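(* For $\varrho_+=1/20$ and $\varrho_-=-1/20$ put $$\mathcal B_+=[-0.50197275145282727,-0.50197275125282725]\times[-0.035947758939822244,-0.035947758739822241],$$ $$\mathcal B_-=[-0.49802749511679928,-0.49802749491679926]\times[0.035928499838247668,0.035928500038247671].$$ For each sign there is exactly one pair $(a_0,a_1)\in\mathcal B_\pm$ such that, with $\varrho=\varrho_\pm$, $\chi(1)=\lambda^-(1)=0$. At these two parameter points: for $\varrho=1/20$: $\det D_{(a_0,a_1)}(\chi(1),\lambda^-(1))\in[1.1941593312,1.1941593352]$ and $(\lambda^-)'(1)\in[-0.1048330993,-0.1048330959]$; for $\varrho=-1/20$: $\det D_{(a_0,a_1)}(\chi(1),\lambda^-(1))\in[1.2001493803,1.2001493843]$ and $(\lambda^-)'(1)\in[0.1050308568,0.1050308603]$. The hits of the tangent orbit on $x=0$ at $T_-$ and $T_+$ are transverse, $B(x)\ge1$ on $[0,1]$, and for $\varrho=1/20$: $\min_{[0,1]}p'\ge0.5120062563$, $\max_{[0,1]}p''\le-0.8476526041$, $p'_-(1)\in[0.5120794896,0.5120794901]$, $\beta_{\rm bio}\in[0.3413863264,0.3413863267]$; for $\varrho=-1/20$: $\min_{[0,1]}p'\ge0.4878590474$, $\max_{[0,1]}p''\le-0.9570619837$, $p'_-(1)\in[0.4879010047,0.4879010052]$, $\beta_{\rm bio}\in[0.3252673364,0.3252673368]$. Hence at both points: the response is positive for $x>0$, strictly increasing and strictly concave on $[0,1]$ with $p'_-(1)>0=p'_+(1)$; the grazing mismatch $\beta_{\rm bio}$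 is nonzero; $(\lambda^-)'(1)\neq 0$ with $\operatorname{sgn}(\lambda^-)'(1)=-\operatorname{sgn}\varrho$; and $\det D_{(a_0,a_1)}(\chi(1),\lambda^-(1))\ne0$.
   Context: For parameters $(a_0,a_1,\varrho)$ let $B(x)=1+(x-1)(a_0+a_1x+\varrho x^2)$, $g(x)=(1-x/3)/B(x)$, and let the cutoff response be $p(x)=xB(x)$ for $0\le x\le1$ and $p(x)=1$ for $x\ge1$; derivatives on $[0,1]$ are those of the polynomial $xB(x)$, and $p'_\pm(1)$ are one-sided derivatives. For $x_0$ near $1$ let $(X,Y)$ solve $\dot x=g(x)-y$, $\dot y=y$ with $X(0)=x_0$, $Y(0)=g(x_0)$ (polynomial $B$ used also across $x=1$), and let $T_-<0<T_+$ be its hits on $x=0$. Define $$\chi(1)=\tfrac23(e^{T_+}-e^{T_-})-g(0)(T_+-T_-)\quad(\text{orbit with }x_0=1;\ g(1)=\tfrac23),\qquad\lambda^-(x_0)=\int_{T_-}^{T_+}g'(X(t))\,dt,$$ with $(\lambda^-)'(1)$ the derivative with respect to $x_0$ at $x_0=1$. The ``tangent orbit'' is the one with $x_0=1$. $\beta_{\rm bio}=\frac23(1+a_0+a_1+\varrho)$. All decimals are exact rationals. *)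

(* Defs.v *)
From Stdlib Require Import Reals ClassicalEpsilon.
From Coquelicot Require Import Coquelicot.
Open Scope R_scope.

Definition B (a0 a1 rho x : R) : R :=
  1 + (x - 1) * (a0 + a1 * x + rho * x ^ 2).

Definition g (a0 a1 rho x : R) : R := (1 - x / 3) / B a0 a1 rho x.

(* The polynomial branch of the cutoff response.  Derivatives of the response
   "on [0,1]" are derivatives of this polynomial, endpoints included. *)
Definition p_poly (a0 a1 rho x : R) : R := x * B a0 a1 rho x.

(* Meaningful for 0 <= x only. *)
Definition p (a0 a1 rho x : R) : R :=
  if Rle_dec x 1 then p_poly a0 a1 rho x else 1.

Definition beta_bio (a0 a1 rho : R) : R := 2 / 3 * (1 + a0 + a1 + rho).

Record trajectory : Type := Trajectory {
  X : R -> R;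
  Y : R -> R;
  Tm : R;
  Tp : R
}.

(* [Tm] and [Tp] are the first backward and forward hits on x = 0; the values
   of [X] and [Y] outside [Tm, Tp] are irrelevant.  The condition on [B] keeps
   the orbit in the domain of g, since division by zero is total. *)
Definition is_orbit (a0 a1 rho x0 : R) (o : trajectory) : Prop :=
  Tm o < 0 < Tp o /\
  X o 0 = x0 /\ Y o 0 = g a0 a1 rho x0 /\
  (forall t, Tm o <= t <= Tp o ->
     B a0 a1 rho (X o t) <> 0 /\
     is_derive (X o) t (g a0 a1 rho (X o t) - Y o t) /\
     is_derive (Y o) t (Y o t)) /\
  X o (Tm o) = 0 /\ X o (Tp o) = 0 /\
  (forall t, Tm o < t < Tp o -> 0 < X o t).

(* By uniqueness for the initial value problem, the hitting times and the
   restriction to [Tm, Tp] do not depend on the choice.  The value is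
   unspecified where no orbit reaches x = 0 in both time directions. *)
Definition orbit (a0 a1 rho x0 : R) : trajectory :=
  epsilon (inhabits (Trajectory (fun _ => 0) (fun _ => 0) 0 0))
    (is_orbit a0 a1 rho x0).

Definition chi1 (a0 a1 rho : R) : R :=
  let o := orbit a0 a1 rho 1 in
  2 / 3 * (exp (Tp o) - exp (Tm o)) - g a0 a1 rho 0 * (Tp o - Tm o).

Definition lambda_minus (a0 a1 rho x0 : R) : R :=
  let o := orbit a0 a1 rho x0 in
  RInt (fun t => Derive (g a0 a1 rho) (X o t)) (Tm o) (Tp o).

Definition transverse_hit (a0 a1 rho : R) (o : trajectory) (T : R) : Prop :=
  X o T = 0 /\ g a0 a1 rho (X o T) - Y o T <> 0.

(* [d] is the determinant of the (total) derivative of (F, G) at (a, b). *)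
Definition is_jacobian_det (F G : R -> R -> R) (a b d : R) : Prop :=
  exists Fa Fb Ga Gb : R,
    differentiable_pt_lim F a b Fa Fb /\
    differentiable_pt_lim G a b Ga Gb /\
    d = Fa * Gb - Fb * Ga.

Definition is_left_derive (f : R -> R) (x l : R) : Prop :=
  filterlim (fun h => (f (x + h) - f x) / h) (at_left 0) (locally l).

Definition is_right_derive (f : R -> R) (x l : R) : Prop :=
  filterlim (fun h => (f (x + h) - f x) / h) (at_right 0) (locally l).

Definition is_min_on (f : R -> R) (a b m : R) : Prop :=
  (exists x, a <= x <= b /\ f x = m) /\ (forall x, a <= x <= b -> m <= f x).

Definition is_max_on (f : R -> R) (a b m : R) : Prop :=
  (exists x, a <= x <= b /\ f x = m) /\ (forall x, a <= x <= b -> f x <= m).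

Definition strictly_increasing_on (f : R -> R) (a b : R) : Prop :=
  forall x y, a <= x -> x < y -> y <= b -> f x < f y.

Definition strictly_concave_on (f : R -> R) (a b : R) : Prop :=
  forall x y s, a <= x -> x < y -> y <= b -> 0 < s < 1 ->
    s * f x + (1 - s) * f y < f (s * x + (1 - s) * y).

Definition B_plus (a0 a1 : R) : Prop :=
  -0.50197275145282727 <= a0 <= -0.50197275125282725 /\
  -0.035947758939822244 <= a1 <= -0.035947758739822241.

Definition B_minus (a0 a1 : R) : Prop :=
  -0.49802749511679928 <= a0 <= -0.49802749491679926 /\
  0.035928499838247668 <= a1 <= 0.035928500038247671.

Definition parameter_box (rho a0 a1 : R) : Prop :=
  (rho = 1 / 20 /\ B_plus a0 a1) \/ (rho = -1 / 20 /\ B_minus a0 a1).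

Definition parameter_point (rho a0 a1 : R) : Prop :=
  parameter_box rho a0 a1 /\
  chi1 a0 a1 rho = 0 /\ lambda_minus a0 a1 rho 1 = 0.

(* Main.v *)
(* For a0 = -1/2, a1 = rho = 0 the function g is the constant 2/3, and over the
   parameter boxes g stays so close to it that |g'| <= 1/6 along the orbits.
   Hence Picard iteration contracts on the whole time interval [-2.7, 1.45], X
   increases before its tangency with g and decreases after it, and errors in
   the equation are amplified by a factor of at most 2.

   Smooth dependence on (a0, a1, x0) is obtained by expanding X, the integral
   of g'(X) and the hitting times to second order with uniform remainders; the
   first-order terms solve variational equations.  As X' T' = - dX at a hit T, the
   derivative of chi(1) reduces to values of these solutions at the two hits.

   The values at the hits are enclosed by integer arithmetic: polynomials in
   time are given for each of the two branches of the orbit, and the residual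
   with which they satisfy the equations bounds their error.  A rough enclosure
   of the Jacobian over the box makes the Newton map a contraction, a sharp one
   of (chi(1), lambda^-(1)) at the centre places the zero within 4 * 10^-15 of
   the centre, and a sharp enclosure of the derivatives on that small square
   gives the stated bounds. *)

Require Import Defs.
From Stdlib Require Import Reals Lra Lia Psatz ZArith List ClassicalEpsilon.
From Coquelicot Require Import Coquelicot.
Import ListNotations.
Open Scope R_scope.

(** * Real analysis *)

(** Since Y(0) = g(x0), the orbit starts with velocity zero, so transversality is absent at the
    start and has to be won quantitatively: |X'| is at least t/4 forward, but only |t|/20 backward,
    and the hits are kept away from time 0. Because 1/6 * 27/10 is below 1/2, Gronwall estimates for
    X are replaced by absorption into a maximum, without exponential constants. As Y = g(x0) e^t
    explicitly, only a scalar equation for X remains. Expansions with quadratic remainders are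
    closed under sums, products and inverses, so second partial derivatives in the parameters never
    have to be bounded; differentiability is read off at the end. Only a0, a1 and x0 vary: |rho| =
    1/20 lies on the boundary of the admissible range. The contraction test on the whole box asks
    for about two digits of the Jacobian, so a low precision serves there; the sharp values are
    computed only on the far smaller square around the zero. *)

Lemma is_derive_eq (f : R -> R) (x l l' : R) :
  is_derive f x l -> l = l' -> is_derive f x l'.
Proof. intros H <-; exact H. Qed.

Lemma derive_plus (f g : R -> R) (x lf lg : R) :
  is_derive f x lf -> is_derive g x lg ->
  is_derive (fun t => f t + g t) x (lf + lg).
Proof. intros Hf Hg; exact (is_derive_plus f g x lf lg Hf Hg). Qed.

Lemma derive_minus (f g : R -> R) (x lf lg : R) :
  is_derive f x lf -> is_derive g x lg ->
  is_derive (fun t => f t - g t) x (lf - lg).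
Proof. intros Hf Hg; exact (is_derive_minus f g x lf lg Hf Hg). Qed.

Lemma derive_scal (f : R -> R) (x k lf : R) :
  is_derive f x lf -> is_derive (fun t => k * f t) x (k * lf).
Proof. intros Hf; exact (is_derive_scal f x k lf Hf). Qed.

Lemma derive_mult (f g : R -> R) (x lf lg : R) :
  is_derive f x lf -> is_derive g x lg ->
  is_derive (fun t => f t * g t) x (lf * g x + f x * lg).
Proof. intros Hf Hg; apply (is_derive_mult f g x lf lg Hf Hg); intros; apply Rmult_comm. Qed.

Lemma derive_comp (f g : R -> R) (x lf lg : R) :
  is_derive f (g x) lf -> is_derive g x lg ->
  is_derive (fun t => f (g t)) x (lg * lf).
Proof. intros Hf Hg; exact (is_derive_comp f g x lf lg Hf Hg). Qed.

Lemma derive_continuous (f : R -> R) (x l : R) : is_derive f x l -> continuous f x.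
Proof. intros H; apply (@ex_derive_continuous R_AbsRing R_NormedModule f x); now exists l. Qed.

Lemma derive_continuity_pt (f : R -> R) (x l : R) : is_derive f x l -> continuity_pt f x.
Proof. intros H; apply continuity_pt_filterlim; exact (derive_continuous f x l H). Qed.

Lemma derive_RInt (f : R -> R) (t : R) :
  (forall s, continuous f s) -> is_derive (fun t => RInt f 0 t) t (f t).
Proof.
  intros Hf; apply (is_derive_RInt f (fun t => RInt f 0 t) 0 t); [|apply Hf].
  apply filter_forall; intros u; apply (RInt_correct f), (ex_RInt_continuous f); intros; apply Hf.
Qed.

Lemma RInt_0 (f : R -> R) : RInt f 0 0 = 0.
Proof. exact (RInt_point 0 f). Qed.

Lemma mvt_between (f df : R -> R) (u v : R) :
  (forall t, Rmin u v <= t <= Rmax u v -> is_derive f t (df t)) ->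
  exists c, Rmin u v <= c <= Rmax u v /\ f v - f u = df c * (v - u).
Proof.
  intros H; destruct (MVT_gen f u v df) as [c Hc].
  - intros; apply H; lra.
  - intros x Hx; apply (derive_continuity_pt f x (df x)), H, Hx.
  - exists c; exact Hc.
Qed.

Lemma mvt_bound (f df : R -> R) (u v M : R) :
  (forall t, Rmin u v <= t <= Rmax u v -> is_derive f t (df t)) ->
  (forall t, Rmin u v <= t <= Rmax u v -> Rabs (df t) <= M) ->
  Rabs (f v - f u) <= M * Rabs (v - u).
Proof.
  intros H HM; destruct (mvt_between f df u v H) as [c [Hc E]].
  rewrite E, Rabs_mult; apply Rmult_le_compat_r; [apply Rabs_pos|auto].
Qed.

Lemma between_sub (a b u v t : R) :
  a <= u <= b -> a <= v <= b -> Rmin u v <= t <= Rmax u v -> a <= t <= b.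
Proof. intros ? ?; unfold Rmin, Rmax; destruct (Rle_dec u v); lra. Qed.

Lemma abs_bounds (x e : R) : Rabs x <= e -> - e <= x <= e.
Proof. intros H; unfold Rabs in H; destruct (Rcase_abs x); lra. Qed.

Lemma abs_le (x e : R) : - e <= x <= e -> Rabs x <= e.
Proof. intros H; apply Rabs_le; lra. Qed.

(** At a maximum point m of |phi| the mean value theorem gives |phi m| <= d + (L |phi m| + eps) T,
    and L T <= 1/2 absorbs the term with |phi m|. This stands in for Gronwall's inequality; the
    factor 2 is the price of the absorption. *)
Lemma comparison (phi dphi : R -> R) (a b L T eps d : R) :
  a <= 0 <= b -> 0 <= L -> 0 <= eps -> - T <= a -> b <= T -> L * T <= 1 / 2 ->
  (forall t, a <= t <= b -> is_derive phi t (dphi t)) ->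
  (forall t, a <= t <= b -> Rabs (dphi t) <= L * Rabs (phi t) + eps) ->
  Rabs (phi 0) <= d ->
  forall t, a <= t <= b -> Rabs (phi t) <= 2 * (d + eps * T).
Proof.
  intros Hab HL He HTa HTb HLT Hd Hb H0 t Ht.
  destruct (continuity_ab_maj (fun t => Rabs (phi t)) a b) as [m [Hmab Hm]]; [lra| |].
  { intros c Hc; apply (continuity_pt_comp phi Rabs).
    - apply (derive_continuity_pt phi c (dphi c)); auto.
    - apply Rcontinuity_abs. }
  assert (HM : Rabs (phi m - phi 0) <= (L * Rabs (phi m) + eps) * Rabs (m - 0)).
  { apply mvt_bound with dphi.
    - intros s Hs; apply Hd; apply (between_sub a b 0 m s); auto.
    - intros s Hs; assert (Hs' : a <= s <= b) by (apply (between_sub a b 0 m s); auto).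
      apply Rle_trans with (1 := Hb s Hs').
      apply Rplus_le_compat_r, Rmult_le_compat_l; auto. }
  assert (Hmm : Rabs (m - 0) <= T) by (apply abs_le; lra).
  assert (P1 := Rabs_pos (phi m)); assert (P2 := Rabs_pos (m - 0)).
  assert (Rabs (phi m) <= Rabs (phi m - phi 0) + Rabs (phi 0)).
  { replace (phi m) with ((phi m - phi 0) + phi 0) at 1 by ring; apply Rabs_triang. }
  assert ((L * Rabs (phi m) + eps) * Rabs (m - 0) <= (L * Rabs (phi m) + eps) * T).
  { apply Rmult_le_compat_l; [|lra]. assert (0 <= L * Rabs (phi m)) by (apply Rmult_le_pos; lra); lra. }
  assert (L * Rabs (phi m) * T <= 1 / 2 * Rabs (phi m)).
  { replace (L * Rabs (phi m) * T) with (L * T * Rabs (phi m)) by ring.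
    apply Rmult_le_compat_r; lra. }
  specialize (Hmab t Ht); simpl in Hmab; lra.
Qed.

Definition clamp (a b t : R) : R := Rmax a (Rmin b t).

Lemma clamp_range (a b t : R) : a <= b -> a <= clamp a b t <= b.
Proof. intros; unfold clamp, Rmax, Rmin; repeat destruct Rle_dec; lra. Qed.

Lemma clamp_id (a b t : R) : a <= t <= b -> clamp a b t = t.
Proof. intros; unfold clamp, Rmax, Rmin; repeat destruct Rle_dec; lra. Qed.

Lemma clamp_lip (a b s t : R) : Rabs (clamp a b s - clamp a b t) <= Rabs (s - t).
Proof.
  unfold clamp, Rmax, Rmin; repeat destruct Rle_dec;
  unfold Rabs; repeat destruct Rcase_abs; lra.
Qed.

Lemma lipschitz_continuous (f : R -> R) (L : R) :
  (forall x y, Rabs (f x - f y) <= L * Rabs (x - y)) -> forall x, continuous f x.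
Proof.
  intros H x; apply continuity_pt_filterlim; intros eps Heps.
  assert (HL : 0 <= L).
  { specialize (H 1 0); replace (1 - 0) with 1 in H by ring; rewrite Rabs_R1 in H.
    assert (Hp := Rabs_pos (f 1 - f 0)); lra. }
  exists (eps / (L + 1)); split; [apply Rdiv_lt_0_compat; lra|].
  intros y [_ Hy]; simpl in *; unfold R_dist in *.
  apply Rle_lt_trans with (1 := H y x).
  apply Rle_lt_trans with (L * (eps / (L + 1))).
  - apply Rmult_le_compat_l; lra.
  - replace (L * (eps / (L + 1))) with (eps - eps / (L + 1)) by (field; lra).
    assert (0 < eps / (L + 1)) by (apply Rdiv_lt_0_compat; lra); lra.
Qed.

Lemma clamp_continuous (a b t : R) : continuous (clamp a b) t.
Proof. apply (lipschitz_continuous (clamp a b) 1); intros; rewrite Rmult_1_l; apply clamp_lip. Qed.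

Lemma uniform_limit_continuous (f : nat -> R -> R) (l : R -> R) (e : nat -> R) :
  is_lim_seq e 0 -> (forall n t, Rabs (f n t - l t) <= e n) ->
  (forall n t, continuous (f n) t) -> forall t, continuous l t.
Proof.
  intros He Hf Hc t; apply continuity_pt_filterlim; intros eps Heps.
  apply is_lim_seq_spec in He; destruct (He (mkposreal (eps / 3) ltac:(lra))) as [N HN].
  specialize (HN N (le_n N)); simpl in HN; rewrite Rminus_0_r in HN; apply Rabs_lt_between in HN.
  specialize (Hc N t); apply continuity_pt_filterlim in Hc.
  destruct (Hc (eps / 3)) as [d [Hd Hd']]; [lra|].
  exists d; split; [exact Hd|]; intros y Hy; specialize (Hd' y Hy); simpl in *; unfold R_dist in *.
  replace (l y - l t) with (- (f N y - l y) + (f N y - f N t) + (f N t - l t)) by ring.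
  assert (A1 := Hf N y); assert (A2 := Hf N t).
  assert (A3 := Rabs_triang (- (f N y - l y) + (f N y - f N t)) (f N t - l t)).
  assert (A4 := Rabs_triang (- (f N y - l y)) (f N y - f N t)).
  rewrite Rabs_Ropp in A4; lra.
Qed.

Lemma half_pow_lim (K : R) : is_lim_seq (fun n => K * (1 / 2) ^ n) 0.
Proof.
  replace (Finite 0) with (Rbar_mult K 0) by (simpl; now rewrite Rmult_0_r).
  apply is_lim_seq_scal_l, is_lim_seq_geom; rewrite Rabs_right; lra.
Qed.

Lemma geometric_cauchy (u : nat -> R) (K : R) :
  (forall n, Rabs (u (S n) - u n) <= K * (1 / 2) ^ n) ->
  exists l : R, is_lim_seq u l /\ forall n, Rabs (u n - l) <= 2 * K * (1 / 2) ^ n.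
Proof.
  intros H.
  (* The factor 1 - (1/2)^k is the exact geometric sum, which makes the induction close. *)
  assert (Hk : forall k n, Rabs (u (n + k)%nat - u n) <= 2 * K * (1 / 2) ^ n * (1 - (1 / 2) ^ k)).
  { induction k; intros n.
    - rewrite Nat.add_0_r, Rminus_diag, Rabs_R0; simpl; lra.
    - replace (n + S k)%nat with (S (n + k)) by lia.
      specialize (IHk n); specialize (H (n + k)%nat).
      replace (u (S (n + k)) - u n) with ((u (S (n + k)) - u (n + k)%nat) + (u (n + k)%nat - u n)) by ring.
      apply Rle_trans with (1 := Rabs_triang _ _).
      rewrite pow_add in H; simpl pow at 2; nra. }
  assert (HK : 0 <= K).
  { specialize (H 0%nat); assert (P := Rabs_pos (u 1%nat - u 0%nat)); simpl in H; lra. }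
  assert (Hb : forall k n, Rabs (u (n + k)%nat - u n) <= 2 * K * (1 / 2) ^ n).
  { intros k n; apply Rle_trans with (1 := Hk k n).
    assert (0 < (1 / 2) ^ n) by (apply pow_lt; lra).
    assert (0 < (1 / 2) ^ k) by (apply pow_lt; lra).
    assert (0 <= 2 * K * (1 / 2) ^ n) by (apply Rmult_le_pos; lra); nra. }
  assert (Hc : ex_finite_lim_seq u).
  { apply ex_lim_seq_cauchy_corr; intros eps.
    assert (L := half_pow_lim (4 * K)); apply is_lim_seq_spec in L; destruct (L eps) as [N HN].
    specialize (HN N (le_n N)); rewrite Rminus_0_r in HN; apply Rabs_lt_between in HN.
    exists N; intros n m Hn Hm.
    assert (A := Hb (n - N)%nat N); assert (B := Hb (m - N)%nat N).
    replace (N + (n - N))%nat with n in A by lia; replace (N + (m - N))%nat with m in B by lia.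
    replace (u n - u m) with ((u n - u N) + - (u m - u N)) by ring.
    apply Rle_lt_trans with (1 := Rabs_triang _ _); rewrite Rabs_Ropp; lra. }
  destruct Hc as [l Hl]; exists l; split; [exact Hl|]; intros n.
  assert (Hl' : is_lim_seq (fun k => Rabs (u (n + k)%nat - u n)) (Rabs (l - u n))).
  { apply (is_lim_seq_abs _ (Finite (l - u n))).
    apply (is_lim_seq_minus' _ _ l (u n)); [|apply is_lim_seq_const].
    apply is_lim_seq_ext with (fun k => u (k + n)%nat); [intros; f_equal; lia|].
    now apply is_lim_seq_incr_n. }
  rewrite Rabs_minus_sym.
  exact (is_lim_seq_le _ _ _ _ (fun k => Hb k n) Hl' (is_lim_seq_const _)).
Qed.

(* Freezing time outside [a, b] makes the solution differentiable on the whole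
   line, so no one-sided derivatives occur at a and b. *)
Lemma picard (G h : R -> R) (x0 a b L T : R) :
  a <= 0 <= b -> - T <= a -> b <= T -> L * T <= 1 / 2 ->
  (forall x y, Rabs (G x - G y) <= L * Rabs (x - y)) ->
  (forall t, continuous h t) ->
  exists x : R -> R, x 0 = x0 /\ forall t, is_derive x t (G (x (clamp a b t)) + h t).
Proof.
  intros Hab HTa HTb HLT HG Hh.
  assert (HGc := lipschitz_continuous G L HG).
  assert (HL : 0 <= L).
  { specialize (HG 1 0); replace (1 - 0) with 1 in HG by ring; rewrite Rabs_R1 in HG.
    assert (Hp := Rabs_pos (G 1 - G 0)); lra. }
  pose (F := fun (v : R -> R) s => G (v (clamp a b s)) + h s).
  pose (pic := fix pic n := match n with O => fun _ : R => x0
               | S n => fun t => x0 + RInt (F (pic n)) 0 t end).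
  assert (HF : forall v, (forall t, continuous v t) -> forall t, continuous (F v) t).
  { intros v Hv t; unfold F; apply (continuous_plus (fun s => G (v (clamp a b s))) h); [|apply Hh].
    apply (continuous_comp (fun s => v (clamp a b s)) G); [|apply HGc].
    apply (continuous_comp (clamp a b) v); [apply clamp_continuous|apply Hv]. }
  assert (HFd : forall v, (forall t, continuous v t) -> forall t,
    is_derive (fun t => x0 + RInt (F v) 0 t) t (F v t)).
  { intros v Hv t; apply is_derive_eq with (0 + F v t); [|ring].
    apply derive_plus; [apply (is_derive_const x0 t)|apply derive_RInt, HF, Hv]. }
  assert (Hpc : forall n t, continuous (pic n) t).
  { induction n; intros t; [apply continuous_const|].
    exact (derive_continuous _ _ _ (HFd _ IHn t)). }
  (* One Picard step halves the distance on [a, b]: the integrand evaluates its argument at clamped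
     times only. *)
  assert (Hstep : forall v w D, (forall t, continuous v t) -> (forall t, continuous w t) -> 
    (forall t, a <= t <= b -> Rabs (v t - w t) <= D) ->
    forall t, a <= t <= b -> Rabs ((x0 + RInt (F v) 0 t) - (x0 + RInt (F w) 0 t)) <= D / 2).
  { intros v w D Hv Hw HD t Ht.
    assert (A := mvt_bound (fun t => (x0 + RInt (F v) 0 t) - (x0 + RInt (F w) 0 t))
       (fun t => F v t - F w t) 0 t (L * D)).
    assert (HD0 : 0 <= D) by (apply Rle_trans with (2 := HD 0 ltac:(lra)), Rabs_pos).
    cbv beta in A; rewrite !RInt_0, Rminus_diag, !Rminus_0_r in A.
    apply Rle_trans with (L * D * Rabs t).
    - apply A; intros s _.
      + apply derive_minus; apply HFd; auto.
      + unfold F; replace (G (v (clamp a b s)) + h s - (G (w (clamp a b s)) + h s))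
          with (G (v (clamp a b s)) - G (w (clamp a b s))) by ring.
        apply Rle_trans with (1 := HG _ _), Rmult_le_compat_l; [lra|].
        apply HD, clamp_range; lra.
    - assert (Rabs t <= T) by (apply abs_le; lra). assert (0 <= Rabs t) by apply Rabs_pos.
      assert (0 <= L * D) by nra. nra. }
  destruct (continuity_ab_maj (fun t => Rabs (pic 1%nat t - pic 0%nat t)) a b) as [m [Hm _]]; [lra| |].
  { intros c _; apply (continuity_pt_comp (fun t => pic 1%nat t - pic 0%nat t) Rabs); [|apply Rcontinuity_abs].
    apply continuity_pt_filterlim, (continuous_minus (pic 1%nat) (pic 0%nat)); apply Hpc. }
  simpl in Hm; set (K := Rabs (x0 + RInt (F (fun _ => x0)) 0 m - x0)) in Hm.
  assert (Hn : forall n t, a <= t <= b -> Rabs (pic (S n) t - pic n t) <= K * (1 / 2) ^ n).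
  { induction n; intros t Ht; [simpl; rewrite Rmult_1_r; apply Hm, Ht|].
    replace (K * (1 / 2) ^ S n) with (K * (1 / 2) ^ n / 2) by (simpl; field).
    apply (Hstep (pic (S n)) (pic n)); auto. }
  (* The limit is taken at clamped times, where the iterates are known to converge, so [V] is
     continuous on the whole line. *)
  pose (V := fun t => real (Lim_seq (fun n => pic n (clamp a b t)))).
  assert (HV : forall t, is_lim_seq (fun n => pic n (clamp a b t)) (V t) /\
     forall n, Rabs (pic n (clamp a b t) - V t) <= 2 * K * (1 / 2) ^ n).
  { intros t; destruct (geometric_cauchy (fun n => pic n (clamp a b t)) K) as [l [Hl Hl']].
    - intros n; apply Hn, clamp_range; lra.
    - assert (E : V t = l) by (unfold V; now rewrite (is_lim_seq_unique _ _ Hl)).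
      rewrite <- E in Hl, Hl'; split; [exact Hl|exact Hl']. }
  assert (HVc : forall t, continuous V t).
  { apply (uniform_limit_continuous (fun n t => pic n (clamp a b t)) V (fun n => 2 * K * (1 / 2) ^ n)).
    - apply half_pow_lim.
    - intros n t; apply HV.
    - intros n t; apply (continuous_comp (clamp a b) (pic n)); [apply clamp_continuous|apply Hpc]. }
  assert (HVeq : forall t, a <= t <= b -> V t = x0 + RInt (F V) 0 t).
  { intros t Ht.
    assert (L1 : is_lim_seq (fun n => pic (S n) t) (V t)).
    { apply is_lim_seq_incr_1 with (u := fun n => pic n t).
      apply is_lim_seq_ext with (fun n => pic n (clamp a b t)); [intros; now rewrite clamp_id|apply HV]. }
    assert (L2 : is_lim_seq (fun n => pic (S n) t) (x0 + RInt (F V) 0 t)).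
    { apply is_lim_seq_le_le with
        (fun n => (x0 + RInt (F V) 0 t) - K * (1 / 2) ^ n) (fun n => (x0 + RInt (F V) 0 t) + K * (1 / 2) ^ n).
      - intros n; assert (A := Hstep (pic n) V (2 * K * (1 / 2) ^ n) (Hpc n) HVc).
        assert (A' := fun H => A H t Ht); apply abs_bounds in A'.
        + change (pic (S n) t) with (x0 + RInt (F (pic n)) 0 t); lra.
        + intros s Hs; rewrite <- (clamp_id a b s Hs) at 1; apply HV.
      - replace (Finite (x0 + RInt (F V) 0 t)) with (Rbar_minus (x0 + RInt (F V) 0 t) 0) at 1
          by (simpl; f_equal; ring).
        apply is_lim_seq_minus'; [apply is_lim_seq_const|apply half_pow_lim].
      - replace (Finite (x0 + RInt (F V) 0 t)) with (Rbar_plus (x0 + RInt (F V) 0 t) 0) at 1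
          by (simpl; f_equal; ring).
        apply is_lim_seq_plus'; [apply is_lim_seq_const|apply half_pow_lim]. }
    assert (E := is_lim_seq_unique _ _ L1); rewrite (is_lim_seq_unique _ _ L2) in E; now injection E. }
  exists (fun t => x0 + RInt (F V) 0 t); split; [rewrite RInt_0; ring|].
  intros t; apply is_derive_eq with (F V t); [apply HFd, HVc|].
  unfold F at 1; f_equal; f_equal.
  rewrite <- HVeq by (apply clamp_range; lra).
  unfold V; rewrite (clamp_id a b (clamp a b t)); [reflexivity|apply clamp_range; lra].
Qed.

(** Variation of constants with the integrating factor e^E. A linear equation is solved on the whole
    line at once, whatever the size of its coefficients. *)
Lemma linear_ode (al be : R -> R) (k : R) :
  (forall t, continuous al t) -> (forall t, continuous be t) ->
  exists x : R -> R, x 0 = k /\ forall t, is_derive x t (al t * x t + be t).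
Proof.
  intros Ha Hb.
  pose (E := (fun t => RInt al 0 t) : R -> R).
  assert (HE : forall t, is_derive E t (al t)) by (intros; apply derive_RInt, Ha).
  assert (Hexp : forall t, is_derive (fun t => exp (E t)) t (al t * exp (E t))).
  { intros t; apply (derive_comp exp E); [apply is_derive_exp|apply HE]. }
  assert (Hc : forall t, continuous (fun s => / exp (E s) * be s) t).
  { intros t; apply (continuous_mult (fun s => / exp (E s)) be); [|apply Hb].
    apply (continuous_comp (fun s => exp (E s)) Rinv); [exact (derive_continuous _ _ _ (Hexp t))|].
    apply continuity_pt_filterlim, (continuity_pt_inv id);
      [apply derivable_continuous_pt, derivable_pt_id|apply Rgt_not_eq, exp_pos]. }
  exists (fun t => exp (E t) * (k + RInt (fun s => / exp (E s) * be s) 0 t)); split.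
  - unfold E; rewrite !RInt_0, exp_0; ring.
  - intros t.
    assert (HI := derive_RInt (fun s => / exp (E s) * be s) t Hc).
    assert (HI' := derive_plus (fun _ => k) _ t 0 _ (is_derive_const k t) HI).
    apply is_derive_eq with (al t * exp (E t) * (k + RInt (fun s => / exp (E s) * be s) 0 t)
       + exp (E t) * (0 + / exp (E t) * be t)).
    + exact (derive_mult _ _ t _ _ (Hexp t) HI').
    + assert (exp (E t) <> 0) by (apply Rgt_not_eq, exp_pos). field; auto.
Qed.

(** Supplies the bootstrap in [orbit_below_fwd] and [orbit_below_bwd]: an orbit exceeding a level
    has a first time at which it reaches it, and estimates hold up to then. That time is the
    supremum of the t for which f stays at most m on [0, t]. *)
Lemma first_crossing (f : R -> R) (m b : R) :
  0 <= b -> (forall t, 0 <= t <= b -> continuity_pt f t) -> f 0 < m -> m < f b ->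
  exists s, 0 <= s <= b /\ f s = m /\ forall u, 0 <= u <= s -> f u <= m.
Proof.
  intros Hb Hc H0 H1.
  destruct (completeness (fun t => 0 <= t <= b /\ forall u, 0 <= u <= t -> f u <= m)) as [s [Hs1 Hs2]].
  { exists b; intros t [Ht _]; lra. }
  { exists 0; split; [lra|]; intros u Hu; replace u with 0 by lra; lra. }
  assert (Hs0 : 0 <= s) by (apply Hs1; split; [lra|]; intros u Hu; replace u with 0 by lra; lra).
  assert (Hsb : s <= b) by (apply Hs2; intros t [Ht _]; lra).
  assert (Hlt : forall u, 0 <= u < s -> f u <= m).
  { intros u Hu; destruct (Rle_dec (f u) m) as [|N]; [assumption|exfalso].
    assert (s <= u); [|lra]. apply Hs2; intros t [Ht Ht'].
    destruct (Rle_dec t u); [assumption|]. exfalso; apply N, Ht'; lra. }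
  assert (Hle : f s <= m).
  { destruct (Rle_dec (f s) m) as [|N]; [assumption|exfalso].
    destruct (Req_dec s 0) as [->|Hs]; [lra|].
    destruct (Hc s ltac:(lra) (f s - m)) as [d [Hd Hd']]; [lra|].
    pose (u := Rmax (s / 2) (s - d / 2)).
    assert (Hu : s / 2 <= u /\ s - d / 2 <= u /\ u < s).
    { unfold u; split; [apply Rmax_l|split; [apply Rmax_r|apply Rmax_lub_lt; lra]]. }
    assert (Hx : Rabs (f u - f s) < f s - m).
    { apply Hd'; split; [split; [exact I|lra]|]. simpl; unfold R_dist. rewrite Rabs_left; lra. }
    assert (f u <= m) by (apply Hlt; lra). rewrite Rabs_left1 in Hx; lra. }
  exists s; split; [lra|split].
  - destruct (Req_dec (f s) m) as [|N]; [assumption|exfalso].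
    assert (Hsb' : s < b) by (destruct (Req_dec s b) as [->|]; lra).
    destruct (Hc s ltac:(lra) (m - f s)) as [d [Hd Hd']]; [lra|].
    pose (v := Rmin b (s + d / 2)).
    assert (Hv : v <= b /\ v <= s + d / 2 /\ s < v).
    { unfold v; split; [apply Rmin_l|split; [apply Rmin_r|apply Rmin_glb_lt; lra]]. }
    assert (v <= s); [|lra].
    apply Hs1; split; [lra|]; intros u Hu.
    destruct (Rlt_dec u s); [apply Hlt; lra|].
    destruct (Req_dec u s) as [->|]; [lra|].
    assert (Hx : Rabs (f u - f s) < m - f s).
    { apply Hd'; split; [split; [exact I|lra]|]. simpl; unfold R_dist. rewrite Rabs_right; lra. }
    apply Rabs_def2 in Hx; lra.
  - intros u Hu; destruct (Rlt_dec u s); [apply Hlt; lra|]. replace u with s by lra; assumption.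
Qed.

(** * Bounds on g and the shape of the tangent orbit *)

Definition Bx (a0 a1 rho x : R) : R :=
  a0 + a1 * x + rho * x ^ 2 + (x - 1) * (a1 + 2 * rho * x).

Definition Bxx (a1 rho x : R) : R := 2 * (a1 + 2 * rho * x) + 2 * rho * (x - 1).

(** This and the following definitions are partial derivatives of g. They are written through z =
    1/B, so that a single inverse occurs and the products are those which the Taylor models evaluate
    later. *)
Definition gx (a0 a1 rho x : R) : R :=
  let z := / B a0 a1 rho x in
  - (1 / 3) * z - (1 - x / 3) * z * (z * Bx a0 a1 rho x).

Definition gxx (a0 a1 rho x : R) : R :=
  let z := / B a0 a1 rho x in let u := z * Bx a0 a1 rho x in
  2 / 3 * (z * u) + (1 - x / 3) * z * (2 * (u * u) - z * Bxx a1 rho x).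

Definition ga0 (a0 a1 rho x : R) : R :=
  let z := / B a0 a1 rho x in - ((1 - x / 3) * z * (z * (x - 1))).

Definition ga1 (a0 a1 rho x : R) : R := ga0 a0 a1 rho x * x.

(** Obtained by differentiating [ga0] = - g v in x, where v' = z - v (z B'). *)
Definition gxa0 (a0 a1 rho x : R) : R :=
  let z := / B a0 a1 rho x in let v := z * (x - 1) in
  - (gx a0 a1 rho x * v + (1 - x / 3) * z * (z - v * (z * Bx a0 a1 rho x))).

Definition gxa1 (a0 a1 rho x : R) : R := ga0 a0 a1 rho x + x * gxa0 a0 a1 rho x.

Lemma derive_B (a0 a1 rho x : R) : is_derive (B a0 a1 rho) x (Bx a0 a1 rho x).
Proof. unfold B, Bx; auto_derive; [trivial|ring]. Qed.

Lemma derive_g (a0 a1 rho x : R) :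
  B a0 a1 rho x <> 0 -> is_derive (g a0 a1 rho) x (gx a0 a1 rho x).
Proof.
  intros H; assert (HB := derive_B a0 a1 rho x).
  apply (is_derive_eq (fun x => (1 - x / 3) / B a0 a1 rho x) x
    ((- (1 / 3) * B a0 a1 rho x - (1 - x / 3) * Bx a0 a1 rho x) / (B a0 a1 rho x) ^ 2)).
  - apply (is_derive_div (fun x => 1 - x / 3) (B a0 a1 rho) x (- (1 / 3))); [|exact HB|exact H].
    auto_derive; [trivial|lra].
  - unfold gx; field; exact H.
Qed.

Lemma Derive_g (a0 a1 rho x : R) :
  B a0 a1 rho x <> 0 -> Derive (g a0 a1 rho) x = gx a0 a1 rho x.
Proof. intros; now apply is_derive_unique, derive_g. Qed.

(** Contains both parameter boxes, with slack in a0 and a1 but none in rho. The slack is what allows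
    differentiation in a0 and a1. *)
Definition near (a0 a1 rho : R) : Prop :=
  Rabs (a0 + 1 / 2) <= 3 / 1000 /\ Rabs a1 <= 4 / 100 /\ Rabs rho <= 5 / 100.

Lemma abs_mult_le (x y m n : R) : Rabs x <= m -> Rabs y <= n -> Rabs (x * y) <= m * n.
Proof.
  intros; rewrite Rabs_mult; apply Rmult_le_compat; auto using Rabs_pos.
Qed.

Lemma abs_plus_le (x y m n : R) : Rabs x <= m -> Rabs y <= n -> Rabs (x + y) <= m + n.
Proof. intros; apply Rle_trans with (1 := Rabs_triang x y); lra. Qed.

(* For a0 = -1/2, a1 = rho = 0 the function g is the constant 2/3; the bounds
   are perturbative, with N = 1 - x/3 and h = B - (3 - x)/2. *)
Lemma g_bounds_on (a0 a1 rho x xm m N b Q : R) :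
  near a0 a1 rho -> Rabs x <= xm -> Rabs (x - 1) <= m -> Rabs (1 - x / 3) <= N -> 9 / 10 <= b ->
  Q = 3 / 1000 + 4 / 100 * xm + 5 / 100 * (xm * xm) ->
  b + m * Q <= (3 - x) / 2 -> m * Q <= 6 / 100 * b ->
  m * Q * (1 / 3) + N * (Q + m * (4 / 100 + 2 * (5 / 100 * xm))) <= b * b / 6 ->
  9 / 10 <= B a0 a1 rho x /\ Rabs (gx a0 a1 rho x) <= 1 / 6 /\
  Rabs (g a0 a1 rho x - 2 / 3) <= 4 / 100.
Proof.
  intros [H0 [H1 H2]] Hx Hm HN Hb HQ Hb1 Hb2 Hb3.
  set (q := (a0 + 1 / 2) + (a1 * x + rho * (x * x))).
  assert (Hq : Rabs q <= Q).
  { rewrite HQ; unfold q; replace (3 / 1000 + 4 / 100 * xm + 5 / 100 * (xm * xm))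
      with (3 / 1000 + (4 / 100 * xm + 5 / 100 * (xm * xm))) by ring.
    repeat first [assumption | apply abs_plus_le | apply abs_mult_le]. }
  assert (Hh : Rabs ((x - 1) * q) <= m * Q) by (apply abs_mult_le; assumption).
  assert (Hh' : Rabs (q + (x - 1) * (a1 + 2 * (rho * x))) <= Q + m * (4 / 100 + 2 * (5 / 100 * xm))).
  { assert (Rabs 2 <= 2) by (rewrite Rabs_right; lra).
    repeat first [assumption | apply abs_plus_le | apply abs_mult_le]. }
  assert (EB : B a0 a1 rho x = (3 - x) / 2 + (x - 1) * q) by (unfold B, q; field).
  assert (HB : b <= B a0 a1 rho x) by (apply abs_bounds in Hh; lra).
  assert (HB0 : 0 < B a0 a1 rho x) by lra.
  split; [lra|split].
  (* For B = (3 - x)/2 the numerator of g' vanishes identically; what survives is linear in the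
     perturbation (x - 1) q and its derivative. *)
  - replace (gx a0 a1 rho x) with
      (- (((x - 1) * q * (1 / 3) + (1 - x / 3) * (q + (x - 1) * (a1 + 2 * (rho * x)))) / (B a0 a1 rho x * B a0 a1 rho x))).
    2:{ replace ((x - 1) * q * (1 / 3) + (1 - x / 3) * (q + (x - 1) * (a1 + 2 * (rho * x))))
          with (B a0 a1 rho x * (1 / 3) + (1 - x / 3) * Bx a0 a1 rho x)
          by (rewrite EB; unfold q, Bx; field).
        unfold gx; field; lra. }
    rewrite Rabs_Ropp; unfold Rdiv at 1; rewrite Rabs_mult.
    rewrite (Rabs_right (/ _)) by (apply Rle_ge, Rlt_le, Rinv_0_lt_compat; nra).
    apply Rle_trans with (b * b / 6 * / (B a0 a1 rho x * B a0 a1 rho x)).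
    + apply Rmult_le_compat_r; [apply Rlt_le, Rinv_0_lt_compat; nra|].
      apply Rle_trans with (2 := Hb3), abs_plus_le; apply abs_mult_le; try assumption.
      rewrite Rabs_right; lra.
    + apply Rmult_le_reg_r with (B a0 a1 rho x * B a0 a1 rho x); [nra|].
      rewrite Rmult_assoc, Rinv_l by nra. nra.
  - replace (g a0 a1 rho x - 2 / 3) with (- (2 / 3) * ((x - 1) * q) * / B a0 a1 rho x).
    2:{ replace ((x - 1) * q) with (B a0 a1 rho x - (3 - x) / 2) by (rewrite EB; ring).
        unfold g; field; lra. }
    rewrite Rabs_mult, (Rabs_right (/ _)) by (apply Rle_ge, Rlt_le, Rinv_0_lt_compat; lra).
    apply Rmult_le_reg_r with (B a0 a1 rho x); [lra|].
    rewrite Rmult_assoc, Rinv_l by lra.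
    assert (Rabs (- (2 / 3) * ((x - 1) * q)) <= 2 / 3 * (m * Q)).
    { apply abs_mult_le; [rewrite Rabs_Ropp, Rabs_right; lra|assumption]. }
    lra.
Qed.

(** Near x = 11/10 the main part (3 - x)/2 of B is smallest, near x = -1/2 the weight |x - 1| of the
    perturbation is largest. A single estimate would combine both extremes and fail, so the range is
    cut into four pieces, each with its own lower bound b of B. *)
Lemma g_bounds (a0 a1 rho x : R) :
  near a0 a1 rho -> - (1 / 2) <= x <= 11 / 10 ->
  9 / 10 <= B a0 a1 rho x /\ Rabs (gx a0 a1 rho x) <= 1 / 6 /\
  Rabs (g a0 a1 rho x - 2 / 3) <= 4 / 100.
Proof.
  intros Hn Hx.
  destruct (Rle_dec x 0); [|destruct (Rle_dec x (6 / 10)); [|destruct (Rle_dec x (85 / 100))]].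
  - apply g_bounds_on with (xm := 1 / 2) (m := 3 / 2) (N := 7 / 6) (b := 144 / 100) (6 := eq_refl);
      try assumption; try lra; apply abs_le; lra.
  - apply g_bounds_on with (xm := 6 / 10) (m := 1) (N := 1) (b := 115 / 100) (6 := eq_refl);
      try assumption; try lra; apply abs_le; lra.
  - apply g_bounds_on with (xm := 85 / 100) (m := 4 / 10) (N := 8 / 10) (b := 104 / 100) (6 := eq_refl);
      try assumption; try lra; apply abs_le; lra.
  - apply g_bounds_on with (xm := 11 / 10) (m := 15 / 100) (N := 72 / 100) (b := 93 / 100) (6 := eq_refl);
      try assumption; try lra; apply abs_le; lra.
Qed.

(** Freezing g outside the range of the orbits makes it globally 1/6-Lipschitz, as [picard] demands,
    and avoids zeros of B. By [sol_range] the freezing never acts along the orbit. *)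
Definition gc (a0 a1 rho x : R) : R := g a0 a1 rho (clamp (- (1 / 2)) (11 / 10) x).

Lemma gc_lip (a0 a1 rho x y : R) :
  near a0 a1 rho -> Rabs (gc a0 a1 rho x - gc a0 a1 rho y) <= 1 / 6 * Rabs (x - y).
Proof.
  intros Hn; unfold gc.
  set (u := clamp _ _ x); set (v := clamp _ _ y).
  assert (Hu : - (1 / 2) <= u <= 11 / 10) by (apply clamp_range; lra).
  assert (Hv : - (1 / 2) <= v <= 11 / 10) by (apply clamp_range; lra).
  apply Rle_trans with (1 / 6 * Rabs (u - v)).
  - apply mvt_bound with (df := gx a0 a1 rho); intros t Ht;
      assert (Hb := g_bounds a0 a1 rho t Hn (between_sub _ _ v u t Hv Hu Ht)).
    + apply derive_g; lra.
    + apply Hb.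
  - apply Rmult_le_compat_l; [lra|apply clamp_lip].
Qed.

Lemma gc_near (a0 a1 rho x : R) : near a0 a1 rho -> Rabs (gc a0 a1 rho x - 2 / 3) <= 4 / 100.
Proof. intros Hn; apply (g_bounds a0 a1 rho _ Hn), clamp_range; lra. Qed.

(** The unperturbed orbit 1 + 2/3 (t + 1 - e^t) meets 0 near t = -2.41 and t = 1.35. The window
    contains both times with room to spare and still satisfies 1/6 * 27/10 <= 1/2. *)
Definition ta : R := - (27 / 10).
Definition tb : R := 145 / 100.

(** Y = g(x0) e^t is substituted into the first equation. Time is clamped as in [picard]; on the
    window the clamp is the identity. *)
Definition is_sol (a0 a1 rho x0 : R) (x : R -> R) : Prop :=
  x 0 = x0 /\
  forall t, is_derive x t (gc a0 a1 rho (x (clamp ta tb t)) - g a0 a1 rho x0 * exp t).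

Definition sol (a0 a1 rho x0 : R) : R -> R :=
  epsilon (inhabits (fun _ => 0)) (is_sol a0 a1 rho x0).

Lemma exp_continuous (t : R) : continuous exp t.
Proof. exact (derive_continuous _ _ _ (is_derive_exp t)). Qed.

Lemma sol_spec (a0 a1 rho x0 : R) : near a0 a1 rho -> is_sol a0 a1 rho x0 (sol a0 a1 rho x0).
Proof.
  intros Hn; unfold sol; apply epsilon_spec; unfold is_sol.
  destruct (picard (gc a0 a1 rho) (fun t => - g a0 a1 rho x0 * exp t) x0 ta tb (1 / 6) (27 / 10))
    as [x [Hx Hd]]; unfold ta, tb in *; try lra.
  - intros; now apply gc_lip.
  - intros t; apply (continuous_mult (fun _ => - g a0 a1 rho x0) exp); [apply continuous_const|apply exp_continuous].
  - exists x; split; [exact Hx|]; intros t.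
    apply (is_derive_eq _ _ _ _ (Hd t)); ring.
Qed.

Definition near0 (x0 : R) : Prop := Rabs (x0 - 1) <= 1 / 100.

(** The deviation of g(x0) from 2/3 carries the factor x0 - 1, at most 1/100, so it is far below the
    4/100 of [g_bounds]. With 4/100 the estimate in [sol_ends] would no longer give the sign of x at
    [tb]. *)
Lemma g_start (a0 a1 rho x0 : R) :
  near a0 a1 rho -> near0 x0 -> 665 / 1000 <= g a0 a1 rho x0 <= 668 / 1000.
Proof.
  intros Hn Hx; apply abs_bounds in Hx.
  destruct (g_bounds a0 a1 rho x0 Hn) as [HB _]; [lra|].
  assert (Hq : Rabs (2 / 3 * ((x0 - 1) * ((a0 + 1 / 2) + (a1 * x0 + rho * (x0 * x0)))))
     <= 2 / 3 * (1 / 100 * (3 / 1000 + (4 / 100 * (11 / 10) + 5 / 100 * (11 / 10 * (11 / 10)))))).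
  { destruct Hn as [H0 [H1 H2]].
    assert (Rabs x0 <= 11 / 10) by (apply abs_le; lra).
    assert (Rabs (x0 - 1) <= 1 / 100) by (apply abs_le; lra).
    apply abs_mult_le; [rewrite Rabs_right; lra|].
    repeat first [assumption | apply abs_plus_le | apply abs_mult_le]. }
  apply abs_bounds in Hq.
  assert (E : g a0 a1 rho x0 = 2 / 3 -
     2 / 3 * ((x0 - 1) * ((a0 + 1 / 2) + (a1 * x0 + rho * (x0 * x0)))) * / B a0 a1 rho x0).
  { replace ((x0 - 1) * (a0 + 1 / 2 + (a1 * x0 + rho * (x0 * x0))))
      with (B a0 a1 rho x0 - (3 - x0) / 2) by (unfold B; field).
    unfold g; field; lra. }
  set (q := 2 / 3 * ((x0 - 1) * _)) in *.
  assert (HI : 0 < / B a0 a1 rho x0 <= 10 / 9).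
  { split; [apply Rinv_0_lt_compat; lra|]. replace (10 / 9) with (/ (9 / 10)) by field.
    apply Rinv_le_contravar; lra. }
  assert (HQ : Rabs (q * / B a0 a1 rho x0) <= 8 / 10000 * (10 / 9)).
  { apply abs_mult_le; apply abs_le; lra. }
  apply abs_bounds in HQ; lra.
Qed.

Lemma exp_double (x l u : R) : 0 <= l -> l <= exp x <= u -> l * l <= exp (2 * x) <= u * u.
Proof.
  intros; replace (2 * x) with (x + x) by ring; rewrite exp_plus; split; apply Rmult_le_compat; lra.
Qed.

(** The argument is halved six times, where 1 + x <= e^x <= 1 / (1 - x) is sharp, and the bounds are
    squared back. *)
Lemma exp_1_45 : 419 / 100 <= exp (145 / 100) <= 434 / 100.
Proof.
  assert (H : 1 + 145 / 6400 <= exp (145 / 6400) <= / (1 - 145 / 6400)).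
  { split; [apply exp_ineq1_le|].
    rewrite <- (Rinv_inv (exp _)), <- exp_Ropp.
    apply Rinv_le_contravar; [lra|]. assert (A := exp_ineq1_le (- (145 / 6400))); lra. }
  assert (H0 : 102265 / 100000 <= exp (145 / 6400) <= 102319 / 100000) by (split; lra).
  apply exp_double in H0; [|lra].
  replace (145 / 100) with (2 * (2 * (2 * (2 * (2 * (2 * (145 / 6400))))))) by field.
  do 5 (apply exp_double in H0; [|lra]). lra.
Qed.

Lemma exp_m2_7 : exp (- (27 / 10)) <= 28 / 100.
Proof.
  rewrite exp_Ropp; assert (H := exp_ineq1_le (27 / 10)).
  apply Rle_trans with (/ (1 + 27 / 10)); [apply Rinv_le_contravar; lra|lra].
Qed.

Lemma exp_le_compat (x y : R) : x <= y -> exp x <= exp y.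
Proof. intros [H| ->]; [left; now apply exp_increasing|right; reflexivity]. Qed.

Lemma exp_range_pos (t : R) : 0 <= t <= tb -> 1 + t <= exp t <= 434 / 100.
Proof.
  unfold tb; intros Ht; split; [apply exp_ineq1_le|].
  apply Rle_trans with (2 := proj2 exp_1_45), exp_le_compat; lra.
Qed.

(** 1 + 10/37 t is the chord of the convex function 1 / (1 - t) over [-27/10, 0], and e^t <= 1 / (1
    - t). *)
Lemma exp_range_neg (t : R) : ta <= t <= 0 -> 0 < exp t <= 1 + t * (10 / 37).
Proof.
  unfold ta; intros Ht; split; [apply exp_pos|].
  assert (H := exp_ineq1_le (- t)); rewrite exp_Ropp in H.
  assert (Hp := exp_pos t).
  assert (exp t * (1 + - t) <= 1).
  { apply Rle_trans with (exp t * / exp t); [apply Rmult_le_compat_l; lra|right; field; lra]. }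
  apply Rmult_le_reg_r with (1 - t); [lra|]. nra.
Qed.

(** * Monotonicity of the orbit on either side of the tangency *)

Section Shape.

Variables a0 a1 rho x0 : R.
Hypothesis Hn : near a0 a1 rho.
Hypothesis Hx0 : near0 x0.

Let x := sol a0 a1 rho x0.
Let c := g a0 a1 rho x0.
Let D t := gc a0 a1 rho (x t) - c * exp t.

Lemma sol_0 : x 0 = x0.
Proof. apply (sol_spec a0 a1 rho x0 Hn). Qed.

Lemma sol_derive_c (t : R) : ta <= t <= tb -> is_derive x t (D t).
Proof.
  intros Ht; apply (is_derive_eq _ _ _ _ (proj2 (sol_spec a0 a1 rho x0 Hn) t)).
  now rewrite clamp_id.
Qed.

Lemma sol_continuous (t : R) : continuous x t.
Proof. exact (derive_continuous _ _ _ (proj2 (sol_spec a0 a1 rho x0 Hn) t)). Qed.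

(** Crude bounds on the speed. What counts is that one sixth of them, the resulting drift of g along
    the orbit, stays below the growth of c |e^t - 1|. *)
Lemma sol_move (t : R) : 
  (0 <= t <= tb -> Rabs (x t - x0) <= 23 / 10 * t) /\ (ta <= t <= 0 -> Rabs (x t - x0) <= 71 / 100 * - t).
Proof.
  assert (Hc := g_start _ _ _ _ Hn Hx0); fold c in Hc.
  rewrite <- sol_0; split; intros Ht.
  - replace (23 / 10 * t) with (23 / 10 * Rabs (t - 0)) by (rewrite Rabs_right; lra).
    apply mvt_bound with D; rewrite Rmin_left, Rmax_right by lra; intros s Hs.
    + apply sol_derive_c; unfold ta in *; lra.
    + assert (Hg := gc_near a0 a1 rho (x s) Hn); apply abs_bounds in Hg.
      assert (He := exp_range_pos s ltac:(lra)).
      unfold D; apply abs_le; nra.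
  - replace (71 / 100 * - t) with (71 / 100 * Rabs (t - 0)) by (rewrite Rabs_left1; lra).
    apply mvt_bound with D; rewrite Rmin_right, Rmax_left by lra; intros s Hs.
    + apply sol_derive_c; unfold tb in *; lra.
    + assert (Hg := gc_near a0 a1 rho (x s) Hn); apply abs_bounds in Hg.
      assert (He := exp_range_neg s ltac:(lra)).
      unfold D; apply abs_le; nra.
Qed.

Lemma gc_start : gc a0 a1 rho x0 = c.
Proof. unfold gc, c; rewrite clamp_id; [reflexivity|]. apply abs_bounds in Hx0; lra. Qed.

(** D = (g(X) - c) - c (e^t - 1), and |g(X) - c| is at most 1/6 of the displacement. Per unit of
    time this leaves 0.665 - 2.3/6 > 1/4 forward and 0.665 * 10/37 - 0.71/6 > 1/20 backward. *)
Lemma sol_slope (t : R) :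
  (0 <= t <= tb -> D t <= - t / 4) /\ (ta <= t <= 0 -> - t / 20 <= D t).
Proof.
  assert (Hc := g_start _ _ _ _ Hn Hx0); fold c in Hc.
  assert (HL := gc_lip a0 a1 rho (x t) x0 Hn); rewrite gc_start in HL.
  split; intros Ht; assert (HM := sol_move t).
  - apply proj1 in HM; specialize (HM Ht).
    assert (He := exp_range_pos t Ht).
    assert (HL' : Rabs (gc a0 a1 rho (x t) - c) <= 1 / 6 * (23 / 10 * t)) by lra.
    apply abs_bounds in HL'; unfold D; nra.
  - apply proj2 in HM; specialize (HM Ht).
    assert (He := exp_range_neg t Ht).
    assert (HL' : Rabs (gc a0 a1 rho (x t) - c) <= 1 / 6 * (71 / 100 * - t)) by lra.
    apply abs_bounds in HL'; unfold D; nra.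
Qed.

Lemma sol_decr (s t : R) : 0 <= s -> s < t -> t <= tb -> x t < x s.
Proof.
  intros H0 Hst Ht; destruct (MVT_gen x s t D) as [m [Hm E]].
  - intros u Hu; apply sol_derive_c; rewrite Rmin_left, Rmax_right in Hu by lra; unfold ta; lra.
  - intros u Hu; apply continuity_pt_filterlim, sol_continuous.
  - rewrite Rmin_left, Rmax_right in Hm by lra.
    (* The mean value point may be the endpoint s = 0, where the slope vanishes. In that case the
       interval is halved, and the half away from 0 contributes a strict decrease. *)
    destruct (Req_dec m s) as [->|Hms]; [destruct (Req_dec s 0) as [Hs|Hs]|].
    + assert (HD := proj1 (sol_slope s) ltac:(lra)).
      destruct (mvt_between x D ((s + t) / 2) t) as [k [Hk E']].
      { intros u Hu; apply sol_derive_c; rewrite Rmin_left, Rmax_right in Hu by lra; unfold ta; lra. }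
      destruct (mvt_between x D s ((s + t) / 2)) as [k' [Hk' E'']].
      { intros u Hu; apply sol_derive_c; rewrite Rmin_left, Rmax_right in Hu by lra; unfold ta; lra. }
      rewrite Rmin_left, Rmax_right in Hk, Hk' by lra.
      assert (D k <= - k / 4) by (apply sol_slope; lra).
      assert (D k' <= - k' / 4) by (apply sol_slope; lra). nra.
    + assert (D s <= - s / 4) by (apply sol_slope; lra). nra.
    + assert (D m <= - m / 4) by (apply sol_slope; lra). nra.
Qed.

Lemma sol_incr (s t : R) : ta <= s -> s < t -> t <= 0 -> x s < x t.
Proof.
  intros H0 Hst Ht.
  assert (Hd : forall u v w, Rmin u v <= w <= Rmax u v -> s <= u <= t -> s <= v <= t -> is_derive x w (D w)).
  { intros u v w Hw Hu Hv; assert (s <= w <= t) by exact (between_sub s t u v w Hu Hv Hw).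
    apply sol_derive_c; unfold tb; lra. }
  (* Halving keeps one of the two mean value points away from 0, where the slope vanishes. *)
  destruct (mvt_between x D ((s + t) / 2) t) as [k [Hk E']].
  { intros u Hu; apply (Hd _ _ _ Hu); lra. }
  destruct (mvt_between x D s ((s + t) / 2)) as [k' [Hk' E'']].
  { intros u Hu; apply (Hd _ _ _ Hu); lra. }
  rewrite Rmin_left, Rmax_right in Hk, Hk' by lra.
  assert (- k / 20 <= D k) by (apply sol_slope; lra).
  assert (- k' / 20 <= D k') by (apply sol_slope; lra). nra.
Qed.

(** The function x - 2/3 t + c e^t has derivative g(x) - 2/3, at most 4/100 in size, so the end
    values are explicit up to 4/100 of the elapsed time. *)
Lemma sol_ends : - (1 / 2) <= x ta < 0 /\ - (1 / 2) <= x tb < 0.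
Proof.
  assert (Hc := g_start _ _ _ _ Hn Hx0); fold c in Hc.
  assert (Hx := Hx0); apply abs_bounds in Hx.
  assert (HP : forall t, ta <= t <= tb ->
     Rabs ((x t - 2 / 3 * t + c * exp t) - (x 0 - 2 / 3 * 0 + c * exp 0)) <= 4 / 100 * Rabs (t - 0)).
  { intros t Ht; apply (mvt_bound (fun t => x t - 2 / 3 * t + c * exp t) (fun t => gc a0 a1 rho (x t) - 2 / 3)).
    - intros s Hs; assert (Hs' : ta <= s <= tb)
        by (apply (between_sub ta tb 0 t s); unfold ta, tb in *; lra).
      apply is_derive_eq with (D s - 2 / 3 * 1 + c * exp s); [|unfold D; ring].
      apply derive_plus; [apply derive_minus|].
      + now apply sol_derive_c.
      + apply derive_scal, (is_derive_id s).
      + apply derive_scal, is_derive_exp.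
    - intros s _; now apply gc_near. }
  rewrite sol_0, exp_0 in HP.
  split.
  - assert (HA := HP ta ltac:(unfold ta, tb; lra)).
    unfold ta in *; rewrite (Rabs_left (_ - 0)) in HA by lra; apply abs_bounds in HA.
    assert (H1 := exp_m2_7); assert (H2 := exp_pos (- (27 / 10))). nra.
  - assert (HA := HP tb ltac:(unfold ta, tb; lra)).
    unfold tb in *; rewrite (Rabs_right (_ - 0)) in HA by lra; apply abs_bounds in HA.
    assert (H1 := exp_1_45). nra.
Qed.

(** Monotonicity on both sides of 0 reduces the range to the values at 0 and at the ends of the
    window. This removes the clamp in [gc], so that [sol_derive] can speak of the true g. *)
Lemma sol_range (t : R) : ta <= t <= tb -> - (1 / 2) <= x t <= x0.
Proof.
  intros Ht; destruct sol_ends as [E1 E2]; assert (E0 := sol_0).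
  destruct (Rle_dec 0 t) as [H|H].
  - destruct (Req_dec 0 t) as [<-|]; [apply abs_bounds in Hx0; lra|].
    assert (x t < x 0) by (apply sol_decr; lra).
    destruct (Req_dec t tb) as [->|]; [lra|].
    assert (x tb < x t) by (apply sol_decr; lra). lra.
  - assert (x t < x 0) by (apply sol_incr; lra).
    destruct (Req_dec t ta) as [->|]; [lra|].
    assert (x ta < x t) by (apply sol_incr; lra). lra.
Qed.

Lemma sol_in (t : R) : ta <= t <= tb -> - (1 / 2) <= x t <= 11 / 10.
Proof. intros Ht; assert (H := sol_range t Ht); apply abs_bounds in Hx0; lra. Qed.

Lemma sol_derive (t : R) :
  ta <= t <= tb -> is_derive x t (g a0 a1 rho (x t) - c * exp t).
Proof.
  intros Ht; apply (is_derive_eq _ _ _ _ (sol_derive_c t Ht)).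
  unfold D, gc; rewrite clamp_id; [reflexivity|now apply sol_in].
Qed.

Lemma sol_speed (t : R) : ta <= t <= tb -> Rabs (g a0 a1 rho (x t) - c * exp t) <= 3.
Proof.
  intros Ht; assert (Hc := g_start _ _ _ _ Hn Hx0); fold c in Hc.
  assert (Hg := proj2 (proj2 (g_bounds a0 a1 rho (x t) Hn (sol_in t Ht)))); apply abs_bounds in Hg.
  assert (He : 0 < exp t <= 434 / 100).
  { split; [apply exp_pos|]. apply Rle_trans with (exp tb); [apply exp_le_compat; lra|].
    apply (exp_range_pos tb); unfold tb; lra. }
  apply abs_le; nra.
Qed.

(** By [sol_move] the orbit is still positive at times -3/10 and 3/10. Beyond these times
    [sol_slope] gives |X'| >= 3/200, the uniform transversality on which the expansion of the
    hitting times rests. *)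
Lemma hits_exist : exists hm hp, ta < hm < - (3 / 10) /\ 3 / 10 < hp < tb /\ x hm = 0 /\ x hp = 0.
Proof.
  assert (Hx := Hx0); apply abs_bounds in Hx.
  destruct sol_ends as [E1 E2].
  assert (M1 := proj2 (sol_move (- (3 / 10))) ltac:(unfold ta; lra)).
  assert (M2 := proj1 (sol_move (3 / 10)) ltac:(unfold tb; lra)).
  apply abs_bounds in M1; apply abs_bounds in M2.
  destruct (IVT_gen x ta (- (3 / 10)) 0) as [hm [Hm1 Hm2]].
  { intros t; apply continuity_pt_filterlim, sol_continuous. }
  { rewrite Rmin_left, Rmax_right by lra; lra. }
  destruct (IVT_gen x (3 / 10) tb 0) as [hp [Hp1 Hp2]].
  { intros t; apply continuity_pt_filterlim, sol_continuous. }
  { rewrite Rmin_right, Rmax_left by lra; lra. }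
  unfold ta, tb in *; rewrite Rmin_left, Rmax_right in Hm1, Hp1 by lra.
  exists hm, hp; repeat split; try assumption.
  - destruct (Req_dec hm (- (27 / 10))) as [->|]; lra.
  - destruct (Req_dec hm (- (3 / 10))) as [->|]; lra.
  - destruct (Req_dec hp (3 / 10)) as [->|]; lra.
  - destruct (Req_dec hp (145 / 100)) as [->|]; lra.
Qed.

End Shape.

(** * The two hits and uniqueness of the orbit *)

Definition hm (a0 a1 rho x0 : R) : R :=
  epsilon (inhabits 0) (fun t => ta < t < - (3 / 10) /\ sol a0 a1 rho x0 t = 0).

Definition hp (a0 a1 rho x0 : R) : R :=
  epsilon (inhabits 0) (fun t => 3 / 10 < t < tb /\ sol a0 a1 rho x0 t = 0).

Section Orbit.

Variables a0 a1 rho x0 : R.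
Hypothesis Hn : near a0 a1 rho.
Hypothesis Hx0 : near0 x0.

Notation x := (sol a0 a1 rho x0).
Notation c := (g a0 a1 rho x0).
Notation tm := (hm a0 a1 rho x0).
Notation tp := (hp a0 a1 rho x0).

Lemma hm_spec : ta < tm < - (3 / 10) /\ x tm = 0.
Proof.
  unfold hm; apply epsilon_spec.
  destruct (hits_exist a0 a1 rho x0 Hn Hx0) as [t [_ [H [_ [H' _]]]]]; now exists t.
Qed.

Lemma hp_spec : 3 / 10 < tp < tb /\ x tp = 0.
Proof.
  unfold hp; apply epsilon_spec.
  destruct (hits_exist a0 a1 rho x0 Hn Hx0) as [_ [t [_ [H [_ H']]]]]; now exists t.
Qed.

Lemma hp_unique (t : R) : 0 <= t <= tb -> x t = 0 -> t = tp.
Proof.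
  intros Ht E; destruct hp_spec as [H E'].
  destruct (Rtotal_order t tp) as [L|[L|L]]; [exfalso|exact L|exfalso];
    apply (sol_decr a0 a1 rho x0 Hn Hx0) in L; lra.
Qed.

Lemma hm_unique (t : R) : ta <= t <= 0 -> x t = 0 -> t = tm.
Proof.
  intros Ht E; destruct hm_spec as [H E'].
  destruct (Rtotal_order t tm) as [L|[L|L]]; [exfalso|exact L|exfalso];
    apply (sol_incr a0 a1 rho x0 Hn Hx0) in L; lra.
Qed.

Lemma sol_pos (t : R) : tm < t < tp -> 0 < x t.
Proof.
  intros Ht; destruct hm_spec as [Hm Em]; destruct hp_spec as [Hp Ep].
  destruct (Rle_dec 0 t).
  - rewrite <- Ep; apply (sol_decr a0 a1 rho x0 Hn Hx0); lra.
  - rewrite <- Em; apply (sol_incr a0 a1 rho x0 Hn Hx0); lra.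
Qed.

Lemma canonical_orbit : is_orbit a0 a1 rho x0 (Trajectory x (fun t => c * exp t) tm tp).
Proof.
  destruct hm_spec as [Hm Em]; destruct hp_spec as [Hp Ep].
  unfold is_orbit; simpl; split; [lra|]; split; [now apply sol_0|]; split; [rewrite exp_0; ring|].
  split; [|split; [exact Em|split; [exact Ep|apply sol_pos]]].
  intros t Ht; split; [|split].
  - assert (HB := g_bounds a0 a1 rho (x t) Hn (sol_in a0 a1 rho x0 Hn Hx0 t ltac:(lra))); lra.
  - apply sol_derive; try assumption; lra.
  - apply derive_scal, is_derive_exp.
Qed.

Lemma orbit_spec : is_orbit a0 a1 rho x0 (orbit a0 a1 rho x0).
Proof. unfold orbit; apply epsilon_spec; eexists; exact canonical_orbit. Qed.

Variable o : trajectory.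
Hypothesis Ho : is_orbit a0 a1 rho x0 o.

(** The derivative of Y e^(-t) is zero. *)
Lemma orbit_Y (t : R) : Tm o <= t <= Tp o -> Y o t = c * exp t.
Proof.
  intros Ht; destruct Ho as [HT [_ [HY [HD _]]]].
  assert (H := mvt_bound (fun t => Y o t * exp (- t)) (fun _ => 0) 0 t 0).
  assert (A : Rabs (Y o t * exp (- t) - Y o 0 * exp (- 0)) <= 0 * Rabs (t - 0)).
  { apply H; intros s Hs.
    - assert (Hs' : Tm o <= s <= Tp o) by (apply (between_sub _ _ 0 t s); lra).
      destruct (HD s Hs') as [_ [_ D]].
      apply is_derive_eq with (Y o s * exp (- s) + Y o s * - exp (- s)); [|ring].
      assert (D' : is_derive (fun t => exp (- t)) s (- exp (- s))) by (auto_derive; [trivial|ring]).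
      exact (derive_mult (Y o) (fun t => exp (- t)) s _ _ D D').
    - rewrite Rabs_R0; lra. }
  rewrite Rmult_0_l, Ropp_0, exp_0, HY in A; apply abs_bounds in A.
  assert (E : Y o t * exp (- t) = c) by lra.
  rewrite <- E, Rmult_assoc, <- exp_plus; replace (- t + t) with 0 by ring; rewrite exp_0; ring.
Qed.

Lemma orbit_nonneg (t : R) : Tm o <= t <= Tp o -> 0 <= X o t.
Proof.
  destruct Ho as [_ [_ [_ [_ [H1 [H2 H3]]]]]]; intros Ht.
  destruct (Req_dec t (Tm o)) as [->|]; [lra|].
  destruct (Req_dec t (Tp o)) as [->|]; [lra|].
  left; apply H3; lra.
Qed.

(** [comparison] with eps = d = 0 forces equality. An orbit is nonnegative by definition, so the
    upper bound 11/10 is all that is missing for g to equal [gc] along it. *)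
Lemma orbit_agrees_below (u v : R) :
  u <= 0 <= v -> ta <= u -> v <= tb -> Tm o <= u -> v <= Tp o ->
  (forall t, u <= t <= v -> X o t <= 11 / 10) -> forall t, u <= t <= v -> X o t = x t.
Proof.
  intros H0 Hu Hv Hu' Hv' Hle t Ht.
  assert (Hx := sol_0 a0 a1 rho x0 Hn).
  assert (C : Rabs (X o t - x t) <= 2 * (0 + 0 * (27 / 10))).
  { apply (comparison (fun t => X o t - x t)
      (fun t => (gc a0 a1 rho (X o t) - Y o t) - (gc a0 a1 rho (x t) - c * exp t)) u v (1 / 6));
      unfold ta, tb in *; try lra.
    - intros s Hs; destruct Ho as [_ [_ [_ [HD _]]]].
      apply derive_minus.
      + destruct (HD s ltac:(lra)) as [_ [D _]].
        unfold gc; rewrite clamp_id; [exact D|].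
        split; [|apply Hle; lra]. assert (0 <= X o s) by (apply orbit_nonneg; lra). lra.
      + apply sol_derive_c; try assumption; unfold ta, tb; lra.
    - intros s Hs; rewrite orbit_Y by lra.
      replace (_ - _) with (gc a0 a1 rho (X o s) - gc a0 a1 rho (x s)) by ring.
      assert (L := gc_lip a0 a1 rho (X o s) (x s) Hn); lra.
    - destruct Ho as [_ [-> _]]; rewrite Hx, Rminus_diag, Rabs_R0; lra. }
  apply abs_bounds in C; lra.
Qed.

(** Up to its first passage through 11/10 the orbit equals [sol], which never exceeds x0 < 11/10. *)
Lemma orbit_below_fwd (t : R) : 0 <= t -> t <= tb -> t <= Tp o -> X o t <= 11 / 10.
Proof.
  intros H0 Hb Hp; destruct (Rle_dec (X o t) (11 / 10)) as [|N]; [assumption|exfalso].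
  assert (Ho' := Ho); destruct Ho' as [HT [HX [_ [HD _]]]].
  assert (Hx := Hx0); apply abs_bounds in Hx.
  destruct (first_crossing (X o) (11 / 10) t) as [s [Hs [Es Hle]]]; try lra.
  - intros u Hu; destruct (HD u ltac:(lra)) as [_ [D _]]; exact (derive_continuity_pt _ _ _ D).
  - assert (E := orbit_agrees_below 0 s ltac:(lra) ltac:(unfold ta; lra) ltac:(lra) ltac:(lra) ltac:(lra) Hle s ltac:(lra)).
    assert (R := sol_range a0 a1 rho x0 Hn Hx0 s ltac:(unfold ta; lra)). lra.
Qed.

(** As [first_crossing] looks forward, time is reversed. *)
Lemma orbit_below_bwd (t : R) : t <= 0 -> ta <= t -> Tm o <= t -> X o t <= 11 / 10.
Proof.
  intros H0 Hb Hp; destruct (Rle_dec (X o t) (11 / 10)) as [|N]; [assumption|exfalso].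
  assert (Ho' := Ho); destruct Ho' as [HT [HX [_ [HD _]]]].
  assert (Hx := Hx0); apply abs_bounds in Hx.
  destruct (first_crossing (fun t => X o (- t)) (11 / 10) (- t)) as [s [Hs [Es Hle]]].
  - lra.
  - intros u Hu; destruct (HD (- u) ltac:(lra)) as [_ [D _]].
    apply (continuity_pt_comp Ropp (X o)); [|exact (derive_continuity_pt _ _ _ D)].
    apply continuity_pt_opp, derivable_continuous_pt, derivable_pt_id.
  - rewrite Ropp_0; lra.
  - rewrite Ropp_involutive; lra.
  - assert (E := orbit_agrees_below (- s) 0 ltac:(lra) ltac:(lra) ltac:(unfold tb; lra) ltac:(lra) ltac:(lra)).
    assert (E' := fun H => E H (- s) ltac:(lra)).
    assert (R := sol_range a0 a1 rho x0 Hn Hx0 (- s) ltac:(unfold tb; lra)).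
    assert (X o (- s) = x (- s)); [|lra].
    apply E'; intros u Hu; rewrite <- (Ropp_involutive u); apply Hle; lra.
Qed.

(** Makes the choice in [orbit] harmless: whatever [epsilon] returns has the hits and the values of
    [sol]. *)
Lemma orbit_unique :
  Tm o = tm /\ Tp o = tp /\ forall t, tm <= t <= tp -> X o t = x t.
Proof.
  assert (Ho' := Ho); destruct Ho' as [HT [HX [_ [_ [Em [Ep _]]]]]].
  destruct (sol_ends a0 a1 rho x0 Hn Hx0) as [E1 E2].
  assert (Agree : forall t, ta <= t <= tb -> Tm o <= t <= Tp o -> X o t = x t).
  { intros t Ht Ht'; destruct (Rle_dec 0 t) as [H|H].
    - apply (orbit_agrees_below 0 t); try lra; try (unfold ta; lra).
      intros s Hs; apply orbit_below_fwd; lra.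
    - apply (orbit_agrees_below t 0); try lra; try (unfold tb; lra).
      intros s Hs; apply orbit_below_bwd; lra. }
  (* An orbit still alive at [tb] would equal [sol] there, which is negative. *)
  assert (Hp : Tp o < tb).
  { destruct (Rlt_dec (Tp o) tb) as [|N]; [assumption|exfalso].
    assert (A := Agree tb ltac:(unfold ta, tb; lra) ltac:(unfold tb in *; lra)).
    assert (0 <= X o tb) by (apply orbit_nonneg; unfold tb in *; lra). lra. }
  assert (Hm : ta < Tm o).
  { destruct (Rlt_dec ta (Tm o)) as [|N]; [assumption|exfalso].
    assert (A := Agree ta ltac:(unfold ta, tb; lra) ltac:(unfold ta in *; lra)).
    assert (0 <= X o ta) by (apply orbit_nonneg; unfold ta in *; lra). lra. }
  assert (Tm o = tm).
  { apply hm_unique; [lra|]. rewrite <- Agree; lra. }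
  assert (Tp o = tp).
  { apply hp_unique; [lra|]. rewrite <- Agree; lra. }
  repeat split; try assumption; intros t Ht; apply Agree; lra.
Qed.

End Orbit.

Definition gxs (a0 a1 rho x0 t : R) : R := gx a0 a1 rho (sol a0 a1 rho x0 (clamp ta tb t)).

(** The integral in lambda^- is split at the tangency time 0, so that each hit contributes one value
    of a primitive. *)
Definition En (a0 a1 rho x0 t : R) : R := RInt (gxs a0 a1 rho x0) 0 t.

Lemma sol_clamp_in (a0 a1 rho x0 t : R) : near a0 a1 rho -> near0 x0 ->
  - (1 / 2) <= sol a0 a1 rho x0 (clamp ta tb t) <= 11 / 10.
Proof.
  intros Hn Hx; apply sol_in; try assumption; apply clamp_range; unfold ta, tb; lra.
Qed.

Lemma comp_sol_continuous (f df : R -> R) (a0 a1 rho x0 t : R) :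
  near a0 a1 rho -> near0 x0 ->
  (forall x, B a0 a1 rho x <> 0 -> is_derive f x (df x)) ->
  continuous (fun s => f (sol a0 a1 rho x0 (clamp ta tb s))) t.
Proof.
  intros Hn Hx Hf; apply (continuous_comp (fun s => sol a0 a1 rho x0 (clamp ta tb s)) f).
  - apply (continuous_comp (clamp ta tb)); [apply clamp_continuous|now apply sol_continuous].
  - apply (derive_continuous f _ (df (sol a0 a1 rho x0 (clamp ta tb t)))), Hf.
    assert (H := g_bounds a0 a1 rho _ Hn (sol_clamp_in a0 a1 rho x0 t Hn Hx)); lra.
Qed.

Lemma derive_gx (a0 a1 rho x : R) :
  B a0 a1 rho x <> 0 -> is_derive (gx a0 a1 rho) x (gxx a0 a1 rho x).
Proof.
  intros H; unfold gx, gxx, Bx, Bxx, B in *; auto_derive; [repeat split; exact H|field; exact H].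
Qed.

Lemma gxs_continuous (a0 a1 rho x0 t : R) :
  near a0 a1 rho -> near0 x0 -> continuous (gxs a0 a1 rho x0) t.
Proof.
  intros Hn Hx; apply (comp_sol_continuous _ (gxx a0 a1 rho)); try assumption.
  intros; now apply derive_gx.
Qed.

Lemma En_derive (a0 a1 rho x0 t : R) :
  near a0 a1 rho -> near0 x0 -> is_derive (En a0 a1 rho x0) t (gxs a0 a1 rho x0 t).
Proof. intros Hn Hx; apply derive_RInt; intros; now apply gxs_continuous. Qed.

Lemma chi1_eq (a0 a1 rho : R) :
  near a0 a1 rho ->
  chi1 a0 a1 rho = 2 / 3 * (exp (hp a0 a1 rho 1) - exp (hm a0 a1 rho 1))
    - g a0 a1 rho 0 * (hp a0 a1 rho 1 - hm a0 a1 rho 1).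
Proof.
  intros Hn; assert (H1 : near0 1) by (unfold near0; rewrite Rminus_diag, Rabs_R0; lra).
  destruct (orbit_unique a0 a1 rho 1 Hn H1 _ (orbit_spec a0 a1 rho 1 Hn H1)) as [Em [Ep _]].
  unfold chi1; simpl; now rewrite Em, Ep.
Qed.

Lemma lambda_minus_eq (a0 a1 rho x0 : R) :
  near a0 a1 rho -> near0 x0 ->
  lambda_minus a0 a1 rho x0 =
    En a0 a1 rho x0 (hp a0 a1 rho x0) - En a0 a1 rho x0 (hm a0 a1 rho x0).
Proof.
  intros Hn Hx.
  destruct (orbit_unique a0 a1 rho x0 Hn Hx _ (orbit_spec a0 a1 rho x0 Hn Hx)) as [Em [Ep EX]].
  destruct (hm_spec a0 a1 rho x0 Hn Hx) as [Hm _]; destruct (hp_spec a0 a1 rho x0 Hn Hx) as [Hp _].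
  unfold lambda_minus; simpl; rewrite Em, Ep.
  rewrite (RInt_ext _ (gxs a0 a1 rho x0)).
  - assert (Ex : forall u v, ex_RInt (gxs a0 a1 rho x0) u v).
    { intros; apply (ex_RInt_continuous (gxs a0 a1 rho x0)); intros; now apply gxs_continuous. }
    unfold En; rewrite <- (RInt_Chasles (gxs a0 a1 rho x0) _ 0 _ (Ex _ _) (Ex _ _)).
    rewrite <- (opp_RInt_swap (gxs a0 a1 rho x0) 0 (hm a0 a1 rho x0)) by apply Ex.
    unfold plus, opp; simpl; ring.
  - intros t Ht; rewrite Rmin_left, Rmax_right in Ht by lra.
    unfold gxs; rewrite clamp_id by lra; rewrite EX by lra.
    apply Derive_g.
    assert (H := g_bounds a0 a1 rho _ Hn (sol_in a0 a1 rho x0 Hn Hx t ltac:(lra))); lra.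
Qed.

(** * Second-order expansions *)

(* f = f0 + f1 + O(n^2) and f1 = O(n), uniformly over the indices in P. *)
Definition expands {I : Type} (P : I -> Prop) (n f f0 f1 : I -> R) : Prop :=
  exists C, 0 <= C /\ forall i, P i ->
    Rabs (f0 i) <= C /\ Rabs (f1 i) <= C * n i /\ Rabs (f i - f0 i - f1 i) <= C * (n i * n i).

Section Calculus.

Context {I : Type}.
Variables (P : I -> Prop) (n : I -> R).
Hypothesis Hn : forall i, P i -> 0 <= n i <= 1.

Lemma expands_eq (f f0 f1 f' f0' f1' : I -> R) :
  expands P n f f0 f1 -> (forall i, P i -> f' i = f i) -> (forall i, P i -> f0' i = f0 i) ->
  (forall i, P i -> f1' i = f1 i) -> expands P n f' f0' f1'.
Proof.
  intros [C [HC H]] E E0 E1; exists C; split; [exact HC|]; intros i Hi.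
  rewrite E, E0, E1 by assumption; now apply H.
Qed.

Lemma expands_const (f : I -> R) (K : R) :
  (forall i, P i -> Rabs (f i) <= K) -> expands P n f f (fun _ => 0).
Proof.
  intros H; exists (Rmax 0 K); split; [apply Rmax_l|]; intros i Hi.
  assert (N := Hn i Hi); assert (A := H i Hi); assert (M := Rmax_r 0 K); assert (M0 := Rmax_l 0 K).
  rewrite Rminus_diag, Rminus_0_r, Rabs_R0; repeat split; [lra|nra|nra].
Qed.

Lemma expands_first_order (f0 f1 : I -> R) (K : R) :
  (forall i, P i -> Rabs (f0 i) <= K) -> (forall i, P i -> Rabs (f1 i) <= K * n i) ->
  expands P n (fun i => f0 i + f1 i) f0 f1.
Proof.
  intros H0 H1; exists (Rmax 0 K); split; [apply Rmax_l|]; intros i Hi.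
  assert (N := Hn i Hi); assert (A := H0 i Hi); assert (A1 := H1 i Hi).
  assert (M := Rmax_r 0 K); assert (M0 := Rmax_l 0 K).
  replace (f0 i + f1 i - f0 i - f1 i) with 0 by ring; rewrite Rabs_R0; repeat split; nra.
Qed.

Lemma expands_plus (f f0 f1 h h0 h1 : I -> R) :
  expands P n f f0 f1 -> expands P n h h0 h1 ->
  expands P n (fun i => f i + h i) (fun i => f0 i + h0 i) (fun i => f1 i + h1 i).
Proof.
  intros [C [HC H]] [D [HD H']]; exists (C + D); split; [lra|]; intros i Hi.
  destruct (H i Hi) as [A0 [A1 A2]]; destruct (H' i Hi) as [B0 [B1 B2]].
  rewrite !Rmult_plus_distr_r; repeat split; try (now apply abs_plus_le).
  replace (f i + h i - (f0 i + h0 i) - (f1 i + h1 i))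
    with ((f i - f0 i - f1 i) + (h i - h0 i - h1 i)) by ring; now apply abs_plus_le.
Qed.

Lemma expands_mult (f f0 f1 h h0 h1 : I -> R) :
  expands P n f f0 f1 -> expands P n h h0 h1 ->
  expands P n (fun i => f i * h i) (fun i => f0 i * h0 i) (fun i => f0 i * h1 i + f1 i * h0 i).
Proof.
  intros [C [HC H]] [D [HD H']]; exists (C * D * 6); split; [nra|]; intros i Hi.
  destruct (H i Hi) as [A0 [A1 A2]]; destruct (H' i Hi) as [B0 [B1 B2]].
  assert (N := Hn i Hi); assert (HCD : 0 <= C * D) by nra.
  assert (HCDn : 0 <= C * D * n i) by nra.
  assert (HCDn2 : 0 <= C * D * (n i * n i)) by nra.
  split; [|split].
  - apply Rle_trans with (C * D); [now apply abs_mult_le|lra].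
  - apply Rle_trans with (C * (D * n i) + C * n i * D); [|lra].
    apply abs_plus_le; now apply abs_mult_le.
  (* Six products of total order at least two remain, each at most C D n^2, since higher powers of n
     are absorbed by n <= 1. *)
  - set (e := f i - f0 i - f1 i) in *; set (k := h i - h0 i - h1 i) in *.
    replace (f i * h i - f0 i * h0 i - (f0 i * h1 i + f1 i * h0 i))
      with (f0 i * k + (f1 i * h1 i + (f1 i * k + (e * h0 i + (e * h1 i + e * k)))))
      by (unfold e, k; ring).
    apply Rle_trans with (C * (D * (n i * n i)) + (C * n i * (D * n i) + (C * n i * (D * (n i * n i))
       + (C * (n i * n i) * D + (C * (n i * n i) * (D * n i) + C * (n i * n i) * (D * (n i * n i))))))).
    + repeat apply abs_plus_le; now apply abs_mult_le.
    + assert (n i * n i <= 1) by nra. nra.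
Qed.

Lemma expands_inv (f f0 f1 : I -> R) (m : R) :
  0 < m -> (forall i, P i -> m <= f i) -> (forall i, P i -> m <= f0 i) -> expands P n f f0 f1 ->
  expands P n (fun i => / f i) (fun i => / f0 i) (fun i => - (f1 i * (/ f0 i * / f0 i))).
Proof.
  intros Hm Hf Hf0 [C [HC H]].
  set (k := / m); assert (Hk : 0 < k) by (now apply Rinv_0_lt_compat).
  exists (k + C * (k * k) + (C * C + (C * C + C * C)) * (k * (k * k))).
  assert (0 <= k * k) by nra; assert (0 <= k * (k * k)) by nra; assert (0 <= C * C) by nra.
  assert (0 <= C * (k * k)) by nra.
  assert (0 <= (C * C + (C * C + C * C)) * (k * (k * k))) by nra.
  split; [lra|]; intros i Hi.
  destruct (H i Hi) as [A0 [A1 A2]]; specialize (Hf i Hi); specialize (Hf0 i Hi).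
  assert (N := Hn i Hi); assert (N2 : 0 <= n i * n i) by nra.
  assert (I1 : Rabs (/ f i) <= k).
  { rewrite Rabs_right by (apply Rle_ge, Rlt_le, Rinv_0_lt_compat; lra). apply Rinv_le_contravar; lra. }
  assert (I2 : Rabs (/ f0 i) <= k).
  { rewrite Rabs_right by (apply Rle_ge, Rlt_le, Rinv_0_lt_compat; lra). apply Rinv_le_contravar; lra. }
  split; [lra|split].
  - rewrite Rabs_Ropp; apply Rle_trans with (C * n i * (k * k)).
    + apply abs_mult_le; [assumption|now apply abs_mult_le].
    + assert (0 <= k * n i) by nra.
      assert (0 <= (C * C + (C * C + C * C)) * (k * (k * k)) * n i) by nra. lra.
  - set (e := f i - f0 i - f1 i) in *.
    (* The linear terms cancel: every summand of the numerator contains the remainder e or the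
       square of f1. *)
    replace (/ f i - / f0 i - - (f1 i * (/ f0 i * / f0 i)))
      with ((- e * f0 i + (f1 i * f1 i + e * f1 i)) * (/ f i * (/ f0 i * / f0 i)))
      by (unfold e; field; lra).
    assert (Ne : Rabs (- e) <= C * (n i * n i)) by (now rewrite Rabs_Ropp).
    apply Rle_trans with ((C * (n i * n i) * C + (C * n i * (C * n i) + C * (n i * n i) * C)) * (k * (k * k))).
    + apply abs_mult_le; [|apply abs_mult_le; [assumption|now apply abs_mult_le]].
      repeat apply abs_plus_le; apply abs_mult_le; try assumption.
      apply Rle_trans with (1 := A1); nra.
    + replace ((C * (n i * n i) * C + (C * n i * (C * n i) + C * (n i * n i) * C)) * (k * (k * k)))
        with ((C * C + (C * C + C * C)) * (k * (k * k)) * (n i * n i)) by ring.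
      apply Rmult_le_compat_r; lra.
Qed.

Lemma expands_lip (f f0 f1 : I -> R) : expands P n f f0 f1 ->
  exists C, 0 <= C /\ forall i, P i -> Rabs (f i - f0 i) <= C * n i.
Proof.
  intros [C [HC H]]; exists (C + C); split; [lra|]; intros i Hi.
  destruct (H i Hi) as [A0 [A1 A2]]; assert (N := Hn i Hi).
  replace (f i - f0 i) with (f1 i + (f i - f0 i - f1 i)) by ring.
  rewrite Rmult_plus_distr_r; apply abs_plus_le; [assumption|].
  apply Rle_trans with (1 := A2); apply Rmult_le_compat_l; nra.
Qed.

End Calculus.

Arguments expands_plus {I P n f f0 f1 h h0 h1}.
Arguments expands_mult {I P n} Hn {f f0 f1 h h0 h1}.
Arguments expands_lip {I P n} Hn {f f0 f1}.

Section GExpansion.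

Context {I : Type}.
Variables (P : I -> Prop) (n : I -> R).
Hypothesis Hn : forall i, P i -> 0 <= n i <= 1.
Variables (a0 a1 rho : R) (p0 p1 x x0 l0 l1 x1 : I -> R).
Hypothesis Ha : near a0 a1 rho.
Hypothesis Hp : forall i, P i -> near (p0 i) (p1 i) rho.
Hypothesis Hx : forall i, P i -> - (1 / 2) <= x i <= 11 / 10.
Hypothesis Hx0 : forall i, P i -> - (1 / 2) <= x0 i <= 11 / 10.
Hypothesis S0 : expands P n p0 (fun _ => a0) l0.
Hypothesis S1 : expands P n p1 (fun _ => a1) l1.
Hypothesis Sx : expands P n x x0 x1.

Let sc (k : R) : expands P n (fun _ => k) (fun _ => k) (fun _ => 0).
Proof. apply (expands_const P n Hn _ (Rabs k)); intros; apply Rle_refl. Qed.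

Lemma expands_q : expands P n (fun i => p1 i + 2 * rho * x i) (fun i => a1 + 2 * rho * x0 i)
  (fun i => l1 i + 2 * rho * x1 i).
Proof.
  eapply expands_eq; [exact (expands_plus S1 (expands_mult Hn (sc (2 * rho)) Sx))|..];
    intros; simpl; ring.
Qed.

Lemma expands_B : expands P n (fun i => B (p0 i) (p1 i) rho (x i)) (fun i => B a0 a1 rho (x0 i))
  (fun i => Bx a0 a1 rho (x0 i) * x1 i + (x0 i - 1) * (l0 i + x0 i * l1 i)).
Proof.
  eapply expands_eq; [exact (expands_plus (sc 1) (expands_mult Hn
     (expands_plus Sx (sc (-1)))
     (expands_plus S0 (expands_plus (expands_mult Hn S1 Sx)
        (expands_mult Hn (sc rho) (expands_mult Hn Sx Sx))))))|..];
    intros; unfold B, Bx; simpl; ring.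
Qed.

Lemma expands_Bx : expands P n (fun i => Bx (p0 i) (p1 i) rho (x i)) (fun i => Bx a0 a1 rho (x0 i))
  (fun i => Bxx a1 rho (x0 i) * x1 i + (l0 i + (2 * x0 i - 1) * l1 i)).
Proof.
  eapply expands_eq; [exact (expands_plus
     (expands_plus S0 (expands_plus (expands_mult Hn S1 Sx)
        (expands_mult Hn (sc rho) (expands_mult Hn Sx Sx))))
     (expands_mult Hn (expands_plus Sx (sc (-1))) expands_q))|..];
    intros; unfold Bx, Bxx; simpl; ring.
Qed.

Lemma expands_N : expands P n (fun i => 1 - x i / 3) (fun i => 1 - x0 i / 3) (fun i => - x1 i / 3).
Proof.
  eapply expands_eq; [exact (expands_plus (sc 1) (expands_mult Hn (sc (- / 3)) Sx))|..];
    intros; simpl; field.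
Qed.

Lemma expands_z : expands P n (fun i => / B (p0 i) (p1 i) rho (x i)) (fun i => / B a0 a1 rho (x0 i))
  (fun i => - ((Bx a0 a1 rho (x0 i) * x1 i + (x0 i - 1) * (l0 i + x0 i * l1 i))
     * (/ B a0 a1 rho (x0 i) * / B a0 a1 rho (x0 i)))).
Proof.
  apply (expands_inv P n Hn _ _ _ (9 / 10)); [lra| | |exact expands_B]; intros i Hi.
  - apply g_bounds; auto.
  - apply g_bounds; auto.
Qed.

(** Composed from the expansions of 1 - x/3 and 1/B, whose remainders are already controlled. The
    argument x is left general because the lemma is applied at the moved orbit, at the fixed orbit,
    at the starting point and at the hit value 0. *)
Lemma expands_g : expands P n (fun i => g (p0 i) (p1 i) rho (x i)) (fun i => g a0 a1 rho (x0 i))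
  (fun i => gx a0 a1 rho (x0 i) * x1 i + (ga0 a0 a1 rho (x0 i) * l0 i + ga1 a0 a1 rho (x0 i) * l1 i)).
Proof.
  eapply expands_eq; [exact (expands_mult Hn expands_N expands_z)|..]; intros i Hi; simpl;
    assert (HB := g_bounds a0 a1 rho (x0 i) Ha (Hx0 i Hi)).
  - reflexivity.
  - reflexivity.
  - unfold gx, ga1, ga0; field; lra.
Qed.

Lemma expands_gx : expands P n (fun i => gx (p0 i) (p1 i) rho (x i)) (fun i => gx a0 a1 rho (x0 i))
  (fun i => gxx a0 a1 rho (x0 i) * x1 i + (gxa0 a0 a1 rho (x0 i) * l0 i + gxa1 a0 a1 rho (x0 i) * l1 i)).
Proof.
  eapply expands_eq; [exact (expands_plus (expands_mult Hn (sc (- (1 / 3))) expands_z)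
    (expands_mult Hn (sc (-1)) (expands_mult Hn (expands_mult Hn expands_N expands_z)
       (expands_mult Hn expands_z expands_Bx))))|..]; intros i Hi; simpl;
    assert (HB := g_bounds a0 a1 rho (x0 i) Ha (Hx0 i Hi)).
  - unfold gx; ring.
  - unfold gx; ring.
  - unfold gxx, gxa1, gxa0, ga0, gx; field; lra.
Qed.

End GExpansion.

(** * Dependence on the parameters and on x0 *)

Lemma continuous_bounded (f : R -> R) (a b : R) :
  a <= b -> (forall t, continuous f t) ->
  exists K, 0 <= K /\ forall t, a <= t <= b -> Rabs (f t) <= K.
Proof.
  intros Hab Hf; destruct (continuity_ab_maj (fun t => Rabs (f t)) a b Hab) as [m [Hm _]].
  - intros c _; apply (continuity_pt_comp f Rabs); [|apply Rcontinuity_abs].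
    apply continuity_pt_filterlim, Hf.
  - exists (Rabs (f m)); split; [apply Rabs_pos|exact Hm].
Qed.

Lemma clamp_t_id (t : R) : ta <= t <= tb -> clamp ta tb t = t.
Proof. apply clamp_id. Qed.

Lemma near0_1 : near0 1.
Proof. unfold near0; rewrite Rminus_diag, Rabs_R0; lra. Qed.

Lemma exp_bound (t : R) : ta <= t <= tb -> Rabs (exp t) <= 5.
Proof.
  intros Ht; assert (Hp := exp_pos t); rewrite Rabs_right by lra.
  apply Rle_trans with (exp tb); [apply exp_le_compat; lra|].
  assert (H := exp_range_pos tb); unfold tb in *; lra.
Qed.

Section Dependence.

Variables a0 a1 rho : R.
Hypothesis Ha : near a0 a1 rho.

Notation x := (sol a0 a1 rho 1).
Notation xc t := (sol a0 a1 rho 1 (clamp ta tb t)).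

Definition along (f : R -> R) (t : R) : R := f (xc t).

Lemma along_continuous (f : R -> R) (t : R) :
  (forall y, B a0 a1 rho y <> 0 -> ex_derive f y) -> continuous (along f) t.
Proof.
  intros Hf; apply (comp_sol_continuous f (Derive f) _ _ _ _ _ Ha near0_1).
  intros y Hy; now apply Derive_correct, Hf.
Qed.

Lemma along_gx_continuous (t : R) : continuous (along (gx a0 a1 rho)) t.
Proof. apply along_continuous; intros y Hy; eexists; now apply derive_gx. Qed.

Lemma along_gxx_continuous (t : R) : continuous (along (gxx a0 a1 rho)) t.
Proof.
  apply along_continuous; intros y Hy; unfold gxx, Bx, Bxx, B in *; auto_derive; repeat split; exact Hy.
Qed.

Lemma along_ga0_continuous (t : R) : continuous (along (ga0 a0 a1 rho)) t.
Proof.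
  apply along_continuous; intros y Hy; unfold ga0, B in *; auto_derive; repeat split; exact Hy.
Qed.

Lemma along_ga1_continuous (t : R) : continuous (along (ga1 a0 a1 rho)) t.
Proof.
  apply along_continuous; intros y Hy; unfold ga1, ga0, B in *; auto_derive; repeat split; exact Hy.
Qed.

Lemma along_gxa0_continuous (t : R) : continuous (along (gxa0 a0 a1 rho)) t.
Proof.
  apply along_continuous; intros y Hy; unfold gxa0, gx, Bx, B in *; auto_derive; repeat split; exact Hy.
Qed.

Lemma along_gxa1_continuous (t : R) : continuous (along (gxa1 a0 a1 rho)) t.
Proof.
  apply along_continuous; intros y Hy; unfold gxa1, gxa0, ga0, gx, Bx, B in *; auto_derive; repeat split; exact Hy.
Qed.

(** The variational equation of X' = g(X) - Y along the tangent orbit; f collects the direct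
    dependence of the right-hand side on the datum being varied. *)
Definition is_variation (k : R) (f : R -> R) (v : R -> R) : Prop :=
  v 0 = k /\ forall t, is_derive v t (along (gx a0 a1 rho) t * v t + f t).

Definition variation (k : R) (f : R -> R) : R -> R :=
  epsilon (inhabits (fun _ => 0)) (is_variation k f).

Lemma variation_spec (k : R) (f : R -> R) :
  (forall t, continuous f t) -> is_variation k f (variation k f).
Proof.
  intros Hf; unfold variation; apply epsilon_spec.
  destruct (linear_ode (along (gx a0 a1 rho)) f k along_gx_continuous Hf) as [v Hv].
  exists v; exact Hv.
Qed.

(** Derivatives of X in a0, a1 and x0. As g(1) = 2/3 for all parameters, Y is independent of a0 and
    a1 at x0 = 1; varying x0 also moves Y(0) = g(x0), whence the forcing - g'(1) e^t of [eta]. *)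
Definition xi0 : R -> R := variation 0 (along (ga0 a0 a1 rho)).
Definition xi1 : R -> R := variation 0 (along (ga1 a0 a1 rho)).
Definition eta : R -> R := variation 1 (fun t => - gx a0 a1 rho 1 * exp t).

Lemma xi0_spec : is_variation 0 (along (ga0 a0 a1 rho)) xi0.
Proof. apply variation_spec, along_ga0_continuous. Qed.

Lemma xi1_spec : is_variation 0 (along (ga1 a0 a1 rho)) xi1.
Proof. apply variation_spec, along_ga1_continuous. Qed.

Lemma eta_spec : is_variation 1 (fun t => - gx a0 a1 rho 1 * exp t) eta.
Proof.
  apply variation_spec; intros t.
  apply (continuous_mult (fun _ => - gx a0 a1 rho 1) exp); [apply continuous_const|apply exp_continuous].
Qed.

Lemma variation_continuous (k : R) (f v : R -> R) (t : R) : is_variation k f v -> continuous v t.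
Proof. intros [_ H]; exact (derive_continuous _ _ _ (H t)). Qed.

(** First variation of the integral of g'(X) when X moves by v and the function g' itself by f. *)
Definition w (v f : R -> R) (t : R) : R := RInt (fun s => along (gxx a0 a1 rho) s * v s + f s) 0 t.

Definition w0 : R -> R := w xi0 (along (gxa0 a0 a1 rho)).
Definition w1 : R -> R := w xi1 (along (gxa1 a0 a1 rho)).
Definition we : R -> R := w eta (fun _ => 0).

Lemma w_derive (v f : R -> R) (t : R) :
  (forall s, continuous v s) -> (forall s, continuous f s) ->
  is_derive (w v f) t (along (gxx a0 a1 rho) t * v t + f t).
Proof.
  intros Hv Hf; apply (derive_RInt (fun s => along (gxx a0 a1 rho) s * v s + f s)).
  intros s; apply (continuous_plus (fun s => along (gxx a0 a1 rho) s * v s) f); [|apply Hf].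
  apply (continuous_mult (along (gxx a0 a1 rho)) v); [apply along_gxx_continuous|apply Hv].
Qed.

Lemma w0_derive (t : R) : is_derive w0 t (along (gxx a0 a1 rho) t * xi0 t + along (gxa0 a0 a1 rho) t).
Proof.
  apply w_derive; intros; [apply (variation_continuous _ _ _ _ xi0_spec)|apply along_gxa0_continuous].
Qed.

Lemma w1_derive (t : R) : is_derive w1 t (along (gxx a0 a1 rho) t * xi1 t + along (gxa1 a0 a1 rho) t).
Proof.
  apply w_derive; intros; [apply (variation_continuous _ _ _ _ xi1_spec)|apply along_gxa1_continuous].
Qed.

Lemma we_derive (t : R) : is_derive we t (along (gxx a0 a1 rho) t * eta t + 0).
Proof.
  apply (w_derive eta (fun _ => 0)); intros; [apply (variation_continuous _ _ _ _ eta_spec)|apply continuous_const].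
Qed.

Definition q0 (th : R * R * R) : R := fst (fst th).
Definition q1 (th : R * R * R) : R := snd (fst th).
Definition qx (th : R * R * R) : R := snd th.

Definition nrm (th : R * R * R) : R := Rabs (q0 th - a0) + (Rabs (q1 th - a1) + Rabs (qx th - 1)).
Definition PT (th : R * R * R) : Prop := near (q0 th) (q1 th) rho /\ near0 (qx th).
(** Time is part of the index while [nI] ignores it, so that expansions over [PI] are uniform in
    time. *)
Definition PI (i : (R * R * R) * R) : Prop := PT (fst i) /\ ta <= snd i <= tb.
Definition nI (i : (R * R * R) * R) : R := nrm (fst i).

Lemma nrm_range (th : R * R * R) : PT th -> 0 <= nrm th <= 1.
Proof.
  intros [[H0 [H1 _]] Hx]; destruct Ha as [A0 [A1 _]]; unfold near0 in Hx; unfold nrm.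
  assert (P0 := Rabs_pos (q0 th - a0)); assert (P1 := Rabs_pos (q1 th - a1)); assert (P2 := Rabs_pos (qx th - 1)).
  split; [lra|].
  assert (Rabs (q0 th - a0) <= 6 / 1000).
  { replace (q0 th - a0) with ((q0 th + 1 / 2) + - (a0 + 1 / 2)) by ring.
    replace (6 / 1000) with (3 / 1000 + 3 / 1000) by field.
    apply abs_plus_le; [assumption|now rewrite Rabs_Ropp]. }
  assert (Rabs (q1 th - a1) <= 4 / 100 + 4 / 100).
  { apply abs_plus_le; [assumption|now rewrite Rabs_Ropp]. }
  lra.
Qed.

Lemma nI_range (i : (R * R * R) * R) : PI i -> 0 <= nI i <= 1.
Proof. intros [H _]; now apply nrm_range. Qed.

Definition lin (u v y : R) (th : R * R * R) : R := u * (q0 th - a0) + (v * (q1 th - a1) + y * (qx th - 1)).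

Lemma lin_bound (u v y K : R) (th : R * R * R) :
  Rabs u <= K -> Rabs v <= K -> Rabs y <= K -> Rabs (lin u v y th) <= K * nrm th.
Proof.
  intros; unfold lin, nrm; rewrite !Rmult_plus_distr_l.
  repeat apply abs_plus_le; (apply abs_mult_le; [assumption|apply Rle_refl]).
Qed.

Lemma expands_param0 : expands PI nI (fun i => q0 (fst i)) (fun _ => a0) (fun i => q0 (fst i) - a0).
Proof.
  exists (1 + Rabs a0); assert (A := Rabs_pos a0); split; [lra|]; intros i Hi.
  assert (N := nI_range i Hi); replace (q0 (fst i) - a0 - (q0 (fst i) - a0)) with 0 by ring.
  rewrite Rabs_R0; repeat split; [lra| |nra].
  apply Rle_trans with (nI i); [|nra]. unfold nI, nrm.
  assert (P1 := Rabs_pos (q1 (fst i) - a1)); assert (P2 := Rabs_pos (qx (fst i) - 1)); lra.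
Qed.

Lemma expands_param1 : expands PI nI (fun i => q1 (fst i)) (fun _ => a1) (fun i => q1 (fst i) - a1).
Proof.
  exists (1 + Rabs a1); assert (A := Rabs_pos a1); split; [lra|]; intros i Hi.
  assert (N := nI_range i Hi); replace (q1 (fst i) - a1 - (q1 (fst i) - a1)) with 0 by ring.
  rewrite Rabs_R0; repeat split; [lra| |nra].
  apply Rle_trans with (nI i); [|nra]. unfold nI, nrm.
  assert (P1 := Rabs_pos (q0 (fst i) - a0)); assert (P2 := Rabs_pos (qx (fst i) - 1)); lra.
Qed.

(** [ga0] and [ga1] vanish at x = 1, so the initial value of Y has no first-order term in a0 and
    a1. *)
Lemma expands_start : expands PI nI (fun i => g (q0 (fst i)) (q1 (fst i)) rho (qx (fst i)))
  (fun _ => g a0 a1 rho 1) (fun i => gx a0 a1 rho 1 * (qx (fst i) - 1)).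
Proof.
  eapply expands_eq; [apply (expands_g PI nI nI_range a0 a1 rho (fun i => q0 (fst i)) (fun i => q1 (fst i))
    (fun i => 1 + (qx (fst i) - 1)) (fun _ => 1) (fun i => q0 (fst i) - a0) (fun i => q1 (fst i) - a1)
    (fun i => qx (fst i) - 1) Ha)|..].
  - intros i [[H _] _]; exact H.
  - intros i [[_ H] _]; apply abs_bounds in H; lra.
  - intros; lra.
  - exact expands_param0.
  - exact expands_param1.
  - apply (expands_first_order PI nI nI_range _ _ 1).
    + intros; rewrite Rabs_R1; lra.
    + intros i _; unfold nI, nrm.
      assert (P1 := Rabs_pos (q0 (fst i) - a0)); assert (P2 := Rabs_pos (q1 (fst i) - a1)); lra.
  - intros i _; simpl; f_equal; ring.
  - reflexivity.
  - intros i _; simpl; unfold ga1, ga0; ring.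
Qed.

Lemma base_range (i : (R * R * R) * R) : PI i -> - (1 / 2) <= x (snd i) <= 11 / 10.
Proof. intros [_ H]; exact (sol_in a0 a1 rho 1 Ha near0_1 _ H). Qed.

Notation xt i := (sol (q0 (fst i)) (q1 (fst i)) rho (qx (fst i)) (snd i)).

Lemma moved_range (i : (R * R * R) * R) : PI i -> - (1 / 2) <= xt i <= 11 / 10.
Proof. intros [[H1 H2] H]; exact (sol_in _ _ rho _ H1 H2 _ H). Qed.

Lemma expands_g_base : exists C, 0 <= C /\ forall i, PI i ->
  Rabs (g (q0 (fst i)) (q1 (fst i)) rho (x (snd i)) - g a0 a1 rho (x (snd i))) <= C * nI i.
Proof.
  apply (expands_lip nI_range (expands_g PI nI nI_range a0 a1 rho (fun i => q0 (fst i)) (fun i => q1 (fst i))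
    (fun i => x (snd i)) (fun i => x (snd i)) _ _ _ Ha (fun i H => proj1 (proj1 H)) base_range base_range
    expands_param0 expands_param1 (expands_const PI nI nI_range (fun i => x (snd i)) 2 ltac:(intros i Hi; apply base_range in Hi; apply abs_le; lra)))).
Qed.

(** Precedes the second-order expansion: [expands_g] applies at the moved orbit once its
    displacement is known to be of first order. *)
Lemma sol_lip : exists C, 0 <= C /\ forall i, PI i -> Rabs (xt i - x (snd i)) <= C * nI i.
Proof.
  destruct expands_g_base as [C1 [HC1 H1]].
  destruct (expands_lip nI_range expands_start) as [C2 [HC2 H2]].
  exists (2 * (1 + (C1 + 5 * C2) * (27 / 10))); split; [nra|].
  intros [th t] [[Hq Hx] Ht]; unfold nI; cbn [fst snd] in *.
  assert (N := nrm_range th (conj Hq Hx)).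
  apply Rle_trans with (2 * (nrm th + (C1 + 5 * C2) * nrm th * (27 / 10))); [|right; ring].
  apply (comparison (fun t => sol (q0 th) (q1 th) rho (qx th) t - x t)
    (fun t => (gc (q0 th) (q1 th) rho (sol (q0 th) (q1 th) rho (qx th) t) - g (q0 th) (q1 th) rho (qx th) * exp t)
            - (gc a0 a1 rho (x t) - g a0 a1 rho 1 * exp t)) ta tb (1 / 6)); unfold ta, tb in *; try lra.
  - apply Rmult_le_pos; [nra|lra].
  - intros s Hs; apply derive_minus; apply sol_derive_c; try assumption; apply near0_1.
  - intros s Hs.
    assert (Hi : PI (th, s)) by (split; [split|]; assumption).
    assert (B1 := H1 (th, s) Hi); assert (B2 := H2 (th, s) Hi); unfold nI in B1, B2; cbn [fst snd] in B1, B2.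
    assert (R := base_range (th, s) Hi); cbn [snd] in R.
    assert (L := gc_lip (q0 th) (q1 th) rho (sol (q0 th) (q1 th) rho (qx th) s) (x s) Hq).
    assert (E : gc (q0 th) (q1 th) rho (x s) = g (q0 th) (q1 th) rho (x s)) by (unfold gc; now rewrite clamp_id).
    assert (E' : gc a0 a1 rho (x s) = g a0 a1 rho (x s)) by (unfold gc; now rewrite clamp_id).
    rewrite E' in *; rewrite E in L.
    set (u := gc _ _ _ _) in *; set (c := g (q0 th) (q1 th) rho (qx th)) in *.
    set (c' := g a0 a1 rho 1) in *; set (h := g (q0 th) (q1 th) rho (x s)) in *; set (h' := g a0 a1 rho (x s)) in *.
    replace (u - c * exp s - (h' - c' * exp s)) with ((u - h) + ((h - h') + (- (c - c')) * exp s)) by ring.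
    replace (1 / 6 * Rabs (sol (q0 th) (q1 th) rho (qx th) s - x s) + (C1 + 5 * C2) * nrm th)
      with (1 / 6 * Rabs (sol (q0 th) (q1 th) rho (qx th) s - x s) + (C1 * nrm th + C2 * nrm th * 5)) by ring.
    repeat apply abs_plus_le; [exact L|exact B1|].
    apply abs_mult_le; [now rewrite Rabs_Ropp|apply exp_bound; unfold ta, tb; lra].
  - rewrite !sol_0 by (assumption || apply near0_1). unfold nrm.
    assert (P1 := Rabs_pos (q0 th - a0)); assert (P2 := Rabs_pos (q1 th - a1)); lra.
Qed.

(** The first-order term is here the whole displacement. Fed into [expands_g], it gives a quadratic
    remainder before the linear part of the displacement has been identified. *)
Lemma expands_moved : expands PI nI (fun i => xt i) (fun i => x (snd i)) (fun i => xt i - x (snd i)).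
Proof.
  destruct sol_lip as [C [HC H]].
  eapply expands_eq; [apply (expands_first_order PI nI nI_range (fun i => x (snd i)) (fun i => xt i - x (snd i)) (2 + C))|..].
  - intros i Hi; apply base_range in Hi; apply abs_le; lra.
  - intros i Hi; apply Rle_trans with (1 := H i Hi); apply nI_range in Hi; nra.
  - intros i _; simpl; ring.
  - reflexivity.
  - reflexivity.
Qed.

(** The defect r, the moved orbit minus the fixed one minus the linear term, satisfies r' = g'(X) r
    + O(n^2) and r(0) = 0, so [comparison] makes it quadratic. *)
Lemma expands_sol : expands PI nI (fun i => xt i) (fun i => x (snd i))
  (fun i => lin (xi0 (snd i)) (xi1 (snd i)) (eta (snd i)) (fst i)).
Proof.
  destruct (expands_g PI nI nI_range a0 a1 rho (fun i => q0 (fst i)) (fun i => q1 (fst i))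
    (fun i => xt i) (fun i => x (snd i)) _ _ _ Ha (fun i H => proj1 (proj1 H)) moved_range base_range
    expands_param0 expands_param1 expands_moved) as [C1 [HC1 H1]].
  destruct expands_start as [C2 [HC2 H2]].
  assert (Hab : ta <= tb) by (unfold ta, tb; lra).
  destruct (continuous_bounded xi0 ta tb Hab (fun t => variation_continuous _ _ _ t xi0_spec)) as [K0 [HK0 B0]].
  destruct (continuous_bounded xi1 ta tb Hab (fun t => variation_continuous _ _ _ t xi1_spec)) as [K1 [HK1 B1]].
  destruct (continuous_bounded eta ta tb Hab (fun t => variation_continuous _ _ _ t eta_spec)) as [K2 [HK2 B2]].
  exists (2 + (K0 + (K1 + K2)) + 2 * (0 + (C1 + 5 * C2) * (27 / 10))); split; [nra|].
  intros [th t] Hi; assert (Hi' := Hi); destruct Hi' as [[Hq Hx] Ht]; unfold nI; cbn [fst snd] in *.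
  assert (N := nrm_range th (conj Hq Hx)).
  assert (HC : 0 <= (C1 + 5 * C2) * (27 / 10)) by nra.
  split; [|split].
  - apply base_range in Hi; cbn [snd] in Hi; apply abs_le; lra.
  - apply lin_bound; [apply Rle_trans with K0|apply Rle_trans with K1|apply Rle_trans with K2]; auto; lra.
  - apply Rle_trans with (2 * (0 + (C1 + 5 * C2) * (nrm th * nrm th) * (27 / 10))); [|nra].
    apply (comparison (fun t => sol (q0 th) (q1 th) rho (qx th) t - x t - lin (xi0 t) (xi1 t) (eta t) th)
      (fun t => (g (q0 th) (q1 th) rho (sol (q0 th) (q1 th) rho (qx th) t) - g (q0 th) (q1 th) rho (qx th) * exp t)
            - (g a0 a1 rho (x t) - g a0 a1 rho 1 * exp t)
            - lin (along (gx a0 a1 rho) t * xi0 t + along (ga0 a0 a1 rho) t)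
                  (along (gx a0 a1 rho) t * xi1 t + along (ga1 a0 a1 rho) t)
                  (along (gx a0 a1 rho) t * eta t + - gx a0 a1 rho 1 * exp t) th) ta tb (1 / 6));
      unfold ta, tb in *; try lra.
    + apply Rmult_le_pos; [nra|nra].
    + intros s Hs; apply derive_minus; [apply derive_minus; apply sol_derive; try assumption; apply near0_1|].
      unfold lin; repeat apply derive_plus.
      * eapply is_derive_eq; [apply derive_mult; [apply xi0_spec|apply (is_derive_const (q0 th - a0))]|].
        unfold zero; simpl; ring.
      * eapply is_derive_eq; [apply derive_mult; [apply xi1_spec|apply (is_derive_const (q1 th - a1))]|].
        unfold zero; simpl; ring.
      * eapply is_derive_eq; [apply derive_mult; [apply eta_spec|apply (is_derive_const (qx th - 1))]|].
        unfold zero; simpl; ring.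
    + intros s Hs.
      assert (Hj : PI (th, s)) by (split; [split|]; assumption).
      assert (R := base_range (th, s) Hj); cbn [snd] in R.
      destruct (H1 (th, s) Hj) as [_ [_ E1]]; destruct (H2 (th, s) Hj) as [_ [_ E2]].
      unfold nI in E1, E2; cbn [fst snd] in E1, E2.
      assert (G := proj1 (proj2 (g_bounds a0 a1 rho (x s) Ha R))).
      unfold along; rewrite clamp_id by (unfold ta, tb; lra).
      set (u := g (q0 th) (q1 th) rho (sol _ _ _ _ s)) in *; set (c := g (q0 th) (q1 th) rho (qx th)) in *.
      set (c' := g a0 a1 rho 1) in *; set (h' := g a0 a1 rho (x s)) in *.
      set (r := sol (q0 th) (q1 th) rho (qx th) s - x s - lin (xi0 s) (xi1 s) (eta s) th).
      match goal with |- Rabs ?e <= _ => replace e with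
        (gx a0 a1 rho (x s) * r + ((u - h' - (gx a0 a1 rho (x s) * (sol (q0 th) (q1 th) rho (qx th) s - x s) +
        (ga0 a0 a1 rho (x s) * (q0 th - a0) + ga1 a0 a1 rho (x s) * (q1 th - a1)))) +
         - (c - c' - gx a0 a1 rho 1 * (qx th - 1)) * exp s)) by (unfold r, lin; ring) end.
      replace ((C1 + 5 * C2) * (nrm th * nrm th)) with (C1 * (nrm th * nrm th) + C2 * (nrm th * nrm th) * 5) by ring.
      repeat apply abs_plus_le; [apply abs_mult_le; [exact G|apply Rle_refl]|exact E1|].
      apply abs_mult_le; [now rewrite Rabs_Ropp|apply exp_bound; unfold ta, tb; lra].
    + rewrite !sol_0 by (assumption || apply near0_1).
      unfold lin; rewrite (proj1 xi0_spec), (proj1 xi1_spec), (proj1 eta_spec).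
      replace (_ - _) with 0 by ring; rewrite Rabs_R0; lra.
Qed.

(** All times of the window are within 3 of 0, so integration multiplies the constant by at most
    3. *)
Lemma expands_primitive (F F1 f f1 : R * R * R -> R -> R) (F0 f0 : R -> R) :
  (forall th t, PT th -> ta <= t <= tb -> is_derive (F th) t (f th t)) ->
  (forall t, ta <= t <= tb -> is_derive F0 t (f0 t)) ->
  (forall th t, PT th -> ta <= t <= tb -> is_derive (F1 th) t (f1 th t)) ->
  (forall th, F th 0 = 0) -> F0 0 = 0 -> (forall th, F1 th 0 = 0) ->
  expands PI nI (fun i => f (fst i) (snd i)) (fun i => f0 (snd i)) (fun i => f1 (fst i) (snd i)) ->
  expands PI nI (fun i => F (fst i) (snd i)) (fun i => F0 (snd i)) (fun i => F1 (fst i) (snd i)).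
Proof.
  intros DF DF0 DF1 Z Z0 Z1 [C [HC H]]; exists (C * 3); split; [lra|].
  intros [th t] Hi; assert (Hi' := Hi); destruct Hi' as [Hth Ht]; cbn [fst snd] in *.
  assert (N := nI_range _ Hi).
  assert (H3 : Rabs (t - 0) <= 3) by (apply abs_le; unfold ta, tb in *; lra).
  assert (Hint : forall s, Rmin 0 t <= s <= Rmax 0 t -> ta <= s <= tb).
  { intros s Hs; apply (between_sub ta tb 0 t s); unfold ta, tb in *; lra. }
  assert (Hk : forall (k : R), 0 <= k -> k * Rabs (t - 0) <= k * 3) by (intros; now apply Rmult_le_compat_l).
  assert (HH := fun s Hs => H (th, s) (conj Hth (Hint s Hs))); cbn [fst snd] in HH.
  split; [|split].
  - replace (F0 t) with (F0 t - F0 0) by (rewrite Z0; ring).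
    apply Rle_trans with (2 := Hk C HC), mvt_bound with f0; intros s Hs; [now apply DF0, Hint|exact (proj1 (HH s Hs))].
  - replace (F1 th t) with (F1 th t - F1 th 0) by (rewrite Z1; ring).
    replace (C * 3 * nI (th, t)) with (C * nI (th, t) * 3) by ring.
    apply Rle_trans with (2 := Hk (C * nI (th, t)) ltac:(nra)), mvt_bound with (f1 th);
      intros s Hs; [now apply DF1, Hint|exact (proj1 (proj2 (HH s Hs)))].
  - replace (F th t - F0 t - F1 th t) with ((F th t - F0 t - F1 th t) - (F th 0 - F0 0 - F1 th 0))
      by (rewrite Z, Z0, Z1; ring).
    replace (C * 3 * (nI (th, t) * nI (th, t))) with (C * (nI (th, t) * nI (th, t)) * 3) by ring.
    apply Rle_trans with (2 := Hk (C * (nI (th, t) * nI (th, t))) ltac:(apply Rmult_le_pos; nra)).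
    apply (mvt_bound (fun t => F th t - F0 t - F1 th t) (fun t => f th t - f0 t - f1 th t)).
    + intros s Hs; repeat apply derive_minus; auto.
    + intros s Hs; exact (proj2 (proj2 (HH s Hs))).
Qed.

Lemma lin_derive (u v y du dv dy : R -> R) (th : R * R * R) (t : R) :
  is_derive u t (du t) -> is_derive v t (dv t) -> is_derive y t (dy t) ->
  is_derive (fun t => lin (u t) (v t) (y t) th) t (lin (du t) (dv t) (dy t) th).
Proof.
  intros Hu Hv Hy; unfold lin; repeat apply derive_plus.
  - eapply is_derive_eq; [apply derive_mult; [exact Hu|apply (is_derive_const (q0 th - a0))]|].
    unfold zero; simpl; ring.
  - eapply is_derive_eq; [apply derive_mult; [exact Hv|apply (is_derive_const (q1 th - a1))]|].
    unfold zero; simpl; ring.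
  - eapply is_derive_eq; [apply derive_mult; [exact Hy|apply (is_derive_const (qx th - 1))]|].
    unfold zero; simpl; ring.
Qed.

Lemma lin_0 (th : R * R * R) : lin 0 0 0 th = 0.
Proof. unfold lin; ring. Qed.

Lemma expands_energy : expands PI nI (fun i => En (q0 (fst i)) (q1 (fst i)) rho (qx (fst i)) (snd i))
  (fun i => En a0 a1 rho 1 (snd i)) (fun i => lin (w0 (snd i)) (w1 (snd i)) (we (snd i)) (fst i)).
Proof.
  apply (expands_primitive (fun th => En (q0 th) (q1 th) rho (qx th)) (fun th t => lin (w0 t) (w1 t) (we t) th)
    (fun th => gxs (q0 th) (q1 th) rho (qx th))
    (fun th t => lin (along (gxx a0 a1 rho) t * xi0 t + along (gxa0 a0 a1 rho) t)
                  (along (gxx a0 a1 rho) t * xi1 t + along (gxa1 a0 a1 rho) t)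
                  (along (gxx a0 a1 rho) t * eta t + 0) th)
    (En a0 a1 rho 1) (gxs a0 a1 rho 1)).
  - intros th t [H1 H2] _; now apply En_derive.
  - intros t _; apply En_derive; [exact Ha|exact near0_1].
  - intros th t _ _; apply (lin_derive _ _ _ (fun t => along (gxx a0 a1 rho) t * xi0 t + along (gxa0 a0 a1 rho) t)
      (fun t => along (gxx a0 a1 rho) t * xi1 t + along (gxa1 a0 a1 rho) t)
      (fun t => along (gxx a0 a1 rho) t * eta t + 0)); [apply w0_derive|apply w1_derive|apply we_derive].
  - intros; apply RInt_0.
  - apply RInt_0.
  - intros; unfold w0, w1, we, w; rewrite !RInt_0; apply lin_0.
  - eapply expands_eq; [apply (expands_gx PI nI nI_range a0 a1 rho (fun i => q0 (fst i)) (fun i => q1 (fst i))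
      (fun i => xt i) (fun i => x (snd i)) _ _ _ Ha (fun i H => proj1 (proj1 H)) moved_range base_range
      expands_param0 expands_param1 expands_sol)|..]; intros i [_ Hi]; unfold gxs, along; rewrite !clamp_t_id by exact Hi;
      try reflexivity.
    unfold lin; ring.
Qed.

Lemma taylor2 (F dF : R -> R) (a b K u v : R) :
  (forall t, a <= t <= b -> is_derive F t (dF t)) ->
  (forall s t, a <= s <= b -> a <= t <= b -> Rabs (dF s - dF t) <= K * Rabs (s - t)) ->
  0 <= K -> a <= u <= b -> a <= v <= b ->
  Rabs (F u - F v - dF v * (u - v)) <= K * (Rabs (u - v) * Rabs (u - v)).
Proof.
  intros HD HL HK Hu Hv; destruct (mvt_between F dF v u) as [c [Hc E]].
  { intros t Ht; apply HD, (between_sub _ _ v u); assumption. }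
  rewrite E; replace (dF c * (u - v) - dF v * (u - v)) with ((dF c - dF v) * (u - v)) by ring.
  rewrite <- Rmult_assoc; apply abs_mult_le; [|apply Rle_refl].
  apply Rle_trans with (1 := HL c v (between_sub _ _ v u c Hv Hu Hc) Hv).
  apply Rmult_le_compat_l; [assumption|].
  revert Hc; unfold Rmin, Rmax; destruct (Rle_dec v u); intros Hc.
  - rewrite !Rabs_right; lra.
  - rewrite !Rabs_left1; lra.
Qed.

(** Chain rule at a moving time. The remainder of F is uniform in time, F1 has a Lipschitz constant
    of order n, and F0 is treated by [taylor2]; hence moving the time costs second order apart from
    the term dF0 h1. *)
Lemma expands_time (F F1 : R * R * R -> R -> R) (F0 dF0 : R -> R) (h h1 : R * R * R -> R) (h0 K : R) :
  expands PI nI (fun i => F (fst i) (snd i)) (fun i => F0 (snd i)) (fun i => F1 (fst i) (snd i)) ->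
  expands PT nrm h (fun _ => h0) h1 ->
  (forall th, PT th -> ta <= h th <= tb) -> ta <= h0 <= tb -> 0 <= K ->
  (forall t, ta <= t <= tb -> is_derive F0 t (dF0 t)) ->
  (forall s t, ta <= s <= tb -> ta <= t <= tb -> Rabs (dF0 s - dF0 t) <= K * Rabs (s - t)) ->
  (forall th s t, PT th -> ta <= s <= tb -> ta <= t <= tb ->
     Rabs (F1 th s - F1 th t) <= K * nrm th * Rabs (s - t)) ->
  expands PT nrm (fun th => F th (h th)) (fun _ => F0 h0) (fun th => F1 th h0 + dF0 h0 * h1 th).
Proof.
  intros [C [HC HF]] Sh Hh Hh0 HK HD HL HL1.
  destruct (expands_lip nrm_range Sh) as [M [HM Hlip]].
  destruct Sh as [C' [HC' Hs]].
  set (d := Rabs (dF0 h0)); assert (Hd : 0 <= d) by apply Rabs_pos.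
  exists (C + (K * M + (K * (M * M) + d * C'))).
  assert (0 <= K * M) by nra. assert (0 <= K * (M * M)) by (apply Rmult_le_pos; nra).
  assert (0 <= d * C') by nra.
  split; [lra|]; intros th Hth.
  assert (N := nrm_range th Hth); assert (N2 : 0 <= nrm th * nrm th) by nra.
  destruct (HF (th, h0) (conj Hth Hh0)) as [A0 [A1 _]].
  destruct (HF (th, h th) (conj Hth (Hh th Hth))) as [_ [_ A2]].
  destruct (Hs th Hth) as [_ [B1 B2]]; assert (L := Hlip th Hth).
  unfold nI in *; cbn [fst snd] in *.
  split; [lra|split].
  - apply Rle_trans with (C * nrm th + d * (C' * nrm th)).
    + apply abs_plus_le; [assumption|apply abs_mult_le; [apply Rle_refl|assumption]].
    + assert (0 <= K * M * nrm th) by nra. assert (0 <= K * (M * M) * nrm th) by nra. lra.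
  - assert (T := taylor2 F0 dF0 ta tb K (h th) h0 HD HL HK (Hh th Hth) Hh0).
    assert (L1 := HL1 th (h th) h0 Hth (Hh th Hth) Hh0).
    assert (P := Rabs_pos (h th - h0)).
    replace (F th (h th) - F0 h0 - (F1 th h0 + dF0 h0 * h1 th)) with
      ((F th (h th) - F0 (h th) - F1 th (h th)) + ((F1 th (h th) - F1 th h0) +
       ((F0 (h th) - F0 h0 - dF0 h0 * (h th - h0)) + dF0 h0 * (h th - h0 - h1 th)))) by ring.
    replace ((C + (K * M + (K * (M * M) + d * C'))) * (nrm th * nrm th)) with
      (C * (nrm th * nrm th) + (K * nrm th * (M * nrm th) + (K * ((M * nrm th) * (M * nrm th)) + d * (C' * (nrm th * nrm th))))) by ring.
    repeat apply abs_plus_le.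
    + assumption.
    + apply Rle_trans with (1 := L1), Rmult_le_compat_l; [nra|assumption].
    + apply Rle_trans with (1 := T), Rmult_le_compat_l; [assumption|]. apply Rmult_le_compat; assumption.
    + apply abs_mult_le; [apply Rle_refl|assumption].
Qed.

Lemma lipschitz_on (v dv : R -> R) :
  (forall t, is_derive v t (dv t)) -> (forall t, continuous dv t) ->
  exists K, 0 <= K /\ forall s t, ta <= s <= tb -> ta <= t <= tb -> Rabs (v s - v t) <= K * Rabs (s - t).
Proof.
  intros HD HC; destruct (continuous_bounded dv ta tb ltac:(unfold ta, tb; lra) HC) as [K [HK HB]].
  exists K; split; [exact HK|]; intros s t Hs Ht; apply mvt_bound with dv; [auto|].
  intros r Hr; apply HB, (between_sub _ _ t s); assumption.
Qed.

Lemma lin_lipschitz (u v y : R -> R) (K : R) (th : R * R * R) (s t : R) :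
  Rabs (u s - u t) <= K * Rabs (s - t) -> Rabs (v s - v t) <= K * Rabs (s - t) ->
  Rabs (y s - y t) <= K * Rabs (s - t) ->
  Rabs (lin (u s) (v s) (y s) th - lin (u t) (v t) (y t) th) <= K * nrm th * Rabs (s - t).
Proof.
  intros Hu Hv Hy.
  replace (lin (u s) (v s) (y s) th - lin (u t) (v t) (y t) th)
    with (lin (u s - u t) (v s - v t) (y s - y t) th) by (unfold lin; ring).
  replace (K * nrm th * Rabs (s - t)) with (K * Rabs (s - t) * nrm th) by ring.
  now apply lin_bound.
Qed.

Lemma lin_lipschitz_on (u v y du dv dy : R -> R) :
  (forall t, is_derive u t (du t)) -> (forall t, is_derive v t (dv t)) -> (forall t, is_derive y t (dy t)) ->
  (forall t, continuous du t) -> (forall t, continuous dv t) -> (forall t, continuous dy t) ->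
  exists K, 0 <= K /\ forall th s t, PT th -> ta <= s <= tb -> ta <= t <= tb ->
    Rabs (lin (u s) (v s) (y s) th - lin (u t) (v t) (y t) th) <= K * nrm th * Rabs (s - t).
Proof.
  intros Du Dv Dy Cu Cv Cy.
  destruct (lipschitz_on u du Du Cu) as [K1 [H1 L1]]; destruct (lipschitz_on v dv Dv Cv) as [K2 [H2 L2]].
  destruct (lipschitz_on y dy Dy Cy) as [K3 [H3 L3]].
  exists (K1 + (K2 + K3)); split; [lra|]; intros th s t _ Hs Ht.
  assert (A := Rabs_pos (s - t)).
  apply lin_lipschitz; [apply Rle_trans with (1 := L1 s t Hs Ht)|apply Rle_trans with (1 := L2 s t Hs Ht)
    |apply Rle_trans with (1 := L3 s t Hs Ht)]; apply Rmult_le_compat_r; lra.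
Qed.

Lemma variation_derive_continuous (k : R) (f v : R -> R) (t : R) :
  is_variation k f v -> (forall s, continuous f s) ->
  continuous (fun t => along (gx a0 a1 rho) t * v t + f t) t.
Proof.
  intros Hv Hf; apply (continuous_plus (fun s => along (gx a0 a1 rho) s * v s) f); [|apply Hf].
  apply (continuous_mult (along (gx a0 a1 rho)) v); [apply along_gx_continuous|].
  now apply (variation_continuous k f).
Qed.

Lemma w_derive_continuous (v f : R -> R) (t : R) :
  (forall s, continuous v s) -> (forall s, continuous f s) ->
  continuous (fun t => along (gxx a0 a1 rho) t * v t + f t) t.
Proof.
  intros Hv Hf; apply (continuous_plus (fun s => along (gxx a0 a1 rho) s * v s) f); [|apply Hf].
  apply (continuous_mult (along (gxx a0 a1 rho)) v); [apply along_gxx_continuous|apply Hv].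
Qed.

Lemma lin_xi_lipschitz : exists K, 0 <= K /\ forall th s t, PT th -> ta <= s <= tb -> ta <= t <= tb ->
  Rabs (lin (xi0 s) (xi1 s) (eta s) th - lin (xi0 t) (xi1 t) (eta t) th) <= K * nrm th * Rabs (s - t).
Proof.
  eapply lin_lipschitz_on; [apply xi0_spec|apply xi1_spec|apply eta_spec|..]; intros t;
    eapply variation_derive_continuous.
  - apply xi0_spec.
  - apply along_ga0_continuous.
  - apply xi1_spec.
  - apply along_ga1_continuous.
  - apply eta_spec.
  - intros s; apply (continuous_mult (fun _ => - gx a0 a1 rho 1) exp); [apply continuous_const|apply exp_continuous].
Qed.

Lemma lin_w_lipschitz : exists K, 0 <= K /\ forall th s t, PT th -> ta <= s <= tb -> ta <= t <= tb ->
  Rabs (lin (w0 s) (w1 s) (we s) th - lin (w0 t) (w1 t) (we t) th) <= K * nrm th * Rabs (s - t).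
Proof.
  eapply lin_lipschitz_on; [apply w0_derive|apply w1_derive|apply we_derive|..]; intros t;
    (apply w_derive_continuous || apply (w_derive_continuous eta (fun _ => 0))); intros s.
  - apply (variation_continuous _ _ _ _ xi0_spec).
  - apply along_gxa0_continuous.
  - apply (variation_continuous _ _ _ _ xi1_spec).
  - apply along_gxa1_continuous.
  - apply (variation_continuous _ _ _ _ eta_spec).
  - apply continuous_const.
Qed.

Lemma exp_lipschitz (s t : R) :
  ta <= s <= tb -> ta <= t <= tb -> Rabs (exp s - exp t) <= 5 * Rabs (s - t).
Proof.
  intros Hs Ht; apply mvt_bound with exp; intros r Hr; [apply is_derive_exp|].
  apply exp_bound, (between_sub _ _ t s); assumption.
Qed.

Lemma base_lipschitz (s t : R) :
  ta <= s <= tb -> ta <= t <= tb -> Rabs (x s - x t) <= 3 * Rabs (s - t).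
Proof.
  intros Hs Ht; apply mvt_bound with (fun t => g a0 a1 rho (x t) - g a0 a1 rho 1 * exp t); intros r Hr;
    assert (Hr' := between_sub _ _ t s r Ht Hs Hr).
  - apply sol_derive; [exact Ha|exact near0_1|exact Hr'].
  - apply sol_speed; [exact Ha|exact near0_1|exact Hr'].
Qed.

(** * Dependence of the hitting times on the data *)

Definition slope (t : R) : R := g a0 a1 rho (x t) - g a0 a1 rho 1 * exp t.

Lemma slope_lipschitz (s t : R) :
  ta <= s <= tb -> ta <= t <= tb -> Rabs (slope s - slope t) <= 4 * Rabs (s - t).
Proof.
  intros Hs Ht; unfold slope.
  assert (Ls := sol_in a0 a1 rho 1 Ha near0_1 s Hs); assert (Lt := sol_in a0 a1 rho 1 Ha near0_1 t Ht).
  assert (L := gc_lip a0 a1 rho (x s) (x t) Ha); unfold gc in L; rewrite !clamp_id in L by assumption.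
  assert (L' := base_lipschitz s t Hs Ht); assert (Le := exp_lipschitz s t Hs Ht).
  assert (Hc := g_start _ _ _ _ Ha near0_1); assert (P := Rabs_pos (s - t)).
  replace (_ - _) with ((g a0 a1 rho (x s) - g a0 a1 rho (x t)) + - g a0 a1 rho 1 * (exp s - exp t)) by ring.
  apply Rle_trans with (1 / 6 * (3 * Rabs (s - t)) + 668 / 1000 * (5 * Rabs (s - t))); [|lra].
  apply abs_plus_le; [lra|]. apply abs_mult_le; [|assumption]. apply abs_le; lra.
Qed.

(** Implicit differentiation with an explicit remainder. The vanishing of the moved orbit at h and
    the lower bound m on the slope first give h - h0 = O(n); Taylor's formula at h0 then gives
    slope(h0) (h - h0) = - lin + O(n^2). *)
Lemma expands_hit (h : R * R * R -> R) (h0 u v m : R) :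
  ta <= u -> v <= tb -> 0 < m -> u <= h0 <= v -> x h0 = 0 ->
  (forall th, PT th -> u <= h th <= v) ->
  (forall th, PT th -> sol (q0 th) (q1 th) rho (qx th) (h th) = 0) ->
  (forall t, u <= t <= v -> m <= Rabs (slope t)) ->
  expands PT nrm h (fun _ => h0) (fun th => - lin (xi0 h0) (xi1 h0) (eta h0) th / slope h0).
Proof.
  intros Hu Hv Hm Hh0 Z0 Hh Z Hs.
  destruct expands_sol as [C [HC HS]]; destruct lin_xi_lipschitz as [K [HK HL]].
  set (k := / m); assert (Hk : 0 < k) by (now apply Rinv_0_lt_compat).
  set (M := 2 * C * k); assert (HM : 0 <= M) by (unfold M; nra).
  exists (3 + C * k + (C + (4 * (M * M) + K * M)) * k).
  assert (0 <= C * k) by nra. assert (0 <= K * M) by nra.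
  assert (0 <= (C + (4 * (M * M) + K * M)) * k) by (apply Rmult_le_pos; nra).
  split; [lra|]; intros th Hth.
  assert (Hi := Hh th Hth); assert (Zi := Z th Hth); assert (N := nrm_range th Hth).
  assert (S0 := Hs h0 Hh0).
  assert (Hs0 : slope h0 <> 0) by (intros E; rewrite E, Rabs_R0 in S0; lra).
  assert (I0 : Rabs (/ slope h0) <= k).
  { rewrite Rabs_inv; apply Rinv_le_contravar; assumption. }
  destruct (HS (th, h0)) as [_ [A1 _]]; [split; [exact Hth|cbn; lra]|].
  destruct (HS (th, h th)) as [_ [B1 B2]]; [split; [exact Hth|cbn; lra]|].
  unfold nI in *; cbn [fst snd] in *.
  assert (Dx : forall t, ta <= t <= tb -> is_derive x t (slope t)).
  { intros t Ht; exact (sol_derive a0 a1 rho 1 Ha near0_1 t Ht). }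
  assert (Bx : Rabs (x (h th)) <= 2 * C * nrm th).
  { replace (x (h th)) with (- (sol (q0 th) (q1 th) rho (qx th) (h th) - x (h th) - lin (xi0 (h th)) (xi1 (h th)) (eta (h th)) th)
      - lin (xi0 (h th)) (xi1 (h th)) (eta (h th)) th) by (rewrite Zi; ring).
    replace (2 * C * nrm th) with (C * nrm th + C * nrm th) by ring.
    apply abs_plus_le; rewrite Rabs_Ropp; [|assumption].
    apply Rle_trans with (1 := B2); apply Rmult_le_compat_l; nra. }
  assert (Bh : Rabs (h th - h0) <= M * nrm th).
  { destruct (mvt_between x slope h0 (h th)) as [c [Hc E]].
    { intros t Ht; apply Dx; assert (Q := between_sub u v h0 (h th) t Hh0 Hi Ht); lra. }
    assert (Sc := Hs c (between_sub u v h0 (h th) c Hh0 Hi Hc)).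
    rewrite Z0, Rminus_0_r in E; rewrite E, Rabs_mult in Bx.
    assert (P := Rabs_pos (h th - h0)).
    apply Rmult_le_reg_l with m; [assumption|].
    replace (m * (M * nrm th)) with (2 * C * nrm th) by (unfold M, k; field; lra).
    apply Rle_trans with (2 := Bx), Rmult_le_compat_r; assumption. }
  split; [|split].
  - apply abs_le; unfold ta, tb in *; lra.
  - unfold Rdiv; apply Rle_trans with (C * nrm th * k).
    + apply abs_mult_le; [now rewrite Rabs_Ropp|assumption].
    + assert (0 <= (C + (4 * (M * M) + K * M)) * k * nrm th) by nra. lra.
  - assert (T := taylor2 x slope ta tb 4 (h th) h0 Dx slope_lipschitz ltac:(lra) ltac:(lra) ltac:(lra)).
    assert (L := HL th (h th) h0 Hth ltac:(lra) ltac:(lra)).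
    rewrite Z0, Zi in *.
    assert (P := Rabs_pos (h th - h0)).
    set (r1 := 0 - x (h th) - lin (xi0 (h th)) (xi1 (h th)) (eta (h th)) th) in *.
    set (r2 := x (h th) - 0 - slope h0 * (h th - h0)) in *.
    set (r3 := lin (xi0 (h th)) (xi1 (h th)) (eta (h th)) th - lin (xi0 h0) (xi1 h0) (eta h0) th) in *.
    replace (h th - h0 - - lin (xi0 h0) (xi1 h0) (eta h0) th / slope h0)
      with ((- r1 + (- r2 + - r3)) * / slope h0) by (unfold r1, r2, r3; field; assumption).
    apply Rle_trans with ((C * (nrm th * nrm th) + (4 * ((M * nrm th) * (M * nrm th)) + K * nrm th * (M * nrm th))) * k).
    + apply abs_mult_le; [|assumption].
      repeat apply abs_plus_le; rewrite Rabs_Ropp; [assumption| |].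
      * apply Rle_trans with (1 := T), Rmult_le_compat_l; [lra|]. apply Rmult_le_compat; assumption.
      * apply Rle_trans with (1 := L), Rmult_le_compat_l; [nra|assumption].
    + assert (0 <= nrm th * nrm th) by nra.
      assert (0 <= (3 + C * k) * (nrm th * nrm th)) by nra. nra.
Qed.

Notation tm := (hm a0 a1 rho 1).
Notation tp := (hp a0 a1 rho 1).

Lemma expands_hp : expands PT nrm (fun th => hp (q0 th) (q1 th) rho (qx th)) (fun _ => tp)
  (fun th => - lin (xi0 tp) (xi1 tp) (eta tp) th / slope tp).
Proof.
  destruct (hp_spec a0 a1 rho 1 Ha near0_1) as [H E].
  apply expands_hit with (3 / 10) tb (3 / 200); try assumption; try lra; try (unfold ta; lra).
  - intros th [H1 H2]; destruct (hp_spec _ _ _ _ H1 H2) as [H' _]; lra.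
  - intros th [H1 H2]; now apply hp_spec.
  - intros t Ht; assert (S := proj1 (sol_slope a0 a1 rho 1 Ha near0_1 t) ltac:(lra)).
    assert (R := sol_in a0 a1 rho 1 Ha near0_1 t ltac:(unfold ta; lra)).
    unfold gc in S; rewrite clamp_id in S by assumption; fold (slope t) in S.
    rewrite Rabs_left1; lra.
Qed.

Lemma expands_hm : expands PT nrm (fun th => hm (q0 th) (q1 th) rho (qx th)) (fun _ => tm)
  (fun th => - lin (xi0 tm) (xi1 tm) (eta tm) th / slope tm).
Proof.
  destruct (hm_spec a0 a1 rho 1 Ha near0_1) as [H E].
  apply expands_hit with ta (- (3 / 10)) (3 / 200); try assumption; try lra; try (unfold tb; lra).
  - intros th [H1 H2]; destruct (hm_spec _ _ _ _ H1 H2) as [H' _]; lra.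
  - intros th [H1 H2]; now apply hm_spec.
  - intros t Ht; assert (S := proj2 (sol_slope a0 a1 rho 1 Ha near0_1 t) ltac:(lra)).
    assert (R := sol_in a0 a1 rho 1 Ha near0_1 t ltac:(unfold tb; lra)).
    unfold gc in S; rewrite clamp_id in S by assumption; fold (slope t) in S.
    rewrite Rabs_right; lra.
Qed.

Lemma expands_exp_time (h h1 : R * R * R -> R) (h0 : R) :
  expands PT nrm h (fun _ => h0) h1 -> (forall th, PT th -> ta <= h th <= tb) -> ta <= h0 <= tb ->
  expands PT nrm (fun th => exp (h th)) (fun _ => exp h0) (fun th => exp h0 * h1 th).
Proof.
  intros Sh Hh Hh0.
  eapply expands_eq; [apply (expands_time (fun _ => exp) (fun _ _ => 0) exp exp h h1 h0 5)|..]; try assumption.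
  - apply (expands_const PI nI nI_range (fun i => exp (snd i)) 5); intros i [_ Hi]; now apply exp_bound.
  - lra.
  - intros; apply is_derive_exp.
  - exact exp_lipschitz.
  - intros th s t Hth _ _; rewrite Rminus_diag, Rabs_R0.
    apply Rmult_le_pos; [|apply Rabs_pos]. assert (N := nrm_range th Hth); lra.
  - reflexivity.
  - reflexivity.
  - intros th _; simpl; ring.
Qed.

Lemma gx_lipschitz : exists K, 0 <= K /\ forall s t, ta <= s <= tb -> ta <= t <= tb ->
  Rabs (gxs a0 a1 rho 1 s - gxs a0 a1 rho 1 t) <= K * Rabs (s - t).
Proof.
  destruct (continuity_ab_maj (fun y => Rabs (gxx a0 a1 rho y)) (- (1 / 2)) (11 / 10)) as [m [Hm _]]; [lra| |].
  { intros c Hc; apply (continuity_pt_comp (gxx a0 a1 rho) Rabs); [|apply Rcontinuity_abs].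
    assert (HB := g_bounds a0 a1 rho c Ha Hc); assert (HB' : B a0 a1 rho c <> 0) by lra; clear HB.
    assert (E : ex_derive (gxx a0 a1 rho) c)
      by (unfold gxx, Bx, Bxx, B in *; auto_derive; repeat split; exact HB').
    destruct E as [l E]; exact (derive_continuity_pt _ _ _ E). }
  exists (Rabs (gxx a0 a1 rho m) * 3); split; [assert (P := Rabs_pos (gxx a0 a1 rho m)); lra|].
  intros s t Hs Ht; unfold gxs; rewrite !clamp_t_id by assumption.
  assert (Is := sol_in a0 a1 rho 1 Ha near0_1 s Hs); assert (It := sol_in a0 a1 rho 1 Ha near0_1 t Ht).
  apply Rle_trans with (Rabs (gxx a0 a1 rho m) * Rabs (x s - x t)).
  - apply mvt_bound with (gxx a0 a1 rho); intros y Hy; assert (Hy' := between_sub _ _ _ _ y It Is Hy).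
    + apply derive_gx. assert (HB := g_bounds a0 a1 rho y Ha Hy'); lra.
    + now apply Hm.
  - rewrite Rmult_assoc; apply Rmult_le_compat_l; [apply Rabs_pos|now apply base_lipschitz].
Qed.

Lemma expands_energy_time (h h1 : R * R * R -> R) (h0 : R) :
  expands PT nrm h (fun _ => h0) h1 -> (forall th, PT th -> ta <= h th <= tb) -> ta <= h0 <= tb -> x h0 = 0 ->
  expands PT nrm (fun th => En (q0 th) (q1 th) rho (qx th) (h th)) (fun _ => En a0 a1 rho 1 h0)
    (fun th => lin (w0 h0) (w1 h0) (we h0) th + gx a0 a1 rho 0 * h1 th).
Proof.
  intros Sh Hh Hh0 Z.
  destruct lin_w_lipschitz as [K1 [HK1 L1]]; destruct gx_lipschitz as [K2 [HK2 L2]].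
  eapply expands_eq; [apply (expands_time (fun th => En (q0 th) (q1 th) rho (qx th)) (fun th t => lin (w0 t) (w1 t) (we t) th)
    (En a0 a1 rho 1) (gxs a0 a1 rho 1) h h1 h0 (K1 + K2))|..]; try assumption.
  - exact expands_energy.
  - lra.
  - intros t _; apply En_derive; [exact Ha|exact near0_1].
  - intros s t Hs Ht; apply Rle_trans with (1 := L2 s t Hs Ht), Rmult_le_compat_r; [apply Rabs_pos|lra].
  - intros th s t Hth Hs Ht; apply Rle_trans with (1 := L1 th s t Hth Hs Ht).
    assert (N := nrm_range th Hth); apply Rmult_le_compat_r; [apply Rabs_pos|apply Rmult_le_compat_r; lra].
  - reflexivity.
  - reflexivity.
  - intros th _; simpl; unfold gxs; now rewrite clamp_t_id, Z.
Qed.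

Definition hit_shift (v : R -> R) (t : R) : R := - v t / (g a0 a1 rho 0 - 2 / 3 * exp t).

(** dg0 is the derivative of g(0) in the direction considered. The motion of the hits is already
    eliminated: it enters through (2/3 e^T - g(0)) T', which is v(T). *)
Definition dchi (v : R -> R) (dg0 : R) : R := v tp - v tm - dg0 * (tp - tm).

Definition dlambda (v wv : R -> R) : R :=
  wv tp - wv tm + gx a0 a1 rho 0 * (hit_shift v tp - hit_shift v tm).

Lemma g_one (b0 b1 : R) : g b0 b1 rho 1 = 2 / 3.
Proof. unfold g, B; field. Qed.

Lemma slope_hit (t : R) : x t = 0 -> slope t = g a0 a1 rho 0 - 2 / 3 * exp t.
Proof. intros E; unfold slope; rewrite E, g_one; reflexivity. Qed.

Lemma slope_tp : slope tp <= - (3 / 200).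
Proof.
  destruct (hp_spec a0 a1 rho 1 Ha near0_1) as [H E].
  assert (S := proj1 (sol_slope a0 a1 rho 1 Ha near0_1 tp) ltac:(lra)).
  unfold gc in S; rewrite clamp_id in S by (rewrite E; lra); fold (slope tp) in S; lra.
Qed.

Lemma slope_tm : 3 / 200 <= slope tm.
Proof.
  destruct (hm_spec a0 a1 rho 1 Ha near0_1) as [H E].
  assert (S := proj2 (sol_slope a0 a1 rho 1 Ha near0_1 tm) ltac:(lra)).
  unfold gc in S; rewrite clamp_id in S by (rewrite E; lra); fold (slope tm) in S; lra.
Qed.

Let hp_range (th : R * R * R) : PT th -> ta <= hp (q0 th) (q1 th) rho (qx th) <= tb.
Proof. intros [H1 H2]; destruct (hp_spec _ _ _ _ H1 H2) as [H' _]; unfold ta; lra. Qed.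

Let hm_range (th : R * R * R) : PT th -> ta <= hm (q0 th) (q1 th) rho (qx th) <= tb.
Proof. intros [H1 H2]; destruct (hm_spec _ _ _ _ H1 H2) as [H' _]; unfold tb; lra. Qed.

Let tp_range : ta <= tp <= tb.
Proof. destruct (hp_spec a0 a1 rho 1 Ha near0_1) as [H _]; unfold ta; lra. Qed.

Let tm_range : ta <= tm <= tb.
Proof. destruct (hm_spec a0 a1 rho 1 Ha near0_1) as [H _]; unfold tb; lra. Qed.

Lemma expands_lambda : expands PT nrm
  (fun th => lambda_minus (q0 th) (q1 th) rho (qx th)) (fun _ => lambda_minus a0 a1 rho 1)
  (fun th => lin (dlambda xi0 w0) (dlambda xi1 w1) (dlambda eta we) th).
Proof.
  destruct (hp_spec a0 a1 rho 1 Ha near0_1) as [Hp Ep]; destruct (hm_spec a0 a1 rho 1 Ha near0_1) as [Hm Em].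
  assert (Sp := expands_energy_time _ _ _ expands_hp hp_range tp_range Ep).
  assert (Sm := expands_energy_time _ _ _ expands_hm hm_range tm_range Em).
  assert (Sc : expands PT nrm (fun _ => -1) (fun _ => -1) (fun _ => 0)).
  { apply (expands_const PT nrm nrm_range _ 1); intros; rewrite Rabs_left; lra. }
  assert (S1 := slope_tp); assert (S2 := slope_tm).
  eapply expands_eq; [exact (expands_plus Sp (expands_mult nrm_range Sc Sm))|..]; simpl.
  - intros th [H1 H2]; rewrite lambda_minus_eq by assumption; ring.
  - intros th _; rewrite lambda_minus_eq; [ring|exact Ha|exact near0_1].
  - intros th _; unfold dlambda, hit_shift; rewrite <- !slope_hit by assumption.
    unfold lin; field; lra.
Qed.

(** Defined on all triples so as to share the calculus of expansions; at x0 = 1 it is [chi1]. *)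
Definition chi (th : R * R * R) : R :=
  2 / 3 * (exp (hp (q0 th) (q1 th) rho (qx th)) - exp (hm (q0 th) (q1 th) rho (qx th)))
    - g (q0 th) (q1 th) rho 0 * (hp (q0 th) (q1 th) rho (qx th) - hm (q0 th) (q1 th) rho (qx th)).

Lemma expands_g_zero : expands PT nrm (fun th => g (q0 th) (q1 th) rho 0) (fun _ => g a0 a1 rho 0)
  (fun th => lin (ga0 a0 a1 rho 0) 0 0 th).
Proof.
  assert (R0 : ta <= 0 <= tb) by (unfold ta, tb; lra).
  (* The available expansions of the parameters are indexed with a time; time 0 serves as a
     dummy. *)
  assert (reidx : forall f f0 f1, expands PI nI (fun i => f (fst i)) (fun i => f0 (fst i)) (fun i => f1 (fst i)) ->
    expands PT nrm f f0 f1).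
  { intros f f0 f1 [C [HC H]]; exists C; split; [exact HC|]; intros th Hth.
    exact (H (th, 0) (conj Hth R0)). }
  apply reidx.
  eapply expands_eq; [apply (expands_g PI nI nI_range a0 a1 rho (fun i => q0 (fst i)) (fun i => q1 (fst i))
    (fun _ => 0) (fun _ => 0) (fun i => q0 (fst i) - a0) (fun i => q1 (fst i) - a1) (fun _ => 0) Ha
    (fun i H => proj1 (proj1 H)))|..].
  - intros; lra.
  - intros; lra.
  - exact expands_param0.
  - exact expands_param1.
  - apply (expands_const PI nI nI_range _ 0); intros; rewrite Rabs_R0; lra.
  - reflexivity.
  - reflexivity.
  - intros i _; simpl; unfold lin, ga1; ring.
Qed.

Lemma expands_chi : expands PT nrm chi (fun _ => chi1 a0 a1 rho)
  (fun th => lin (dchi xi0 (ga0 a0 a1 rho 0)) (dchi xi1 0) (dchi eta 0) th).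
Proof.
  destruct (hp_spec a0 a1 rho 1 Ha near0_1) as [Hp Ep]; destruct (hm_spec a0 a1 rho 1 Ha near0_1) as [Hm Em].
  assert (Xp := expands_exp_time _ _ _ expands_hp hp_range tp_range).
  assert (Xm := expands_exp_time _ _ _ expands_hm hm_range tm_range).
  assert (Sc : forall k, expands PT nrm (fun _ => k) (fun _ => k) (fun _ => 0)).
  { intros k; apply (expands_const PT nrm nrm_range _ (Rabs k)); intros; apply Rle_refl. }
  assert (S1 := slope_tp); assert (S2 := slope_tm).
  assert (Md : forall f f0 f1 h h0 h1, expands PT nrm f f0 f1 -> expands PT nrm h h0 h1 ->
    expands PT nrm (fun i => f i - h i) (fun i => f0 i - h0 i) (fun i => f1 i - h1 i)).
  { intros f f0 f1 h h0 h1 Sf Sh.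
    eapply expands_eq; [exact (expands_plus Sf (expands_mult nrm_range (Sc (-1)) Sh))|..];
      intros; simpl; ring. }
  eapply expands_eq; [exact (Md _ _ _ _ _ _ (expands_mult nrm_range (Sc (2 / 3)) (Md _ _ _ _ _ _ Xp Xm))
     (expands_mult nrm_range expands_g_zero (Md _ _ _ _ _ _ expands_hp expands_hm)))|..]; simpl.
  - reflexivity.
  - intros th _; now rewrite chi1_eq.
  - intros th _; rewrite (slope_hit tp Ep) in *; rewrite (slope_hit tm Em) in *.
    unfold dchi, lin; field; lra.
Qed.

(** * From expansions to derivatives *)

Hypothesis Hs0 : Rabs (a0 + 1 / 2) < 3 / 1000.
Hypothesis Hs1 : Rabs a1 < 4 / 100.

(** An interior point is needed in a0 and a1 only: rho is held fixed. *)
Lemma near_open : exists d : posreal, forall b0 b1, Rabs (b0 - a0) < d -> Rabs (b1 - a1) < d -> near b0 b1 rho.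
Proof.
  assert (Hd : 0 < Rmin (3 / 1000 - Rabs (a0 + 1 / 2)) (4 / 100 - Rabs a1)) by (apply Rmin_glb_lt; lra).
  exists (mkposreal _ Hd); simpl; intros b0 b1 H0 H1.
  assert (M0 := Rmin_l (3 / 1000 - Rabs (a0 + 1 / 2)) (4 / 100 - Rabs a1)).
  assert (M1 := Rmin_r (3 / 1000 - Rabs (a0 + 1 / 2)) (4 / 100 - Rabs a1)).
  destruct Ha as [_ [_ Hr]]; split; [|split; [|exact Hr]].
  - replace (b0 + 1 / 2) with ((b0 - a0) + (a0 + 1 / 2)) by ring.
    apply Rle_trans with (1 := Rabs_triang _ _); lra.
  - replace b1 with ((b1 - a1) + a1) by ring.
    apply Rle_trans with (1 := Rabs_triang _ _); lra.
Qed.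

Lemma expands_differentiable (F : R * R * R -> R) (f : R -> R -> R) (v u0 u1 u2 : R) :
  expands PT nrm F (fun _ => v) (fun th => lin u0 u1 u2 th) ->
  (forall b0 b1, near b0 b1 rho -> f b0 b1 = F (b0, b1, 1)) -> f a0 a1 = v ->
  differentiable_pt_lim f a0 a1 u0 u1.
Proof.
  intros [C [HC H]] Ef Ev eps.
  destruct near_open as [d Hd].
  (* The sum norm is at most twice the maximum norm r of the increment, so the remainder is at most
     4 C r^2. *)
  assert (Hk : 0 < eps / (4 * C + 1)) by (apply Rdiv_lt_0_compat; [apply cond_pos|lra]).
  assert (Hm : 0 < Rmin d (eps / (4 * C + 1))) by (apply Rmin_glb_lt; [apply cond_pos|exact Hk]).
  exists (mkposreal _ Hm); simpl; intros b0 b1 B0 B1.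
  assert (M0 := Rmin_l d (eps / (4 * C + 1))); assert (M1 := Rmin_r d (eps / (4 * C + 1))).
  assert (Hn : near b0 b1 rho) by (apply Hd; lra).
  destruct (H (b0, b1, 1) (conj Hn near0_1)) as [_ [_ E]].
  rewrite Ef, Ev by assumption; unfold lin, nrm, q0, q1, qx in E; simpl in E.
  rewrite Rminus_diag, Rabs_R0 in E.
  set (r := Rmax (Rabs (b0 - a0)) (Rabs (b1 - a1))).
  assert (R0 := Rmax_l (Rabs (b0 - a0)) (Rabs (b1 - a1))); assert (R1 := Rmax_r (Rabs (b0 - a0)) (Rabs (b1 - a1))).
  fold r in R0, R1.
  assert (Hr : r < eps / (4 * C + 1)) by (apply Rmax_lub_lt; lra).
  assert (P0 := Rabs_pos (b0 - a0)); assert (P1 := Rabs_pos (b1 - a1)).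
  match goal with |- Rabs ?e <= _ => match type of E with Rabs ?e' <= _ => replace e with e' by ring end end.
  apply Rle_trans with (1 := E).
  apply Rle_trans with (C * ((2 * r) * (2 * r))).
  - apply Rmult_le_compat_l; [assumption|]. apply Rmult_le_compat; lra.
  - replace (C * (2 * r * (2 * r))) with (4 * C * r * r) by ring.
    apply Rmult_le_compat_r; [lra|].
    apply Rle_trans with ((4 * C + 1) * (eps / (4 * C + 1))); [|right; field; lra].
    nra.
Qed.

Lemma chi1_differentiable :
  differentiable_pt_lim (fun b0 b1 => chi1 b0 b1 rho) a0 a1 (dchi xi0 (ga0 a0 a1 rho 0)) (dchi xi1 0).
Proof.
  apply (expands_differentiable chi _ _ _ _ _ expands_chi); [|reflexivity].
  intros b0 b1 Hb; now rewrite chi1_eq.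
Qed.

Lemma lambda_minus_differentiable :
  differentiable_pt_lim (fun b0 b1 => lambda_minus b0 b1 rho 1) a0 a1 (dlambda xi0 w0) (dlambda xi1 w1).
Proof. now apply (expands_differentiable _ _ _ _ _ _ expands_lambda). Qed.

Lemma lambda_minus_derive : is_derive (lambda_minus a0 a1 rho) 1 (dlambda eta we).
Proof.
  destruct expands_lambda as [C [HC H]].
  apply is_derive_Reals; intros eps Heps.
  assert (Hk : 0 < eps / (C + 1)) by (apply Rdiv_lt_0_compat; lra).
  assert (Hm : 0 < Rmin (1 / 100) (eps / (C + 1))) by (apply Rmin_glb_lt; lra).
  exists (mkposreal _ Hm); simpl; intros h Hh0 Hh.
  assert (M0 := Rmin_l (1 / 100) (eps / (C + 1))); assert (M1 := Rmin_r (1 / 100) (eps / (C + 1))).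
  assert (Hn : near0 (1 + h)) by (unfold near0; replace (1 + h - 1) with h by ring; lra).
  destruct (H (a0, a1, 1 + h) (conj Ha Hn)) as [_ [_ E]].
  unfold lin, nrm, q0, q1, qx in E; simpl in E.
  rewrite !Rminus_diag, Rabs_R0 in E; replace (1 + h - 1) with h in E by ring.
  assert (P := Rabs_pos_lt h Hh0).
  replace ((lambda_minus a0 a1 rho (1 + h) - lambda_minus a0 a1 rho 1) / h - dlambda eta we)
    with ((lambda_minus a0 a1 rho (1 + h) - lambda_minus a0 a1 rho 1 - dlambda eta we * h) * / h)
    by (field; assumption).
  rewrite Rabs_mult, Rabs_inv.
  apply Rmult_lt_reg_r with (Rabs h); [assumption|].
  rewrite Rmult_assoc, Rinv_l, Rmult_1_r by lra.
  apply Rle_lt_trans with (C * (Rabs h * Rabs h)).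
  - match type of E with Rabs ?e' <= ?b' => match goal with |- Rabs ?e <= ?b => 
      replace e with e' by ring; replace b with b' by ring end end; exact E.
  - rewrite <- Rmult_assoc; apply Rmult_lt_compat_r; [assumption|].
    apply Rle_lt_trans with (C * (eps / (C + 1))); [apply Rmult_le_compat_l; lra|].
    replace (C * (eps / (C + 1))) with (eps - eps / (C + 1)) by (field; lra). lra.
Qed.

End Dependence.

(** * Taylor models with integer coefficients *)

Fixpoint pev (l : list Z) (s : R) : R :=
  match l with [] => 0 | a :: l => IZR a + s * pev l s end.

Fixpoint pnorm (l : list Z) : Z :=
  match l with [] => 0%Z | a :: l => (Z.abs a + pnorm l)%Z end.

Fixpoint padd (l m : list Z) : list Z :=
  match l, m with
  | [], _ => m
  | _, [] => l
  | a :: l, b :: m => (a + b)%Z :: padd l m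
  end.

Definition pscale (k : Z) (l : list Z) : list Z := map (Z.mul k) l.

Fixpoint pder (l : list Z) : list Z :=
  match l with [] => [] | _ :: l => padd l (0%Z :: pder l) end.

Fixpoint pmul (n : nat) (l m : list Z) : list Z :=
  match n, l with
  | S n', a :: l' => padd (pscale a (firstn n m)) (0%Z :: pmul n' l' m)
  | _, _ => []
  end.

(* Bounds the terms of degree at least n which [pmul n] drops. *)
Fixpoint pmul_tail (n : nat) (l m : list Z) : Z :=
  match n, l with
  | S n', a :: l' => (Z.abs a * pnorm (skipn n m) + pmul_tail n' l' m)%Z
  | _, _ => (pnorm l * pnorm m)%Z
  end.

Fixpoint psum (l : list Z) : Z := match l with [] => 0%Z | a :: l => (a + psum l)%Z end.

Fixpoint paltsum (l : list Z) : Z := match l with [] => 0%Z | a :: l => (a - paltsum l)%Z end.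

Lemma pev_padd (l m : list Z) (s : R) : pev (padd l m) s = pev l s + pev m s.
Proof.
  revert m; induction l as [|a l IH]; intros [|b m]; simpl; try ring.
  rewrite plus_IZR, IH; ring.
Qed.

Lemma pev_pscale (k : Z) (l : list Z) (s : R) : pev (pscale k l) s = IZR k * pev l s.
Proof. induction l as [|a l IH]; simpl; [ring|]. rewrite mult_IZR, IH; ring. Qed.

Lemma pev_1 (l : list Z) : pev l 1 = IZR (psum l).
Proof. induction l as [|a l IH]; simpl; [reflexivity|]. rewrite plus_IZR, IH; ring. Qed.

Lemma pev_m1 (l : list Z) : pev l (-1) = IZR (paltsum l).
Proof. induction l as [|a l IH]; simpl; [reflexivity|]. rewrite minus_IZR, IH; ring. Qed.

Lemma pev_derive (l : list Z) (s : R) : is_derive (pev l) s (pev (pder l) s).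
Proof.
  induction l as [|a l IH]; simpl.
  - apply (is_derive_const 0).
  - rewrite pev_padd; simpl.
    apply is_derive_eq with (0 + (1 * pev l s + s * pev (pder l) s)); [|ring].
    apply derive_plus; [apply (is_derive_const (IZR a))|].
    apply (derive_mult (fun s => s) (pev l)); [apply (is_derive_id s)|exact IH].
Qed.

Lemma pev_pnorm (l : list Z) (s : R) : Rabs s <= 1 -> Rabs (pev l s) <= IZR (pnorm l).
Proof.
  intros Hs; induction l as [|a l IH]; simpl; [rewrite Rabs_R0; lra|].
  rewrite plus_IZR, abs_IZR; apply abs_plus_le; [apply Rle_refl|].
  rewrite <- (Rmult_1_l (IZR (pnorm l))); now apply abs_mult_le.
Qed.

Lemma pev_firstn (k : nat) (l : list Z) (s : R) :
  Rabs s <= 1 -> Rabs (pev l s - pev (firstn k l) s) <= IZR (pnorm (skipn k l)).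
Proof.
  intros Hs; revert l; induction k as [|k IH]; intros l.
  - simpl; rewrite Rminus_0_r; now apply pev_pnorm.
  - destruct l as [|a l]; simpl; [rewrite Rminus_0_r, Rabs_R0; lra|].
    replace (_ - _) with (s * (pev l s - pev (firstn k l) s)) by ring.
    rewrite <- (Rmult_1_l (IZR _)); apply abs_mult_le; [exact Hs|apply IH].
Qed.

Lemma pev_pmul (n : nat) (l m : list Z) (s : R) :
  Rabs s <= 1 -> Rabs (pev l s * pev m s - pev (pmul n l m) s) <= IZR (pmul_tail n l m).
Proof.
  intros Hs; revert l; induction n as [|n IH]; intros l.
  - simpl; rewrite Rminus_0_r, mult_IZR; apply abs_mult_le; now apply pev_pnorm.
  - destruct l as [|a l].
    + cbn [pmul pmul_tail pnorm pev]; rewrite Rmult_0_l, Rminus_0_r, Rabs_R0; simpl; lra.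
    + cbn [pmul pmul_tail]. rewrite pev_padd, pev_pscale, plus_IZR, mult_IZR, abs_IZR.
      cbn [pev].
      replace (_ - _) with (IZR a * (pev m s - pev (firstn (S n) m) s)
        + s * (pev l s * pev m s - pev (pmul n l m) s)) by ring.
      apply abs_plus_le.
      * apply abs_mult_le; [apply Rle_refl|now apply pev_firstn].
      * rewrite <- (Rmult_1_l (IZR _)); apply abs_mult_le; [exact Hs|apply IH].
Qed.

Section TaylorModels.

Variables (p : Z) (n : nat).
Hypothesis Hp : (0 <= p)%Z.

Definition scale : Z := (2 ^ p)%Z.
Notation S2 := (IZR scale).

(** A polynomial on [-1, 1] together with a uniform error radius, both in units of 2^(-p). *)
Definition tm : Type := (list Z * Z)%type.

Definition tm_ok (f : R -> R) (m : tm) : Prop :=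
  forall s, -1 <= s <= 1 -> Rabs (f s * S2 - pev (fst m) s) <= IZR (snd m).

Definition tadd (a b : tm) : tm := (padd (fst a) (fst b), (snd a + snd b)%Z).
Definition tscale (k : Z) (a : tm) : tm := (pscale k (fst a), (Z.abs k * snd a)%Z).
Definition tsub (a b : tm) : tm := tadd a (tscale (-1) b).
Definition tconst (c e : Z) : tm := ([c], e).
(** The error collects the dropped terms of high degree and the products involving the operands'
    errors, scaled down. The 1 pays for flooring this bound, the length of l for flooring each
    coefficient. *)
Definition tmul (a b : tm) : tm :=
  let la := fst a in let lb := fst b in let ea := snd a in let eb := snd b in
  let l := pmul n la lb in
  (map (fun c => Z.shiftr c p) l,
   (Z.shiftr (pmul_tail n la lb + pnorm la * eb + ea * pnorm lb + ea * eb) p + 1 + Z.of_nat (length l))%Z).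
Definition tmag (a : tm) : Z := (pnorm (fst a) + snd a)%Z.

Lemma scale_pos : 0 < S2.
Proof. apply IZR_lt; unfold scale; apply Z.pow_pos_nonneg; lia. Qed.

Lemma shiftr_bounds (c : Z) : IZR (Z.shiftr c p) <= IZR c / S2 < IZR (Z.shiftr c p) + 1.
Proof.
  assert (H := scale_pos); rewrite Z.shiftr_div_pow2 by exact Hp; fold scale.
  assert (HS : (0 < scale)%Z) by (apply lt_IZR; exact H).
  assert (E := Z.div_mod c scale ltac:(lia)); assert (M := Z.mod_pos_bound c scale HS).
  assert (E' : IZR c = S2 * IZR (c / scale) + IZR (c mod scale)) by (rewrite <- mult_IZR, <- plus_IZR; now f_equal).
  destruct M as [M1 M2]; apply IZR_le in M1; apply IZR_lt in M2.
  split.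
  - apply Rmult_le_reg_r with S2; [exact H|]. unfold Rdiv; rewrite Rmult_assoc, Rinv_l by lra. lra.
  - apply Rmult_lt_reg_r with S2; [exact H|]. unfold Rdiv; rewrite Rmult_assoc, Rinv_l by lra. lra.
Qed.

Lemma pev_shiftr (l : list Z) (s : R) : Rabs s <= 1 ->
  Rabs (pev l s / S2 - pev (map (fun c => Z.shiftr c p) l) s) <= IZR (Z.of_nat (length l)).
Proof.
  intros Hs; induction l as [|a l IH]; [simpl; unfold Rdiv; rewrite Rmult_0_l, Rminus_0_r, Rabs_R0; lra|].
  change (length (a :: l)) with (S (length l)); rewrite Nat2Z.inj_succ, <- Z.add_1_l, plus_IZR.
  cbn [pev map].
  assert (H := scale_pos); assert (B := shiftr_bounds a).
  replace (_ - _) with ((IZR a / S2 - IZR (Z.shiftr a p))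
    + s * (pev l s / S2 - pev (map (fun c => Z.shiftr c p) l) s)) by (field; lra).
  apply abs_plus_le; [apply abs_le; lra|].
  rewrite <- (Rmult_1_l (IZR (Z.of_nat (length l)))); now apply abs_mult_le.
Qed.

Lemma tm_ext (f h : R -> R) (m : tm) :
  tm_ok f m -> (forall s, -1 <= s <= 1 -> h s = f s) -> tm_ok h m.
Proof. intros H E s Hs; rewrite E by exact Hs; now apply H. Qed.

Lemma tadd_ok (f h : R -> R) (a b : tm) :
  tm_ok f a -> tm_ok h b -> tm_ok (fun s => f s + h s) (tadd a b).
Proof.
  intros Hf Hh s Hs; simpl; rewrite pev_padd, plus_IZR.
  replace (_ - _) with ((f s * S2 - pev (fst a) s) + (h s * S2 - pev (fst b) s)) by ring.
  apply abs_plus_le; auto.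
Qed.

Lemma tscale_ok (k : Z) (f : R -> R) (a : tm) :
  tm_ok f a -> tm_ok (fun s => IZR k * f s) (tscale k a).
Proof.
  intros Hf s Hs; simpl; rewrite pev_pscale, mult_IZR, abs_IZR.
  replace (_ - _) with (IZR k * (f s * S2 - pev (fst a) s)) by ring.
  apply abs_mult_le; [apply Rle_refl|auto].
Qed.

Lemma tsub_ok (f h : R -> R) (a b : tm) :
  tm_ok f a -> tm_ok h b -> tm_ok (fun s => f s - h s) (tsub a b).
Proof.
  intros Hf Hh; eapply tm_ext; [apply (tadd_ok _ _ _ _ Hf (tscale_ok (-1) _ _ Hh))|].
  intros; simpl; ring.
Qed.

Lemma tconst_ok (f : R -> R) (c e : Z) :
  (forall s, -1 <= s <= 1 -> Rabs (f s * S2 - IZR c) <= IZR e) -> tm_ok f (tconst c e).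
Proof. intros H s Hs; simpl; rewrite Rmult_0_r, Rplus_0_r; now apply H. Qed.

Lemma tpoly_ok (l : list Z) : tm_ok (fun s => pev l s / S2) (l, 0%Z).
Proof.
  intros s Hs; assert (H := scale_pos); simpl.
  replace (_ - _) with 0 by (field; lra). rewrite Rabs_R0; lra.
Qed.

Lemma tmul_ok (f h : R -> R) (a b : tm) :
  tm_ok f a -> tm_ok h b -> tm_ok (fun s => f s * h s) (tmul a b).
Proof.
  intros Hf Hh s Hs; specialize (Hf s Hs); specialize (Hh s Hs).
  destruct a as [la ea]; destruct b as [lb eb]; unfold tmul; cbn [fst snd] in *.
  assert (Hs' : Rabs s <= 1) by (apply abs_le; lra).
  assert (H := scale_pos).
  assert (M := pev_pmul n la lb s Hs'); assert (Sh := pev_shiftr (pmul n la lb) s Hs').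
  assert (Na := pev_pnorm la s Hs'); assert (Nb := pev_pnorm lb s Hs').
  set (e := (pmul_tail n la lb + pnorm la * eb + ea * pnorm lb + ea * eb)%Z).
  assert (B := shiftr_bounds e).
  rewrite plus_IZR, plus_IZR.
  set (al := f s * S2 - pev la s) in *; set (be := h s * S2 - pev lb s) in *.
  set (r := pev la s * pev lb s - pev (pmul n la lb) s) in *.
  replace (f s * h s * S2 - pev (map (fun c => Z.shiftr c p) (pmul n la lb)) s) with
    ((r + pev la s * be + al * pev lb s + al * be) * / S2
     + (pev (pmul n la lb) s / S2 - pev (map (fun c => Z.shiftr c p) (pmul n la lb)) s))
    by (unfold al, be, r; field; lra).
  apply abs_plus_le; [|exact Sh].
  apply Rle_trans with (IZR e * / S2); [|unfold Rdiv in B; lra].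
  rewrite Rabs_mult, (Rabs_right (/ S2)) by (apply Rle_ge, Rlt_le, Rinv_0_lt_compat; exact H).
  apply Rmult_le_compat_r; [apply Rlt_le, Rinv_0_lt_compat; exact H|].
  unfold e; rewrite !plus_IZR, !mult_IZR.
  repeat apply abs_plus_le; try assumption; now apply abs_mult_le.
Qed.

Lemma tmag_ok (f : R -> R) (a : tm) (s : R) :
  tm_ok f a -> -1 <= s <= 1 -> Rabs (f s) <= IZR (tmag a) / S2.
Proof.
  intros Hf Hs; specialize (Hf s Hs); assert (H := scale_pos).
  assert (N := pev_pnorm (fst a) s ltac:(apply abs_le; lra)).
  replace (f s) with (((f s * S2 - pev (fst a) s) + pev (fst a) s) * / S2) by (field; lra).
  rewrite Rabs_mult, (Rabs_right (/ S2)) by (apply Rle_ge, Rlt_le, Rinv_0_lt_compat; exact H).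
  apply Rmult_le_compat_r; [apply Rlt_le, Rinv_0_lt_compat; exact H|].
  unfold tmag; rewrite plus_IZR, Rplus_comm; now apply abs_plus_le.
Qed.

(** The bound 2 (d + 2 eps) of [comparison_s]: d is the mismatch at s = -1, the point of time 0, and
    eps is multiplied by the length 2 of the interval. *)
Definition residual_error (v0 : Z) (l : list Z) (res : tm) : Z :=
  (2 * (Z.abs (v0 - paltsum l) + 2 * tmag res))%Z.

Lemma comparison_s (phi dphi : R -> R) (L eps d : R) :
  0 <= L <= 1 / 4 -> 0 <= eps ->
  (forall s, -1 <= s <= 1 -> is_derive phi s (dphi s)) ->
  (forall s, -1 <= s <= 1 -> Rabs (dphi s) <= L * Rabs (phi s) + eps) ->
  Rabs (phi (-1)) <= d ->
  forall s, -1 <= s <= 1 -> Rabs (phi s) <= 2 * (d + eps * 2).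
Proof.
  intros HL He HD HB H0 s Hs.
  assert (C := comparison (fun u => phi (u - 1)) (fun u => dphi (u - 1)) 0 2 L 2 eps d).
  replace s with ((s + 1) - 1) by ring; apply C; try lra.
  - intros t Ht; apply is_derive_eq with (1 * dphi (t - 1)); [|ring].
    apply (derive_comp phi (fun u => u - 1)); [apply HD; lra|].
    apply is_derive_eq with (1 - 0); [|ring].
    apply derive_minus; [apply (is_derive_id t)|apply (is_derive_const 1)].
  - intros t Ht; apply HB; lra.
  - replace (0 - 1) with (-1) by ring; exact H0.
Qed.

(** A posteriori estimate: h is the residual of the polynomial in the equation of f. The polynomial
    may come from anywhere; its quality shows only in the size of [res]. *)
Lemma candidate_ok (f df : R -> R) (L : R) (v0 : Z) (l : list Z) (res : tm) (h : R -> R) :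
  0 <= L <= 1 / 4 -> tm_ok h res -> f (-1) * S2 = IZR v0 ->
  (forall s, -1 <= s <= 1 -> is_derive f s (df s)) ->
  (forall s, -1 <= s <= 1 ->
    Rabs (df s - pev (pder l) s / S2 - h s) <= L * Rabs (f s - pev l s / S2)) ->
  tm_ok f (l, residual_error v0 l res).
Proof.
  intros HL Hres H0 HD HB s Hs; assert (H := scale_pos).
  assert (C : Rabs (f s - pev l s / S2) <= 2 * (IZR (Z.abs (v0 - paltsum l)) / S2 + IZR (tmag res) / S2 * 2)).
  { apply (comparison_s (fun s => f s - pev l s / S2) (fun s => df s - pev (pder l) s / S2) L).
    - exact HL.
    - apply Rle_trans with (2 := tmag_ok h res s Hres Hs), Rabs_pos.
    - intros t Ht; apply derive_minus; [now apply HD|].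
      apply is_derive_eq with (pev (pder l) t * / S2 + pev l t * 0); [|unfold Rdiv; ring].
      apply (derive_mult (pev l) (fun _ => / S2)); [apply pev_derive|apply (is_derive_const (/ S2))].
    - intros t Ht.
      replace (df t - pev (pder l) t / S2) with ((df t - pev (pder l) t / S2 - h t) + h t) by ring.
      apply abs_plus_le; [now apply HB|now apply tmag_ok].
    - rewrite pev_m1, abs_IZR, minus_IZR, <- H0.
      replace (f (-1) - IZR (paltsum l) / S2) with ((f (-1) * S2 - IZR (paltsum l)) * / S2) by (field; lra).
      rewrite Rabs_mult, (Rabs_right (/ S2)) by (apply Rle_ge, Rlt_le, Rinv_0_lt_compat; exact H).
      apply Rle_refl.
    - exact Hs. }
  cbn [fst snd]; unfold residual_error; rewrite mult_IZR, plus_IZR, mult_IZR.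
  replace (f s * S2 - pev l s) with ((f s - pev l s / S2) * S2) by (field; lra).
  rewrite Rabs_mult, (Rabs_right S2) by lra.
  apply Rmult_le_compat_r with (r := S2) in C; [|lra].
  apply Rle_trans with (1 := C); right; field; lra.
Qed.

Definition linear_step (v0 : Z) (A b : tm) (l : list Z) : tm :=
  (l, residual_error v0 l (tsub (tadd (tmul A (l, 0%Z)) b) (pder l, 0%Z))).

Lemma linear_step_ok (f A b : R -> R) (v0 : Z) (tA tb : tm) (l : list Z) :
  tm_ok A tA -> tm_ok b tb -> (forall s, -1 <= s <= 1 -> Rabs (A s) <= 1 / 4) ->
  f (-1) * S2 = IZR v0 ->
  (forall s, -1 <= s <= 1 -> is_derive f s (A s * f s + b s)) ->
  tm_ok f (linear_step v0 tA tb l).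
Proof.
  intros HA Hb HL H0 HD.
  eapply (candidate_ok f (fun s => A s * f s + b s) (1 / 4)); [lra| |exact H0|exact HD|].
  - apply tsub_ok; [apply tadd_ok; [apply tmul_ok; [exact HA|apply tpoly_ok]|exact Hb]|apply tpoly_ok].
  - intros s Hs; cbv beta.
    replace (_ - _) with (A s * (f s - pev l s / S2)) by ring.
    apply abs_mult_le; [now apply HL|apply Rle_refl].
Qed.

(* Antiderivative vanishing at -1, up to rounding; its error is recomputed from
   its derivative. *)
Fixpoint pint_from (k : Z) (l : list Z) : list Z :=
  match l with [] => [] | a :: l => (a / k)%Z :: pint_from (k + 1) l end.

Definition pint (v0 : Z) (l : list Z) : list Z :=
  let q := pint_from 1 l in (v0 + paltsum q)%Z :: q.

Definition integral_step (b : tm) : tm :=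
  let l := pint 0 (fst b) in (l, residual_error 0 l (tsub b (pder l, 0%Z))).

Lemma integral_step_ok (f b : R -> R) (tb : tm) :
  tm_ok b tb -> f (-1) = 0 -> (forall s, -1 <= s <= 1 -> is_derive f s (b s)) ->
  tm_ok f (integral_step tb).
Proof.
  intros Hb H0 HD.
  eapply (candidate_ok f b 0); [lra| |rewrite H0; apply Rmult_0_l|exact HD|].
  - apply tsub_ok; [exact Hb|apply tpoly_ok].
  - intros s Hs; cbv beta; rewrite Rmult_0_l.
    replace (_ - _) with 0 by ring; rewrite Rabs_R0; lra.
Qed.

(** From 1/b - l = - (b l - 1) / b with 1/b <= 10/9; the factor is rounded up to 2. *)
Definition inverse_step (b : tm) (l : list Z) : tm :=
  (l, (2 * tmag (tsub (tmul b (l, 0%Z)) (tconst scale 0)))%Z).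

Lemma tone_ok : tm_ok (fun _ => 1) (tconst scale 0).
Proof. apply tconst_ok; intros; rewrite Rmult_1_l, Rminus_diag, Rabs_R0; lra. Qed.

Lemma inverse_step_ok (b : R -> R) (tb : tm) (l : list Z) :
  tm_ok b tb -> (forall s, -1 <= s <= 1 -> 9 / 10 <= b s) ->
  tm_ok (fun s => / b s) (inverse_step tb l).
Proof.
  intros Hb H9 s Hs; assert (H := scale_pos); specialize (H9 s Hs); cbn [fst snd inverse_step].
  assert (M := tmag_ok _ _ s (tsub_ok _ _ _ _ (tmul_ok _ _ _ _ Hb (tpoly_ok l)) tone_ok) Hs).
  cbv beta in M; rewrite mult_IZR; set (e := IZR (tmag _)) in *.
  replace (/ b s * S2 - pev l s) with (- (b s * (pev l s / S2) - 1) * (S2 * / b s)) by (field; lra).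
  replace (2 * e) with (e / S2 * (S2 * 2)) by (field; lra).
  apply abs_mult_le; [now rewrite Rabs_Ropp|].
  apply abs_mult_le; [rewrite Rabs_right; lra|].
  rewrite Rabs_right by (apply Rle_ge, Rlt_le, Rinv_0_lt_compat; lra).
  apply Rle_trans with (/ (9 / 10)); [apply Rinv_le_contravar; lra|lra].
Qed.

End TaylorModels.

(** * Enclosing one branch of the orbit *)

(* Candidate polynomials in s for the branch t = r (1 + s), with r = cr / 2^p
   and coefficients scaled by 2^p. *)
Record candidates : Type := Candidates {
  cr : Z; cy : list Z; cx : list Z; cz : list Z; cxi0 : list Z; cxi1 : list Z; ceta : list Z
}.

Section Branch.

Variables (p : Z) (n : nat) (az0 az1 rhoz er : Z) (cd : candidates).

Notation "a '*t' b" := (tmul p n a b) (at level 40, left associativity).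
Notation "a '+t' b" := (tadd a b) (at level 50, left associativity).
Notation "a '-t' b" := (tsub a b) (at level 50, left associativity).

Definition tone : tm := tconst (scale p) 0.
Definition tthird : tm := tconst (scale p / 3) 1.
Definition ttwothird : tm := tconst (2 * scale p / 3) 1.
Definition tr : tm := tconst (cr cd) 0.
Definition tA0 : tm := tconst az0 er.
Definition tA1 : tm := tconst az1 er.
(** 1/20 is not dyadic: the radius 2 covers its approximation at the finest scale and the floor in
    passing to a coarser one. *)
Definition trho : tm := tconst rhoz 2.

(** The coefficient r of y' = r y exceeds the 1/4 allowed in [candidate_ok], so the error is bounded
    by an integrating factor instead; 20 bounds e^(27/10), and with it every quotient of two values
    of y. *)
Definition ty : tm :=
  (cy cd, (20 * (Z.abs (scale p - paltsum (cy cd))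
     + 2 * tmag (tr *t (cy cd, 0%Z) -t (pder (cy cd), 0%Z))))%Z).

Definition tq (x : tm) : tm := tA0 +t x *t (tA1 +t trho *t x).
Definition tB (x q : tm) : tm := tone +t (x -t tone) *t q.
Definition tN (x : tm) : tm := tone -t tthird *t x.

(* 1 + 2/3 (t + 1 - e^t), the orbit for a0 = -1/2, a1 = rho = 0. *)
Definition tunperturbed (y : tm) : tm := tone +t ttwothird *t ((cr cd :: cr cd :: nil, 0%Z) +t tone -t y).

(** The bounds on g apply to the candidate only if it stays in [-1/2, 11/10]. The upper bound
    compares it with the unperturbed orbit, which is at most 1 as e^t >= 1 + t. The coefficient norm
    would be too coarse there, but suffices for the lower bound. *)
Definition candidate_in_range (y : tm) : bool :=
  ((10 * tmag ((cx cd, 0%Z) -t tunperturbed y) <=? scale p)%Z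
   && match cx cd with [] => false | a :: l => (- scale p <=? 2 * (a - pnorm l))%Z end)%bool.

(** The polynomial [cz] is tested here as inverse of B along the candidate, and in [tz] as inverse
    of B along the enclosure of the true orbit. *)
Definition tx (y : tm) : tm :=
  let x := (cx cd, 0%Z) in
  let z := inverse_step p n (tB x (tq x)) (cz cd) in
  (cx cd, residual_error (scale p) (cx cd)
     (tr *t (tN x *t z -t ttwothird *t y) -t (pder (cx cd), 0%Z))).

Definition tz (x q : tm) : tm := inverse_step p n (tB x q) (cz cd).

Definition tu (x q z : tm) : tm := z *t (q +t (x -t tone) *t (tA1 +t tscale 2 (trho *t x))).

Definition tgx (z u g : tm) : tm := tscale (-1) (tthird *t z) -t g *t u.

Definition end_value (a : tm) : Z * Z := (psum (fst a), snd a).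

Definition run_energy : bool * list (Z * Z) :=
  let y := ty in let x := tx y in let q := tq x in let z := tz x q in
  let gx := tgx z (tu x q z) (tN x *t z) in
  (candidate_in_range y, map end_value [y; x; integral_step (tr *t gx)]).

Definition run_variations : bool * list (Z * Z) :=
  let y := ty in let x := tx y in let q := tq x in let z := tz x q in
  let u := tu x q z in let g := tN x *t z in let gx := tgx z u g in
  let dB := tscale 2 (tA1 +t tscale 2 (trho *t x)) +t tscale 2 (trho *t (x -t tone)) in
  let gxx := ttwothird *t (z *t u) +t g *t (tscale 2 (u *t u) -t z *t dB) in
  let v := z *t (x -t tone) in
  let ga0 := tscale (-1) (g *t v) in
  let ga1 := ga0 *t x in
  let gxa0 := tscale (-1) (gx *t v +t g *t (z -t v *t u)) in
  let gxa1 := ga0 +t x *t gxa0 in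
  let A := tr *t gx in
  let xi0 := linear_step p n 0 A (tr *t ga0) (cxi0 cd) in
  let xi1 := linear_step p n 0 A (tr *t ga1) (cxi1 cd) in
  let eta := linear_step p n (scale p) A
    (tr *t ((tthird +t ttwothird *t (tA0 +t tA1 +t trho)) *t y)) (ceta cd) in
  (candidate_in_range y, map end_value [y; x; xi0; xi1; eta;
     integral_step (tr *t (gxx *t xi0 +t gxa0));
     integral_step (tr *t (gxx *t xi1 +t gxa1));
     integral_step (tr *t (gxx *t eta))]).

Notation S2 := (IZR (scale p)).
Notation ok := (tm_ok p).

Hypothesis Hp : (0 <= p)%Z.
Variables a0 a1 rho r : R.
Hypothesis Ha : near a0 a1 rho.
Hypothesis H0 : Rabs (a0 * S2 - IZR az0) <= IZR er.
Hypothesis H1 : Rabs (a1 * S2 - IZR az1) <= IZR er.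
Hypothesis Hrho : Rabs (rho * S2 - IZR rhoz) <= 2.
Hypothesis Hr : r * S2 = IZR (cr cd).
Hypothesis Hr1 : ta <= 2 * r <= tb.

Let time (s : R) : R := r * (1 + s).
Let xs (s : R) : R := sol a0 a1 rho 1 (time s).
Let zs (s : R) : R := / B a0 a1 rho (xs s).

Let time_range (s : R) : -1 <= s <= 1 -> ta <= time s <= tb.
Proof. unfold time, ta, tb in *; intros Hs; split; nra. Qed.

Let time_derive (s : R) : is_derive time s r.
Proof. unfold time; auto_derive; [trivial|ring]. Qed.

Let along_time (f df : R -> R) (s : R) :
  (forall t, is_derive f t (df t)) -> is_derive (fun s => f (time s)) s (r * df (time s)).
Proof. intros H; apply (derive_comp f time); [apply H|apply time_derive]. Qed.

Let time_m1 : time (-1) = 0.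
Proof. unfold time; ring. Qed.

Let xs_range (s : R) : -1 <= s <= 1 -> - (1 / 2) <= xs s <= 11 / 10.
Proof. intros Hs; apply sol_in; [exact Ha|exact near0_1|now apply time_range]. Qed.

Let along_xs (f : R -> R) (s : R) : -1 <= s <= 1 -> along a0 a1 rho f (time s) = f (xs s).
Proof. intros Hs; unfold along, xs; rewrite clamp_t_id; [reflexivity|now apply time_range]. Qed.

Let B_low (s : R) : -1 <= s <= 1 -> 9 / 10 <= B a0 a1 rho (xs s).
Proof. intros Hs; apply (g_bounds a0 a1 rho _ Ha), xs_range, Hs. Qed.

Lemma third_ok : ok (fun _ => 1 / 3) tthird.
Proof.
  apply tconst_ok; intros s _; assert (HS := scale_pos p Hp).
  assert (E := Z.div_mod (scale p) 3 ltac:(lia)); assert (M := Z.mod_pos_bound (scale p) 3 ltac:(lia)).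
  assert (E' : IZR (scale p) = 3 * IZR (scale p / 3) + IZR (scale p mod 3)) by (rewrite <- mult_IZR, <- plus_IZR; now f_equal).
  destruct M as [M1 M2]; apply IZR_le in M1; apply IZR_lt in M2.
  apply abs_le; lra.
Qed.

Lemma twothird_ok : ok (fun _ => 2 / 3) ttwothird.
Proof.
  apply tconst_ok; intros s _; assert (HS := scale_pos p Hp).
  assert (E := Z.div_mod (2 * scale p) 3 ltac:(lia)); assert (M := Z.mod_pos_bound (2 * scale p) 3 ltac:(lia)).
  assert (E' : 2 * IZR (scale p) = 3 * IZR (2 * scale p / 3) + IZR ((2 * scale p) mod 3))
    by (rewrite <- !mult_IZR, <- plus_IZR; now f_equal).
  destruct M as [M1 M2]; apply IZR_le in M1; apply IZR_lt in M2.
  apply abs_le; lra.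
Qed.

Let one_ok : ok (fun _ => 1) tone.
Proof. apply tone_ok. Qed.

Let A0_ok : ok (fun _ => a0) tA0.
Proof. apply tconst_ok; intros; exact H0. Qed.

Let A1_ok : ok (fun _ => a1) tA1.
Proof. apply tconst_ok; intros; exact H1. Qed.

Let rho_ok : ok (fun _ => rho) trho.
Proof. apply tconst_ok; intros; exact Hrho. Qed.

Let r_ok : ok (fun _ => r) tr.
Proof. apply tconst_ok; intros; rewrite Hr, Rminus_diag, Rabs_R0; lra. Qed.

Let mul_ok (f h : R -> R) (a b : tm) : ok f a -> ok h b -> ok (fun s => f s * h s) (a *t b).
Proof. now apply tmul_ok. Qed.

(** The bound e^(-x) >= 1 - x at x = 27/160 is squared four times, which is just enough for 1/20. *)
Lemma exp_2_7 : exp (27 / 10) <= 20.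
Proof.
  assert (H : 83125 / 100000 <= exp (- (27 / 160)) <= 1).
  { split; [assert (A := exp_ineq1_le (- (27 / 160))); lra|].
    rewrite <- exp_0; apply exp_le_compat; lra. }
  do 4 (apply exp_double in H; [|lra]).
  replace (2 * (2 * (2 * (2 * - (27 / 160))))) with (- (27 / 10)) in H by field.
  rewrite exp_Ropp in H; assert (P := exp_pos (27 / 10)).
  rewrite <- (Rinv_inv (exp (27 / 10))); apply Rle_trans with (/ (1 / 20)); [|lra].
  apply Rinv_le_contravar; lra.
Qed.

Lemma exp_product (s t : R) : -1 <= s <= 1 -> -1 <= t <= 1 -> exp (- time t) * exp (time s) <= 20.
Proof.
  intros Hs Ht; rewrite <- exp_plus.
  apply Rle_trans with (2 := exp_2_7), exp_le_compat; unfold time, ta, tb in *. 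
  destruct (Rle_dec 0 r); nra.
Qed.

Lemma ty_ok : ok (fun s => exp (time s)) ty.
Proof.
  intros s Hs; assert (HS := scale_pos p Hp); cbn [fst snd ty].
  set (res := tr *t (cy cd, 0%Z) -t (pder (cy cd), 0%Z)).
  assert (Hres : ok (fun s => r * (pev (cy cd) s / S2) - pev (pder (cy cd)) s / S2) res).
  { apply tsub_ok; [apply mul_ok; [exact r_ok|]|]; apply (tpoly_ok p Hp). }
  set (e := IZR (tmag res) / S2).
  assert (He : 0 <= e) by (apply Rle_trans with (2 := tmag_ok p Hp _ res s Hres Hs), Rabs_pos).
  set (d := IZR (Z.abs (scale p - paltsum (cy cd))) / S2).
  assert (Hd : Rabs (1 - pev (cy cd) (-1) / S2) = d).
  { unfold d; rewrite pev_m1, abs_IZR, minus_IZR.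
    replace (1 - IZR (paltsum (cy cd)) / S2) with ((S2 - IZR (paltsum (cy cd))) * / S2) by (field; lra).
    rewrite Rabs_mult, (Rabs_right (/ S2)) by (apply Rle_ge, Rlt_le, Rinv_0_lt_compat; exact HS). reflexivity. }
  assert (Hd0 : 0 <= d) by (rewrite <- Hd; apply Rabs_pos).
  assert (Pe := exp_pos (time s)).
  (* The error times e^(-time t) has derivative residual times e^(-time t). Carrying the constant
     e^(time s) along keeps the two exponentials together, so that only their quotient has to be
     bounded. *)
  assert (M : Rabs ((exp (time s) - pev (cy cd) s / S2) * exp (- time s) * exp (time s)
     - (exp (time (-1)) - pev (cy cd) (-1) / S2) * exp (- time (-1)) * exp (time s)) <= e * 20 * Rabs (s - -1)).
  { apply (mvt_bound (fun t => (exp (time t) - pev (cy cd) t / S2) * exp (- time t) * exp (time s))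
      (fun t => (r * (pev (cy cd) t / S2) - pev (pder (cy cd)) t / S2) * (exp (- time t) * exp (time s)))).
    - intros t _.
      assert (D1 : is_derive (fun t => exp (time t)) t (r * exp (time t))) by (unfold time; auto_derive; [trivial|ring]).
      assert (D2 : is_derive (fun t => exp (- time t)) t (- r * exp (- time t))) by (unfold time; auto_derive; [trivial|ring]).
      assert (D3 := derive_mult (pev (cy cd)) (fun _ => / S2) t _ _ (pev_derive (cy cd) t) (is_derive_const (/ S2) t)).
      assert (D4 := derive_mult _ _ t _ _ (derive_mult _ _ t _ _ (derive_minus _ _ t _ _ D1 D3) D2)
         (is_derive_const (exp (time s)) t)).
      apply (is_derive_eq _ _ _ _ D4). unfold zero; simpl.
      field; lra.
    - intros t Ht; rewrite Rmin_left, Rmax_right in Ht by lra.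
      apply abs_mult_le; [apply (tmag_ok p Hp _ res t Hres); lra|].
      rewrite Rabs_right; [apply exp_product; lra|]. apply Rle_ge, Rmult_le_pos; left; apply exp_pos. }
  rewrite time_m1, Ropp_0, exp_0, Rmult_1_r, Rmult_assoc, <- exp_plus in M.
  replace (- time s + time s) with 0 in M by ring; rewrite exp_0, Rmult_1_r in M.
  assert (E0 : exp (time s) <= 20).
  { assert (Q := exp_product s (-1) Hs ltac:(lra)); rewrite time_m1, Ropp_0, exp_0 in Q; lra. }
  assert (K : Rabs (exp (time s) - pev (cy cd) s / S2) <= 20 * (d + 2 * e)).
  { replace (exp (time s) - pev (cy cd) s / S2) with
      ((exp (time s) - pev (cy cd) s / S2 - (1 - pev (cy cd) (-1) / S2) * exp (time s))
       + (1 - pev (cy cd) (-1) / S2) * exp (time s)) by ring.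
    replace (20 * (d + 2 * e)) with (e * 20 * 2 + d * 20) by ring.
    apply abs_plus_le.
    - apply Rle_trans with (1 := M), Rmult_le_compat_l; [lra|apply abs_le; lra].
    - apply abs_mult_le; [rewrite Hd; lra|rewrite Rabs_right; lra]. }
  rewrite mult_IZR, plus_IZR, mult_IZR.
  replace (exp (time s) * S2 - pev (cy cd) s) with ((exp (time s) - pev (cy cd) s / S2) * S2) by (field; lra).
  replace (20 * (IZR (Z.abs (scale p - paltsum (cy cd))) + 2 * IZR (tmag res))) with (20 * (d + 2 * e) * S2)
    by (unfold d, e; field; lra).
  apply abs_mult_le; [exact K|rewrite Rabs_right; lra].
Qed.

Lemma tq_ok (x : R -> R) (m : tm) :
  ok x m -> ok (fun s => a0 + x s * (a1 + rho * x s)) (tq m).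
Proof.
  intros Hx; unfold tq; apply tadd_ok; [exact A0_ok|]; apply mul_ok; [exact Hx|].
  apply tadd_ok; [exact A1_ok|]; now apply mul_ok.
Qed.

Lemma tB_ok (x : R -> R) (m : tm) : ok x m -> ok (fun s => B a0 a1 rho (x s)) (tB m (tq m)).
Proof.
  intros Hx; eapply tm_ext; [unfold tB; apply tadd_ok; [exact one_ok|]; apply mul_ok;
    [apply tsub_ok; [exact Hx|exact one_ok]|exact (tq_ok x m Hx)]|].
  intros s _; unfold B; simpl; ring.
Qed.

Lemma tN_ok (x : R -> R) (m : tm) : ok x m -> ok (fun s => 1 - x s / 3) (tN m).
Proof.
  intros Hx; eapply tm_ext; [unfold tN; apply tsub_ok; [exact one_ok|]; apply mul_ok; [exact third_ok|exact Hx]|].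
  intros s _; simpl; field.
Qed.

Lemma unperturbed_ok : ok (fun s => 1 + 2 / 3 * (time s + 1 - exp (time s))) (tunperturbed ty).
Proof.
  unfold tunperturbed; apply tadd_ok; [exact one_ok|]; apply mul_ok; [exact twothird_ok|].
  apply tsub_ok; [apply tadd_ok; [|exact one_ok]|exact ty_ok].
  intros s _; simpl; unfold time; rewrite Rmult_0_r, Rplus_0_r, <- Hr.
  replace (_ - _) with 0 by ring; rewrite Rabs_R0; lra.
Qed.

Lemma candidate_range (s : R) : candidate_in_range ty = true -> -1 <= s <= 1 ->
  - (1 / 2) <= pev (cx cd) s / S2 <= 11 / 10.
Proof.
  unfold candidate_in_range; intros H Hs; apply andb_prop in H; destruct H as [C1 C2].
  assert (HS := scale_pos p Hp).
  split.
  - destruct (cx cd) as [|a l]; [discriminate|]. apply Z.leb_le, IZR_le in C2.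
    rewrite opp_IZR, mult_IZR, minus_IZR in C2; cbn [pev].
    assert (N := pev_pnorm l s ltac:(apply abs_le; lra)).
    assert (M : Rabs (s * pev l s) <= 1 * IZR (pnorm l)) by (apply abs_mult_le; [apply abs_le; lra|exact N]).
    apply abs_bounds in M.
    apply Rmult_le_reg_r with S2; [exact HS|]. unfold Rdiv at 2; rewrite (Rmult_assoc _ (/ S2)), Rinv_l by lra. lra.
  - apply Z.leb_le, IZR_le in C1; rewrite mult_IZR in C1.
    assert (M := tmag_ok p Hp _ _ s (tsub_ok p _ _ _ _ (tpoly_ok p Hp (cx cd)) unperturbed_ok) Hs); cbv beta in M.
    assert (M' : IZR (tmag ((cx cd, 0%Z) -t tunperturbed ty)) / S2 <= 1 / 10).
    { apply Rmult_le_reg_r with S2; [exact HS|]. unfold Rdiv at 1; rewrite Rmult_assoc, Rinv_l by lra. lra. }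
    apply abs_bounds in M; assert (E := exp_ineq1_le (time s)); lra.
Qed.

(** The orbit obeys the equation with [gc], and by [candidate_range] g is [gc] along the candidate
    as well; hence the error equation has the Lipschitz constant |r| / 6. *)
Lemma tx_ok : candidate_in_range ty = true -> ok xs (tx ty).
Proof.
  intros Hc; unfold tx.
  assert (Rng := fun s => candidate_range s Hc).
  set (xc s := pev (cx cd) s / S2) in *.
  assert (HX : ok xc (cx cd, 0%Z)) by apply (tpoly_ok p Hp).
  assert (HZ := inverse_step_ok p n Hp _ _ (cz cd) (tB_ok _ _ HX)
    (fun s Hs => proj1 (g_bounds a0 a1 rho (xc s) Ha (Rng s Hs)))).
  apply (candidate_ok p Hp xs (fun s => r * (gc a0 a1 rho (xs s) - g a0 a1 rho 1 * exp (time s))) (Rabs r * (1 / 6))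
    (scale p) (cx cd) _
    (fun s => r * ((1 - xc s / 3) * / B a0 a1 rho (xc s) - 2 / 3 * exp (time s)) - pev (pder (cx cd)) s / S2)).
  - assert (P := Rabs_pos r).
    assert (Rabs r <= 27 / 20) by (apply abs_le; unfold ta, tb in *; lra). lra.
  - apply tsub_ok; [apply mul_ok; [exact r_ok|]|apply (tpoly_ok p Hp)].
    apply tsub_ok; [apply mul_ok; [now apply tN_ok|exact HZ]|apply mul_ok; [exact twothird_ok|exact ty_ok]].
  - unfold xs; rewrite time_m1, sol_0 by exact Ha; ring.
  - intros s Hs; apply (derive_comp (sol a0 a1 rho 1) time); [|apply time_derive].
    apply sol_derive_c; [exact Ha|now apply time_range].
  - intros s Hs; rewrite g_one.
    match goal with |- Rabs ?e <= _ =>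
      replace e with (r * (gc a0 a1 rho (xs s) - g a0 a1 rho (xc s))) by (unfold g, Rdiv; ring) end.
    replace (g a0 a1 rho (xc s)) with (gc a0 a1 rho (xc s)) by (unfold gc; rewrite clamp_id; [reflexivity|now apply Rng]).
    rewrite Rmult_assoc; apply abs_mult_le; [apply Rle_refl|now apply gc_lip].
Qed.

(** * Derivatives of g and the variational equations along a branch *)

Section Stage2.

Hypothesis Hc : candidate_in_range ty = true.
Let x := tx ty.
Let q := tq x.
Let z := tz x q.
Let u := tu x q z.
Let gt := tN x *t z.

Let x_ok : ok xs x := tx_ok Hc.

Let z_ok : ok zs z.
Proof. apply (inverse_step_ok p n Hp (fun s => B a0 a1 rho (xs s))); [now apply tB_ok|exact B_low]. Qed.

Let u_ok : ok (fun s => zs s * Bx a0 a1 rho (xs s)) u.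
Proof.
  unfold u, tu; apply mul_ok; [exact z_ok|].
  eapply tm_ext; [apply tadd_ok; [exact (tq_ok _ _ x_ok)|]; apply mul_ok;
    [apply tsub_ok; [exact x_ok|exact one_ok]|apply tadd_ok; [exact A1_ok|]; apply tscale_ok, mul_ok;
    [exact rho_ok|exact x_ok]]|].
  intros s _; unfold Bx; simpl; ring.
Qed.

Let g_ok : ok (fun s => (1 - xs s / 3) * zs s) gt.
Proof. apply mul_ok; [now apply tN_ok|exact z_ok]. Qed.

Let gx_ok : ok (fun s => gx a0 a1 rho (xs s)) (tgx z u gt).
Proof.
  eapply tm_ext; [unfold tgx; apply tsub_ok; [apply tscale_ok, mul_ok; [exact third_ok|exact z_ok]|];
    apply mul_ok; [exact g_ok|exact u_ok]|].
  intros s _; unfold gx, zs; simpl; ring.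
Qed.

Let A_ok : ok (fun s => r * gx a0 a1 rho (xs s)) (tr *t tgx z u gt).
Proof. apply mul_ok; [exact r_ok|exact gx_ok]. Qed.

Let A_small (s : R) : -1 <= s <= 1 -> Rabs (r * gx a0 a1 rho (xs s)) <= 1 / 4.
Proof.
  intros Hs; apply Rle_trans with (27 / 20 * (1 / 6)); [|lra].
  apply abs_mult_le; [apply abs_le; unfold ta, tb in *; lra|].
  apply (g_bounds a0 a1 rho (xs s) Ha), xs_range, Hs.
Qed.

Lemma energy_ok : ok (fun s => En a0 a1 rho 1 (time s)) (integral_step (tr *t tgx z u gt)).
Proof.
  apply (integral_step_ok p Hp _ _ _ A_ok); [rewrite time_m1; apply RInt_0|].
  intros s Hs; eapply is_derive_eq; [apply along_time; intros t; apply (En_derive a0 a1 rho 1 t Ha near0_1)|].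
  unfold gxs; rewrite clamp_t_id by (now apply time_range); reflexivity.
Qed.

Let v := z *t (x -t tone).

Let v_ok : ok (fun s => zs s * (xs s - 1)) v.
Proof. apply mul_ok; [exact z_ok|]; now apply tsub_ok. Qed.

Let dB := tscale 2 (tA1 +t tscale 2 (trho *t x)) +t tscale 2 (trho *t (x -t tone)).
Let gxxt := ttwothird *t (z *t u) +t gt *t (tscale 2 (u *t u) -t z *t dB).

Let dB_ok : ok (fun s => Bxx a1 rho (xs s)) dB.
Proof.
  eapply tm_ext; [unfold dB; apply tadd_ok; [apply tscale_ok, tadd_ok; [exact A1_ok|apply tscale_ok, mul_ok;
    [exact rho_ok|exact x_ok]]|apply tscale_ok, mul_ok; [exact rho_ok|apply tsub_ok; [exact x_ok|exact one_ok]]]|].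
  intros s _; unfold Bxx; simpl; ring.
Qed.

Let gxx_ok : ok (fun s => gxx a0 a1 rho (xs s)) gxxt.
Proof.
  eapply tm_ext; [unfold gxxt; apply tadd_ok; [apply mul_ok; [exact twothird_ok|apply mul_ok; [exact z_ok|exact u_ok]]|];
    apply mul_ok; [exact g_ok|]; apply tsub_ok; [apply tscale_ok, mul_ok; exact u_ok|apply mul_ok; [exact z_ok|exact dB_ok]]|].
  intros s _; unfold gxx, zs; simpl; ring.
Qed.

Let ga0t := tscale (-1) (gt *t v).
Let ga1t := ga0t *t x.
Let gxa0t := tscale (-1) (tgx z u gt *t v +t gt *t (z -t v *t u)).
Let gxa1t := ga0t +t x *t gxa0t.

Let ga0_ok : ok (fun s => ga0 a0 a1 rho (xs s)) ga0t.
Proof.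
  eapply tm_ext; [unfold ga0t; apply tscale_ok, mul_ok; [exact g_ok|exact v_ok]|].
  intros s _; unfold ga0, zs; simpl; ring.
Qed.

Let ga1_ok : ok (fun s => ga1 a0 a1 rho (xs s)) ga1t.
Proof. apply mul_ok; [exact ga0_ok|exact x_ok]. Qed.

Let gxa0_ok : ok (fun s => gxa0 a0 a1 rho (xs s)) gxa0t.
Proof.
  eapply tm_ext; [unfold gxa0t; apply tscale_ok, tadd_ok; [apply mul_ok; [exact gx_ok|exact v_ok]|];
    apply mul_ok; [exact g_ok|]; apply tsub_ok; [exact z_ok|apply mul_ok; [exact v_ok|exact u_ok]]|].
  intros s _; unfold gxa0, zs; simpl; ring.
Qed.

Let gxa1_ok : ok (fun s => gxa1 a0 a1 rho (xs s)) gxa1t.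
Proof. apply tadd_ok; [exact ga0_ok|]; apply mul_ok; [exact x_ok|exact gxa0_ok]. Qed.

Let variation_time (k : R) (f vf : R -> R) (s : R) : is_variation a0 a1 rho k f vf -> -1 <= s <= 1 ->
  is_derive (fun s => vf (time s)) s (r * gx a0 a1 rho (xs s) * vf (time s) + r * f (time s)).
Proof.
  intros [_ H] Hs; eapply is_derive_eq; [apply along_time; exact H|].
  cbv beta; rewrite along_xs by exact Hs; ring.
Qed.

Let xi0t := linear_step p n 0 (tr *t tgx z u gt) (tr *t ga0t) (cxi0 cd).
Let xi1t := linear_step p n 0 (tr *t tgx z u gt) (tr *t ga1t) (cxi1 cd).
Let etat := linear_step p n (scale p) (tr *t tgx z u gt)
    (tr *t ((tthird +t ttwothird *t (tA0 +t tA1 +t trho)) *t ty)) (ceta cd).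

Lemma xi0_ok : ok (fun s => xi0 a0 a1 rho (time s)) xi0t.
Proof.
  assert (Sp := xi0_spec a0 a1 rho Ha).
  apply (linear_step_ok p n Hp _ _ (fun s => r * ga0 a0 a1 rho (xs s)) _ _ _ _ A_ok).
  - apply mul_ok; [exact r_ok|exact ga0_ok].
  - exact A_small.
  - rewrite time_m1, (proj1 Sp); ring.
  - intros s Hs; apply (is_derive_eq _ _ _ _ (variation_time _ _ _ s Sp Hs)); now rewrite along_xs.
Qed.

Lemma xi1_ok : ok (fun s => xi1 a0 a1 rho (time s)) xi1t.
Proof.
  assert (Sp := xi1_spec a0 a1 rho Ha).
  apply (linear_step_ok p n Hp _ _ (fun s => r * ga1 a0 a1 rho (xs s)) _ _ _ _ A_ok).
  - apply mul_ok; [exact r_ok|exact ga1_ok].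
  - exact A_small.
  - rewrite time_m1, (proj1 Sp); ring.
  - intros s Hs; apply (is_derive_eq _ _ _ _ (variation_time _ _ _ s Sp Hs)); now rewrite along_xs.
Qed.

Lemma eta_ok : ok (fun s => eta a0 a1 rho (time s)) etat.
Proof.
  assert (Sp := eta_spec a0 a1 rho Ha).
  (* 1/3 + 2/3 (a0 + a1 + rho) is - g'(1), because B(1) = 1 and B'(1) = a0 + a1 + rho. *)
  apply (linear_step_ok p n Hp _ _ (fun s => r * ((1 / 3 + 2 / 3 * (a0 + a1 + rho)) * exp (time s))) _ _ _ _ A_ok).
  - apply mul_ok; [exact r_ok|]; apply mul_ok; [|exact ty_ok].
    apply tadd_ok; [exact third_ok|]; apply mul_ok; [exact twothird_ok|].
    apply tadd_ok; [apply tadd_ok; [exact A0_ok|exact A1_ok]|exact rho_ok].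
  - exact A_small.
  - rewrite time_m1, (proj1 Sp); ring.
  - intros s Hs; apply (is_derive_eq _ _ _ _ (variation_time _ _ _ s Sp Hs)).
    unfold gx at 2, Bx, B; field.
Qed.

Lemma w0_ok : ok (fun s => w0 a0 a1 rho (time s)) (integral_step (tr *t (gxxt *t xi0t +t gxa0t))).
Proof.
  apply (integral_step_ok p Hp _ (fun s => r * (gxx a0 a1 rho (xs s) * xi0 a0 a1 rho (time s) + gxa0 a0 a1 rho (xs s)))).
  - apply mul_ok; [exact r_ok|]; apply tadd_ok; [apply mul_ok; [exact gxx_ok|exact xi0_ok]|exact gxa0_ok].
  - rewrite time_m1; apply RInt_0.
  - intros s Hs; eapply is_derive_eq; [apply along_time; intros t; apply (w0_derive a0 a1 rho Ha t)|].
    cbv beta; now rewrite !along_xs.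
Qed.

Lemma w1_ok : ok (fun s => w1 a0 a1 rho (time s)) (integral_step (tr *t (gxxt *t xi1t +t gxa1t))).
Proof.
  apply (integral_step_ok p Hp _ (fun s => r * (gxx a0 a1 rho (xs s) * xi1 a0 a1 rho (time s) + gxa1 a0 a1 rho (xs s)))).
  - apply mul_ok; [exact r_ok|]; apply tadd_ok; [apply mul_ok; [exact gxx_ok|exact xi1_ok]|exact gxa1_ok].
  - rewrite time_m1; apply RInt_0.
  - intros s Hs; eapply is_derive_eq; [apply along_time; intros t; apply (w1_derive a0 a1 rho Ha t)|].
    cbv beta; now rewrite !along_xs.
Qed.

Lemma we_ok : ok (fun s => we a0 a1 rho (time s)) (integral_step (tr *t (gxxt *t etat))).
Proof.
  apply (integral_step_ok p Hp _ (fun s => r * (gxx a0 a1 rho (xs s) * eta a0 a1 rho (time s)))).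
  - apply mul_ok; [exact r_ok|]; apply mul_ok; [exact gxx_ok|exact eta_ok].
  - rewrite time_m1; apply RInt_0.
  - intros s Hs; eapply is_derive_eq; [apply along_time; intros t; apply (we_derive a0 a1 rho Ha t)|].
    cbv beta; rewrite !along_xs by exact Hs; ring.
Qed.

End Stage2.

Definition encloses (x : R) (ve : Z * Z) : Prop := Rabs (x * S2 - IZR (fst ve)) <= IZR (snd ve).

Lemma end_value_ok (f : R -> R) (a : tm) : ok (fun s => f (time s)) a -> encloses (f (2 * r)) (end_value a).
Proof.
  intros H; specialize (H 1 ltac:(lra)); rewrite pev_1 in H.
  unfold encloses; simpl; replace (2 * r) with (time 1) by (unfold time; ring); exact H.
Qed.

Lemma run_energy_ok (l : list (Z * Z)) :
  run_energy = (true, l) ->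
  Forall2 encloses [exp (2 * r); sol a0 a1 rho 1 (2 * r); En a0 a1 rho 1 (2 * r)] l.
Proof.
  unfold run_energy; intros E; injection E; intros <- Hc; clear E.
  repeat apply Forall2_cons; try apply Forall2_nil; apply end_value_ok.
  - exact ty_ok.
  - exact (tx_ok Hc).
  - exact (energy_ok Hc).
Qed.

Lemma run_variations_ok (l : list (Z * Z)) :
  run_variations = (true, l) ->
  Forall2 encloses [exp (2 * r); sol a0 a1 rho 1 (2 * r);
    xi0 a0 a1 rho (2 * r); xi1 a0 a1 rho (2 * r); eta a0 a1 rho (2 * r);
    w0 a0 a1 rho (2 * r); w1 a0 a1 rho (2 * r); we a0 a1 rho (2 * r)] l.
Proof.
  unfold run_variations; intros E; injection E; intros <- Hc; clear E.
  repeat apply Forall2_cons; try apply Forall2_nil; apply end_value_ok.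
  - exact ty_ok.
  - exact (tx_ok Hc).
  - exact (xi0_ok Hc).
  - exact (xi1_ok Hc).
  - exact (eta_ok Hc).
  - exact (w0_ok Hc).
  - exact (w1_ok Hc).
  - exact (we_ok Hc).
Qed.

End Branch.

(** * From the branches to chi, lambda and their derivatives *)

Section Rates.

Variables a0 a1 rho : R.
Hypothesis Ha : near a0 a1 rho.

Let abs_const (k : R) : 0 <= k -> Rabs k <= k.
Proof. intros; rewrite Rabs_right; lra. Qed.

(** These bounds enter only Lipschitz constants in time, which are multiplied by the tiny distance
    between the end of a branch and the hit. *)
Lemma crude_bounds (x : R) : - (1 / 2) <= x <= 11 / 10 ->
  Rabs (ga0 a0 a1 rho x) <= 3 /\ Rabs (ga1 a0 a1 rho x) <= 4 /\ Rabs (gxx a0 a1 rho x) <= 5 /\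
  Rabs (gxa0 a0 a1 rho x) <= 5 /\ Rabs (gxa1 a0 a1 rho x) <= 9.
Proof.
  intros Hx; destruct (g_bounds a0 a1 rho x Ha Hx) as [HB [HG _]].
  assert (Hz : Rabs (/ B a0 a1 rho x) <= 10 / 9).
  { rewrite Rabs_right by (apply Rle_ge, Rlt_le, Rinv_0_lt_compat; lra).
    apply Rle_trans with (/ (9 / 10)); [apply Rinv_le_contravar; lra|lra]. }
  destruct Ha as [H0 [H1 H2]].
  assert (HN : Rabs (1 - x / 3) <= 7 / 6) by (apply abs_le; lra).
  assert (Hm : Rabs (x - 1) <= 3 / 2) by (apply abs_le; lra).
  assert (Hx' : Rabs x <= 11 / 10) by (apply abs_le; lra).
  assert (Hd : Rabs (a1 + 2 * rho * x) <= 4 / 100 + 2 * (5 / 100) * (11 / 10)).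
  { apply abs_plus_le; [exact H1|]. apply abs_mult_le; [|exact Hx'].
    apply abs_mult_le; [apply abs_const; lra|exact H2]. }
  assert (HBx : Rabs (Bx a0 a1 rho x) <= 9 / 10).
  { unfold Bx; replace (a0 + a1 * x + rho * x ^ 2) with ((a0 + 1 / 2) + (a1 * x + rho * (x * x)) + - (1 / 2)) by field.
    apply Rle_trans with (3 / 1000 + (4 / 100 * (11 / 10) + 5 / 100 * (11 / 10 * (11 / 10))) + 1 / 2
       + 3 / 2 * (4 / 100 + 2 * (5 / 100) * (11 / 10))); [|lra].
    assert (Rabs (- (1 / 2)) <= 1 / 2) by (apply abs_le; lra).
    repeat first [assumption | apply abs_plus_le | apply abs_mult_le]. }
  assert (HBxx : Rabs (Bxx a1 rho x) <= 5 / 10).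
  { unfold Bxx; apply Rle_trans with (2 * (4 / 100 + 2 * (5 / 100) * (11 / 10)) + 2 * (5 / 100) * (3 / 2)); [|lra].
    apply abs_plus_le; apply abs_mult_le; try assumption; [apply abs_const; lra|].
    apply abs_mult_le; [apply abs_const; lra|assumption]. }
  assert (Hu : Rabs (/ B a0 a1 rho x * Bx a0 a1 rho x) <= 10 / 9 * (9 / 10)) by (now apply abs_mult_le).
  assert (Hv : Rabs (/ B a0 a1 rho x * (x - 1)) <= 10 / 9 * (3 / 2)) by (now apply abs_mult_le).
  assert (Hg : Rabs ((1 - x / 3) * / B a0 a1 rho x) <= 7 / 6 * (10 / 9)) by (now apply abs_mult_le).
  assert (G0 : Rabs (ga0 a0 a1 rho x) <= 7 / 6 * (10 / 9) * (10 / 9 * (3 / 2))).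
  { unfold ga0; rewrite Rabs_Ropp; now apply abs_mult_le. }
  assert (GX0 : Rabs (gxa0 a0 a1 rho x) <= 1 / 6 * (10 / 9 * (3 / 2)) +
     7 / 6 * (10 / 9) * (10 / 9 + 10 / 9 * (3 / 2) * (10 / 9 * (9 / 10)))).
  { unfold gxa0; rewrite Rabs_Ropp; apply abs_plus_le; [now apply abs_mult_le|].
    apply abs_mult_le; [assumption|]. unfold Rminus; apply abs_plus_le; [assumption|].
    rewrite Rabs_Ropp; now apply abs_mult_le. }
  repeat split.
  - lra.
  - apply Rle_trans with (3 * (11 / 10)); [|lra]. unfold ga1; apply abs_mult_le; lra.
  - unfold gxx; apply Rle_trans with (2 / 3 * (10 / 9 * (10 / 9 * (9 / 10))) +
      7 / 6 * (10 / 9) * (2 * (10 / 9 * (9 / 10) * (10 / 9 * (9 / 10))) + 10 / 9 * (5 / 10))); [|lra].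
    apply abs_plus_le; [apply abs_mult_le; [apply abs_const; lra|now apply abs_mult_le]|].
    apply abs_mult_le; [assumption|]. unfold Rminus; apply abs_plus_le.
    + apply abs_mult_le; [apply abs_const; lra|now apply abs_mult_le].
    + rewrite Rabs_Ropp; now apply abs_mult_le.
  - lra.
  - apply Rle_trans with (3 + 11 / 10 * 5); [|lra].
    unfold gxa1; apply abs_plus_le; [lra|apply abs_mult_le; lra].
Qed.

Lemma along_range (t : R) : - (1 / 2) <= sol a0 a1 rho 1 (clamp ta tb t) <= 11 / 10.
Proof. apply sol_clamp_in; [exact Ha|exact near0_1]. Qed.

Lemma variation_bound (k K : R) (f v : R -> R) (t : R) :
  is_variation a0 a1 rho k f v -> Rabs k <= 1 -> 0 <= K ->
  (forall t, ta <= t <= tb -> Rabs (f t) <= K) -> ta <= t <= tb ->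
  Rabs (v t) <= 2 * (1 + K * (27 / 10)).
Proof.
  intros [Hv0 Hv] Hk HK Hf Ht.
  apply (comparison v (fun t => along a0 a1 rho (gx a0 a1 rho) t * v t + f t) ta tb (1 / 6));
    unfold ta, tb in *; try lra.
  - intros; apply Hv.
  - intros s Hs; apply abs_plus_le; [|now apply Hf].
    apply abs_mult_le; [|apply Rle_refl]. apply g_bounds; [exact Ha|apply along_range].
  - now rewrite Hv0.
Qed.

Definition lip (K : R) (v : R -> R) : Prop :=
  forall s t, ta <= s <= tb -> ta <= t <= tb -> Rabs (v s - v t) <= K * Rabs (s - t).

Lemma lip_intro (K : R) (v dv : R -> R) :
  (forall t, is_derive v t (dv t)) -> (forall t, ta <= t <= tb -> Rabs (dv t) <= K) -> lip K v.
Proof.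
  intros HD HB s t Hs Ht; apply mvt_bound with dv; [auto|].
  intros r Hr; apply HB, (between_sub _ _ t s); assumption.
Qed.

Lemma xi0_bound (t : R) : ta <= t <= tb -> Rabs (xi0 a0 a1 rho t) <= 19.
Proof.
  intros Ht; apply Rle_trans with (2 * (1 + 3 * (27 / 10))); [|lra].
  apply (variation_bound 0 3 _ _ t (xi0_spec a0 a1 rho Ha)); try assumption; try lra.
  - rewrite Rabs_R0; lra.
  - intros s _; apply crude_bounds, along_range.
Qed.

Lemma xi1_bound (t : R) : ta <= t <= tb -> Rabs (xi1 a0 a1 rho t) <= 24.
Proof.
  intros Ht; apply Rle_trans with (2 * (1 + 4 * (27 / 10))); [|lra].
  apply (variation_bound 0 4 _ _ t (xi1_spec a0 a1 rho Ha)); try assumption; try lra.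
  - rewrite Rabs_R0; lra.
  - intros s _; apply crude_bounds, along_range.
Qed.

Let eta_force (t : R) : ta <= t <= tb -> Rabs (- gx a0 a1 rho 1 * exp t) <= 1 / 6 * 5.
Proof.
  intros Ht; apply abs_mult_le; [rewrite Rabs_Ropp; apply g_bounds; [exact Ha|lra]|now apply exp_bound].
Qed.

Lemma eta_bound (t : R) : ta <= t <= tb -> Rabs (eta a0 a1 rho t) <= 7.
Proof.
  intros Ht; apply Rle_trans with (2 * (1 + 1 / 6 * 5 * (27 / 10))); [|lra].
  apply (variation_bound 1 (1 / 6 * 5) _ _ t (eta_spec a0 a1 rho Ha)); try assumption; try lra.
  - rewrite Rabs_R1; lra.
Qed.

Let gx_along (t : R) : Rabs (along a0 a1 rho (gx a0 a1 rho) t) <= 1 / 6.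
Proof. apply g_bounds; [exact Ha|apply along_range]. Qed.

(** The constant 150 is shared by the six functions xi0, xi1, eta, w0, w1 and we; the largest
    requirement is 5 * 24 + 9 = 129, for [w1]. *)
Lemma xi0_lip : lip 150 (xi0 a0 a1 rho).
Proof.
  apply lip_intro with (1 := proj2 (xi0_spec a0 a1 rho Ha)); intros t Ht.
  apply Rle_trans with (1 / 6 * 19 + 3); [|lra].
  apply abs_plus_le; [apply abs_mult_le; [apply gx_along|now apply xi0_bound]|apply crude_bounds, along_range].
Qed.

Lemma xi1_lip : lip 150 (xi1 a0 a1 rho).
Proof.
  apply lip_intro with (1 := proj2 (xi1_spec a0 a1 rho Ha)); intros t Ht.
  apply Rle_trans with (1 / 6 * 24 + 4); [|lra].
  apply abs_plus_le; [apply abs_mult_le; [apply gx_along|now apply xi1_bound]|apply crude_bounds, along_range].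
Qed.

Lemma eta_lip : lip 150 (eta a0 a1 rho).
Proof.
  apply lip_intro with (1 := proj2 (eta_spec a0 a1 rho Ha)); intros t Ht.
  apply Rle_trans with (1 / 6 * 7 + 1 / 6 * 5); [|lra].
  apply abs_plus_le; [apply abs_mult_le; [apply gx_along|now apply eta_bound]|now apply eta_force].
Qed.

Lemma w0_lip : lip 150 (w0 a0 a1 rho).
Proof.
  apply lip_intro with (1 := w0_derive a0 a1 rho Ha); intros t Ht.
  apply Rle_trans with (5 * 19 + 5); [|lra].
  apply abs_plus_le; [apply abs_mult_le; [|now apply xi0_bound]|]; apply crude_bounds, along_range.
Qed.

Lemma w1_lip : lip 150 (w1 a0 a1 rho).
Proof.
  apply lip_intro with (1 := w1_derive a0 a1 rho Ha); intros t Ht.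
  apply Rle_trans with (5 * 24 + 9); [|lra].
  apply abs_plus_le; [apply abs_mult_le; [|now apply xi1_bound]|]; apply crude_bounds, along_range.
Qed.

Lemma we_lip : lip 150 (we a0 a1 rho).
Proof.
  apply lip_intro with (1 := we_derive a0 a1 rho Ha); intros t Ht.
  apply Rle_trans with (5 * 7 + 0); [|lra].
  apply abs_plus_le; [apply abs_mult_le; [apply crude_bounds, along_range|now apply eta_bound]|rewrite Rabs_R0; lra].
Qed.

Lemma En_lip : lip 5 (En a0 a1 rho 1).
Proof.
  apply lip_intro with (1 := fun t => En_derive a0 a1 rho 1 t Ha near0_1); intros t Ht.
  apply Rle_trans with (1 / 6); [apply gx_along|lra].
Qed.

Lemma exp_lip : lip 5 exp.
Proof.
  intros s t Hs Ht; now apply exp_lipschitz.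
Qed.

Notation x := (sol a0 a1 rho 1).

Lemma zero_close (u v b h m : R) :
  ta <= u -> v <= tb -> u <= b <= v -> u <= h <= v -> 0 < m -> x h = 0 ->
  (forall t, u <= t <= v -> m <= Rabs (slope a0 a1 rho t)) -> Rabs (h - b) * m <= Rabs (x b).
Proof.
  intros Hu Hv Hb Hh Hm Z Hs.
  destruct (mvt_between x (slope a0 a1 rho) b h) as [c [Hc E]].
  { intros t Ht; assert (Q := between_sub u v b h t Hb Hh Ht).
    apply sol_derive; [exact Ha|exact near0_1|lra]. }
  rewrite Z in E; replace (Rabs (x b)) with (Rabs (0 - x b)) by (rewrite <- Rabs_Ropp; f_equal; ring).
  rewrite E, Rabs_mult, Rmult_comm; apply Rmult_le_compat_r; [apply Rabs_pos|].
  apply Hs, (between_sub u v b h); assumption.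
Qed.

Lemma slope_abs_fwd (u t : R) : 0 <= u <= t -> t <= tb -> u / 4 <= Rabs (slope a0 a1 rho t).
Proof.
  intros Hu Ht; assert (S := proj1 (sol_slope a0 a1 rho 1 Ha near0_1 t) ltac:(lra)).
  assert (R := sol_in a0 a1 rho 1 Ha near0_1 t ltac:(unfold ta; lra)).
  unfold gc in S; rewrite clamp_id in S by assumption; fold (slope a0 a1 rho t) in S.
  rewrite Rabs_left1; lra.
Qed.

Lemma slope_abs_bwd (u t : R) : 0 <= u <= - t -> ta <= t -> u / 20 <= Rabs (slope a0 a1 rho t).
Proof.
  intros Hu Ht; assert (S := proj2 (sol_slope a0 a1 rho 1 Ha near0_1 t) ltac:(lra)).
  assert (R := sol_in a0 a1 rho 1 Ha near0_1 t ltac:(unfold tb; lra)).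
  unfold gc in S; rewrite clamp_id in S by assumption; fold (slope a0 a1 rho t) in S.
  rewrite Rabs_right; lra.
Qed.

(** Two passes: the slope bound 3/40, valid from time 3/10 on, puts the hit within 1/10 of b; then
    the bound 3/10, valid from time 12/10 on, gives the factor 10/3 <= 4. *)
Lemma hp_close (b : R) : 13 / 10 <= b <= tb -> Rabs (x b) <= 1 / 1000 ->
  Rabs (hp a0 a1 rho 1 - b) <= 4 * Rabs (x b).
Proof.
  intros Hb Hx; destruct (hp_spec a0 a1 rho 1 Ha near0_1) as [H E].
  assert (A := zero_close (3 / 10) tb b (hp a0 a1 rho 1) (3 / 40) ltac:(unfold ta; lra) ltac:(lra) ltac:(lra)
    ltac:(lra) ltac:(lra) E).
  assert (A' : Rabs (hp a0 a1 rho 1 - b) * (3 / 40) <= Rabs (x b)).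
  { apply A; intros t Ht; replace (3 / 40) with (3 / 10 / 4) by field; apply slope_abs_fwd; lra. }
  assert (C : Rabs (hp a0 a1 rho 1 - b) <= 1 / 10) by lra; apply abs_bounds in C.
  assert (D := zero_close (12 / 10) tb b (hp a0 a1 rho 1) (3 / 10) ltac:(unfold ta; lra) ltac:(lra) ltac:(lra)
    ltac:(lra) ltac:(lra) E).
  assert (D' : Rabs (hp a0 a1 rho 1 - b) * (3 / 10) <= Rabs (x b)).
  { apply D; intros t Ht; replace (3 / 10) with (12 / 10 / 4) by field; apply slope_abs_fwd; lra. }
  lra.
Qed.

(** Two passes as in [hp_close]. The weaker slope |t|/20 on this side, taken at |t| >= 2, yields
    10. *)
Lemma hm_close (b : R) : ta <= b <= - (23 / 10) -> Rabs (x b) <= 1 / 1000 ->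
  Rabs (hm a0 a1 rho 1 - b) <= 10 * Rabs (x b).
Proof.
  intros Hb Hx; destruct (hm_spec a0 a1 rho 1 Ha near0_1) as [H E].
  assert (A := zero_close ta (- (3 / 10)) b (hm a0 a1 rho 1) (3 / 200) ltac:(lra) ltac:(unfold tb; lra) ltac:(lra)
    ltac:(lra) ltac:(lra) E).
  assert (A' : Rabs (hm a0 a1 rho 1 - b) * (3 / 200) <= Rabs (x b)).
  { apply A; intros t Ht; replace (3 / 200) with (3 / 10 / 20) by field; apply slope_abs_bwd; lra. }
  assert (C : Rabs (hm a0 a1 rho 1 - b) <= 1 / 10) by lra; apply abs_bounds in C.
  assert (D := zero_close ta (- (2)) b (hm a0 a1 rho 1) (1 / 10) ltac:(lra) ltac:(unfold tb; lra) ltac:(lra)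
    ltac:(lra) ltac:(lra) E).
  assert (D' : Rabs (hm a0 a1 rho 1 - b) * (1 / 10) <= Rabs (x b)).
  { apply D; intros t Ht; replace (1 / 10) with (2 / 20) by field; apply slope_abs_bwd; lra. }
  lra.
Qed.

End Rates.

(** * Combining the two branches at the hits *)

Section Assembly.

Variables (p : Z) (nf nb : nat) (az0 az1 rhoz er : Z) (fwd bwd : candidates).

Definition value_of (a : tm) : Z * Z := (hd 0%Z (fst a), snd a).

Notation "a '*t' b" := (tmul p 1 a b) (at level 40, left associativity).
Notation "a '+t' b" := (tadd a b) (at level 50, left associativity).
Notation "a '-t' b" := (tsub a b) (at level 50, left associativity).

Definition tinv (a : tm) : tm :=
  let c := (scale p * scale p / psum (fst a))%Z in
  ([c], (2 * Z.shiftr (tmag ([c], 0%Z) * tmag (a *t ([c], 0%Z) -t tone p)) p + 2)%Z).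

(* [tinv] is valid only if the product of the operand and its candidate inverse
   is within 1/2 of 1. *)
Definition tinv_valid (a : tm) : bool :=
  let c := (scale p * scale p / psum (fst a))%Z in
  (2 * tmag (a *t ([c], 0%Z) -t tone p) <=? scale p)%Z.

(** Bounds the time from the end of a branch to the hit by k times the height left there, with k = 4
    from [hp_close] and k = 10 from [hm_close]. *)
Definition shift_error (k : Z) (x : Z * Z) : Z := (k * (Z.abs (fst x) + snd x))%Z.

(** Transfers a value from the end of a branch to the hit; K is a Lipschitz constant in time. *)
Definition at_hit (K e : Z) (ve : Z * Z) : tm := tconst (fst ve) (snd ve + K * e).

Definition hits_valid (xf xb : Z * Z) : bool :=
  ((13 * scale p <=? 20 * cr fwd) && (200 * cr fwd <=? 145 * scale p)
   && (-27 * scale p <=? 20 * cr bwd) && (20 * cr bwd <=? -23 * scale p)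
   && (1000 * (Z.abs (fst xf) + snd xf) <=? scale p) && (1000 * (Z.abs (fst xb) + snd xb) <=? scale p))%Z%bool.

Definition energy_values : bool * list (Z * Z) :=
  match run_energy p nf az0 az1 rhoz er fwd, run_energy p nb az0 az1 rhoz er bwd with
  | (b1, [yf; xf; Ef]), (b2, [yb; xb; Eb]) =>
    let ef := shift_error 4 xf in let eb := shift_error 10 xb in
    let d0 := tone p -t tA0 az0 er in
    let g0 := tinv d0 in
    let chi := ttwothird p *t (at_hit 5 ef yf -t at_hit 5 eb yb)
      -t g0 *t (tconst (2 * cr fwd) ef -t tconst (2 * cr bwd) eb) in
    let lam := at_hit 5 ef Ef -t at_hit 5 eb Eb in
    ((b1 && b2 && hits_valid xf xb && tinv_valid d0)%bool, [value_of chi; value_of lam])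
  | _, _ => (false, [])
  end.

(** At x = 0 one has B = 1 - a0 and B' = a0 - a1. Hence z0 is g(0), its square is the derivative of
    g(0) in a0, and a1 does not affect g(0). The slopes at the two hits are sf and sb. *)
Definition derivative_values : bool * list (Z * Z) :=
  match run_variations p nf az0 az1 rhoz er fwd, run_variations p nb az0 az1 rhoz er bwd with
  | (b1, [yf; xf; xi0f; xi1f; etaf; w0f; w1f; wef]), (b2, [yb; xb; xi0b; xi1b; etab; w0b; w1b; web]) =>
    let ef := shift_error 4 xf in let eb := shift_error 10 xb in
    let d0 := tone p -t tA0 az0 er in
    let z0 := tinv d0 in
    let gx0 := tscale (-1) (tthird p *t z0) -t z0 *t (z0 *t (tA0 az0 er -t tA1 az1 er)) in
    let sf := z0 -t ttwothird p *t at_hit 5 ef yf in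
    let sb := z0 -t ttwothird p *t at_hit 5 eb yb in
    let if_ := tinv sf in let ib := tinv sb in
    let T := tconst (2 * cr fwd) ef -t tconst (2 * cr bwd) eb in
    let dl (vf vb wf wb : Z * Z) :=
      at_hit 150 ef wf -t at_hit 150 eb wb
      +t gx0 *t (tscale (-1) (at_hit 150 ef vf) *t if_ -t tscale (-1) (at_hit 150 eb vb) *t ib) in
    let c0 := at_hit 150 ef xi0f -t at_hit 150 eb xi0b -t z0 *t z0 *t T in
    let c1 := at_hit 150 ef xi1f -t at_hit 150 eb xi1b in
    let l0 := dl xi0f xi0b w0f w0b in
    let l1 := dl xi1f xi1b w1f w1b in
    let le := dl etaf etab wef web in
    ((b1 && b2 && hits_valid xf xb && tinv_valid d0 && tinv_valid sf && tinv_valid sb)%bool,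
     map value_of [c0; c1; l0; l1; le; c0 *t l1 -t c1 *t l0])
  | _, _ => (false, [])
  end.

End Assembly.

Section AssemblyCorrect.

Variables (p : Z) (nf nb : nat) (az0 az1 rhoz er : Z) (fwd bwd : candidates).
Hypothesis Hp : (0 <= p)%Z.
Variables a0 a1 rho : R.
Notation S2 := (IZR (scale p)).
Hypothesis Ha : near a0 a1 rho.
Hypothesis H0 : Rabs (a0 * S2 - IZR az0) <= IZR er.
Hypothesis H1 : Rabs (a1 * S2 - IZR az1) <= IZR er.
Hypothesis Hrho : Rabs (rho * S2 - IZR rhoz) <= 2.

Notation "a '*t' b" := (tmul p 1 a b) (at level 40, left associativity).
Notation "a '+t' b" := (tadd a b) (at level 50, left associativity).
Notation "a '-t' b" := (tsub a b) (at level 50, left associativity).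

Definition okc (x : R) (m : tm) : Prop := tm_ok p (fun _ => x) m.

Lemma okc_mul (x y : R) (a b : tm) : okc x a -> okc y b -> okc (x * y) (a *t b).
Proof. intros; now apply tmul_ok. Qed.

Lemma okc_add (x y : R) (a b : tm) : okc x a -> okc y b -> okc (x + y) (a +t b).
Proof. intros; now apply tadd_ok. Qed.

Lemma okc_sub (x y : R) (a b : tm) : okc x a -> okc y b -> okc (x - y) (a -t b).
Proof. intros; now apply tsub_ok. Qed.

Lemma okc_opp (x : R) (a : tm) : okc x a -> okc (- x) (tscale (-1) a).
Proof.
  intros H; eapply tm_ext; [apply (tscale_ok p (-1) _ _ H)|]; intros; cbv beta; ring.
Qed.

Lemma okc_const (x : R) (v e : Z) : Rabs (x * S2 - IZR v) <= IZR e -> okc x (tconst v e).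
Proof. intros H; now apply tconst_ok. Qed.

Lemma value_of_ok (x : R) (a : tm) : okc x a -> encloses p x (value_of a).
Proof.
  intros H; specialize (H 0 ltac:(lra)); unfold encloses, value_of; cbn [fst snd].
  replace (IZR (hd 0%Z (fst a))) with (pev (fst a) 0) by (destruct (fst a); simpl; [reflexivity|ring]).
  exact H.
Qed.

(** |x c - 1| <= 1/2 forces |x| |c| >= 1/2, so |1/x| <= 2 |c|, and 1/x - c = - (x c - 1) / x. *)
Lemma tinv_ok (x : R) (a : tm) : okc x a -> tinv_valid p a = true -> x <> 0 /\ okc (/ x) (tinv p a).
Proof.
  intros Hx; unfold tinv_valid, tinv; set (c := (scale p * scale p / psum (fst a))%Z); intros Hv.
  assert (HS := scale_pos p Hp).
  assert (Hc : okc (IZR c / S2) ([c], 0%Z)).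
  { eapply tm_ext; [apply (tpoly_ok p Hp [c])|]; intros s _; simpl; now rewrite Rmult_0_r, Rplus_0_r. }
  assert (M := tmag_ok p Hp _ _ 0 (okc_sub _ _ _ _ (okc_mul _ _ _ _ Hx Hc) (tone_ok p)) ltac:(lra)); cbv beta in M.
  fold (tone p) in M; set (e := tmag (a *t ([c], 0%Z) -t tone p)) in *.
  apply Z.leb_le, IZR_le in Hv; rewrite mult_IZR in Hv.
  assert (He : IZR e / S2 <= 1 / 2).
  { apply Rmult_le_reg_r with S2; [exact HS|]. unfold Rdiv at 1; rewrite Rmult_assoc, Rinv_l by lra. lra. }
  assert (Hlow : 1 / 2 <= Rabs x * Rabs (IZR c / S2)).
  { rewrite <- Rabs_mult; apply abs_bounds in M; rewrite Rabs_right; lra. }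
  assert (Hx0 : x <> 0) by (intros ->; rewrite Rabs_R0 in Hlow; lra).
  split; [exact Hx0|].
  assert (Px := Rabs_pos_lt x Hx0).
  assert (Hi : Rabs (/ x) <= 2 * Rabs (IZR c / S2)).
  { rewrite Rabs_inv; apply Rmult_le_reg_l with (Rabs x); [exact Px|]. rewrite Rinv_r; lra. }
  intros s _; cbn [fst snd pev]; rewrite Rmult_0_r, Rplus_0_r.
  assert (B := shiftr_bounds p Hp (tmag ([c], 0%Z) * e)).
  rewrite plus_IZR, mult_IZR.
  assert (Em : IZR (tmag ([c], 0%Z)) = Rabs (IZR c)).
  { unfold tmag; cbn [fst snd pnorm]; rewrite !Z.add_0_r; apply abs_IZR. }
  rewrite mult_IZR, Em in B.
  replace (/ x * S2 - IZR c) with (- (x * (IZR c / S2) - 1) * (/ x) * S2) by (field; lra).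
  apply Rle_trans with (IZR e / S2 * (2 * Rabs (IZR c / S2)) * S2).
  - apply abs_mult_le; [|rewrite Rabs_right; lra]. apply abs_mult_le; [now rewrite Rabs_Ropp|exact Hi].
  - replace (Rabs (IZR c / S2)) with (Rabs (IZR c) / S2).
    + replace (IZR e / S2 * (2 * (Rabs (IZR c) / S2)) * S2) with (2 * (Rabs (IZR c) * IZR e / S2)) by (field; lra). lra.
    + unfold Rdiv; rewrite Rabs_mult, (Rabs_right (/ S2)); [reflexivity|].
      apply Rle_ge, Rlt_le, Rinv_0_lt_compat; exact HS.
Qed.

Notation x := (sol a0 a1 rho 1).
Notation tp := (hp a0 a1 rho 1).
Notation tm_ := (hm a0 a1 rho 1).
Let rf : R := IZR (cr fwd) / S2.
Let rb : R := IZR (cr bwd) / S2.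

Section Hits.

Variables xf xb : Z * Z.
Hypothesis Hv : hits_valid p fwd bwd xf xb = true.

Lemma hits_valid_spec : 13 / 10 <= 2 * rf <= tb /\ ta <= 2 * rb <= - (23 / 10) /\
  (IZR (Z.abs (fst xf)) + IZR (snd xf)) / S2 <= 1 / 1000 /\ (IZR (Z.abs (fst xb)) + IZR (snd xb)) / S2 <= 1 / 1000.
Proof.
  assert (HS := scale_pos p Hp).
  assert (V := Hv); unfold hits_valid in V; repeat (apply andb_prop in V; destruct V as [V ?]).
  repeat match goal with H : (_ <=? _)%Z = true |- _ => apply Z.leb_le, IZR_le in H;
    rewrite ?mult_IZR, ?plus_IZR, ?opp_IZR in H end.
  assert (E : forall u k, u * S2 <= k * S2 -> u <= k) by (intros u k Hu; now apply Rmult_le_reg_r with S2).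
  assert (Ef : rf * S2 = IZR (cr fwd)) by (unfold rf; field; lra).
  assert (Eb : rb * S2 = IZR (cr bwd)) by (unfold rb; field; lra).
  assert (Eq : forall u, u / S2 * S2 = u) by (intros; field; lra).
  unfold ta, tb; repeat split; apply E; rewrite ?Eq; lra.
Qed.

Lemma hp_enclosed : encloses p (x (2 * rf)) xf ->
  Rabs (tp - 2 * rf) * S2 <= IZR (shift_error 4 xf).
Proof.
  intros He; destruct hits_valid_spec as [Hf [_ [Hd _]]]; assert (HS := scale_pos p Hp).
  assert (Hx : Rabs (x (2 * rf)) * S2 <= IZR (Z.abs (fst xf)) + IZR (snd xf)).
  { rewrite <- (Rabs_right S2) at 1 by lra. rewrite <- Rabs_mult.
    replace (x (2 * rf) * S2) with (IZR (fst xf) + (x (2 * rf) * S2 - IZR (fst xf))) by ring.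
    apply abs_plus_le; [rewrite abs_IZR; apply Rle_refl|exact He]. }
  assert (C := hp_close a0 a1 rho Ha (2 * rf) Hf).
  assert (Hx' : Rabs (x (2 * rf)) <= 1 / 1000).
  { apply Rle_trans with (2 := Hd), Rmult_le_reg_r with S2; [exact HS|].
    unfold Rdiv; rewrite Rmult_assoc, Rinv_l by lra; lra. }
  specialize (C Hx'); unfold shift_error; rewrite mult_IZR, plus_IZR.
  apply Rle_trans with (4 * Rabs (x (2 * rf)) * S2); [apply Rmult_le_compat_r; lra|lra].
Qed.

Lemma hm_enclosed : encloses p (x (2 * rb)) xb ->
  Rabs (tm_ - 2 * rb) * S2 <= IZR (shift_error 10 xb).
Proof.
  intros He; destruct hits_valid_spec as [_ [Hf [_ Hd]]]; assert (HS := scale_pos p Hp).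
  assert (Hx : Rabs (x (2 * rb)) * S2 <= IZR (Z.abs (fst xb)) + IZR (snd xb)).
  { rewrite <- (Rabs_right S2) at 1 by lra. rewrite <- Rabs_mult.
    replace (x (2 * rb) * S2) with (IZR (fst xb) + (x (2 * rb) * S2 - IZR (fst xb))) by ring.
    apply abs_plus_le; [rewrite abs_IZR; apply Rle_refl|exact He]. }
  assert (C := hm_close a0 a1 rho Ha (2 * rb) Hf).
  assert (Hx' : Rabs (x (2 * rb)) <= 1 / 1000).
  { apply Rle_trans with (2 := Hd), Rmult_le_reg_r with S2; [exact HS|].
    unfold Rdiv; rewrite Rmult_assoc, Rinv_l by lra; lra. }
  specialize (C Hx'); unfold shift_error; rewrite mult_IZR, plus_IZR.
  apply Rle_trans with (10 * Rabs (x (2 * rb)) * S2); [apply Rmult_le_compat_r; lra|lra].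
Qed.

End Hits.

Lemma at_hit_ok (K e : Z) (v : R -> R) (T b : R) (ve : Z * Z) :
  lip (IZR K) v -> (0 <= K)%Z -> ta <= T <= tb -> ta <= b <= tb -> Rabs (T - b) * S2 <= IZR e ->
  encloses p (v b) ve -> okc (v T) (at_hit K e ve).
Proof.
  intros HL HK HT Hb He Hv; apply okc_const; rewrite plus_IZR, mult_IZR.
  assert (HS := scale_pos p Hp).
  replace (v T * S2 - IZR (fst ve)) with ((v b * S2 - IZR (fst ve)) + (v T - v b) * S2) by ring.
  apply abs_plus_le; [exact Hv|].
  rewrite Rabs_mult, (Rabs_right S2) by lra.
  apply Rle_trans with (IZR K * Rabs (T - b) * S2).
  - apply Rmult_le_compat_r; [lra|now apply HL].
  - rewrite Rmult_assoc; apply Rmult_le_compat_l; [now apply IZR_le|exact He].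
Qed.

Lemma hit_time_ok (c e : Z) (T : R) :
  Rabs (T - 2 * (IZR c / S2)) * S2 <= IZR e -> okc T (tconst (2 * c) e).
Proof.
  intros H; assert (HS := scale_pos p Hp); apply okc_const.
  rewrite mult_IZR; replace (T * S2 - 2 * IZR c) with ((T - 2 * (IZR c / S2)) * S2) by (field; lra).
  now rewrite Rabs_mult, (Rabs_right S2) by lra.
Qed.

Let A0_ok : okc a0 (tA0 az0 er).
Proof. now apply okc_const. Qed.

Let A1_ok : okc a1 (tA1 az1 er).
Proof. now apply okc_const. Qed.

Let one_ok : okc 1 (tone p) := tone_ok p.

Let rf_eq : rf * S2 = IZR (cr fwd).
Proof. unfold rf; field; assert (HS := scale_pos p Hp); lra. Qed.

Let rb_eq : rb * S2 = IZR (cr bwd).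
Proof. unfold rb; field; assert (HS := scale_pos p Hp); lra. Qed.

Let tp_in : ta <= tp <= tb.
Proof. destruct (hp_spec a0 a1 rho 1 Ha near0_1) as [H _]; unfold ta; lra. Qed.

Let tm_in : ta <= tm_ <= tb.
Proof. destruct (hm_spec a0 a1 rho 1 Ha near0_1) as [H _]; unfold tb; lra. Qed.

Let g_zero : g a0 a1 rho 0 = / (1 - a0).
Proof. unfold g, B; replace (1 + (0 - 1) * (a0 + a1 * 0 + rho * 0 ^ 2)) with (1 - a0) by ring. unfold Rdiv; ring. Qed.

Ltac split_valid H := repeat (apply andb_prop in H; let H' := fresh "V" in destruct H as [H H']).

Ltac invert_all := repeat match goal with
  | H : Forall2 _ _ (_ :: _) |- _ => inversion H; clear H; subst
  | H : Forall2 _ _ nil |- _ => inversion H; clear H; subst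
  end.

Lemma energy_values_ok (l : list (Z * Z)) :
  energy_values p nf nb az0 az1 rhoz er fwd bwd = (true, l) ->
  Forall2 (encloses p) [chi1 a0 a1 rho; lambda_minus a0 a1 rho 1] l.
Proof.
  unfold energy_values; intros E.
  destruct (run_energy p nf az0 az1 rhoz er fwd) as [b1 lf] eqn:Ef.
  destruct (run_energy p nb az0 az1 rhoz er bwd) as [b2 lb] eqn:Eb.
  destruct lf as [|yf [|xf [|ef [|]]]]; try discriminate E.
  destruct lb as [|yb [|xb [|eb [|]]]]; try discriminate E.
  cbv zeta in E; injection E; clear E; intros <- Hv.
  split_valid Hv; subst b1 b2.
  destruct (hits_valid_spec xf xb V0) as [Rf [Rb _]].
  assert (Rf' : ta <= 2 * rf <= tb) by (unfold ta in *; lra).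
  assert (Rb' : ta <= 2 * rb <= tb) by (unfold tb in *; lra).
  apply (run_energy_ok p nf az0 az1 rhoz er fwd Hp a0 a1 rho rf Ha H0 H1 Hrho rf_eq Rf') in Ef.
  apply (run_energy_ok p nb az0 az1 rhoz er bwd Hp a0 a1 rho rb Ha H0 H1 Hrho rb_eq Rb') in Eb.
  invert_all.
  assert (Tf := hp_enclosed xf xb V0 ltac:(assumption)); assert (Tb := hm_enclosed xf xb V0 ltac:(assumption)).
  destruct (tinv_ok _ _ (okc_sub _ _ _ _ one_ok A0_ok) V) as [_ G0]; rewrite <- g_zero in G0.
  rewrite chi1_eq, lambda_minus_eq by (exact Ha || exact near0_1).
  apply Forall2_cons; [|apply Forall2_cons; [|apply Forall2_nil]]; apply value_of_ok.
  - apply okc_sub; apply okc_mul.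
    + apply (twothird_ok p Hp).
    + apply okc_sub; [apply (at_hit_ok 5 _ exp _ (2 * rf))|apply (at_hit_ok 5 _ exp _ (2 * rb))];
        try assumption; try lia; apply exp_lip.
    + exact G0.
    + apply okc_sub; now apply hit_time_ok.
  - apply okc_sub; [apply (at_hit_ok 5 _ (En a0 a1 rho 1) _ (2 * rf))|apply (at_hit_ok 5 _ (En a0 a1 rho 1) _ (2 * rb))];
      try assumption; try lia; now apply En_lip.
Qed.

Lemma derivative_values_ok (l : list (Z * Z)) :
  derivative_values p nf nb az0 az1 rhoz er fwd bwd = (true, l) ->
  Forall2 (encloses p)
    [dchi a0 a1 rho (xi0 a0 a1 rho) (ga0 a0 a1 rho 0); dchi a0 a1 rho (xi1 a0 a1 rho) 0;
     dlambda a0 a1 rho (xi0 a0 a1 rho) (w0 a0 a1 rho); dlambda a0 a1 rho (xi1 a0 a1 rho) (w1 a0 a1 rho);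
     dlambda a0 a1 rho (eta a0 a1 rho) (we a0 a1 rho);
     dchi a0 a1 rho (xi0 a0 a1 rho) (ga0 a0 a1 rho 0) * dlambda a0 a1 rho (xi1 a0 a1 rho) (w1 a0 a1 rho)
     - dchi a0 a1 rho (xi1 a0 a1 rho) 0 * dlambda a0 a1 rho (xi0 a0 a1 rho) (w0 a0 a1 rho)] l.
Proof.
  unfold derivative_values; intros E.
  destruct (run_variations p nf az0 az1 rhoz er fwd) as [b1 lf] eqn:Ef.
  destruct (run_variations p nb az0 az1 rhoz er bwd) as [b2 lb] eqn:Eb.
  destruct lf as [|yf [|xf [|xi0f [|xi1f [|etaf [|w0f [|w1f [|wef [|]]]]]]]]]; try discriminate E.
  destruct lb as [|yb [|xb [|xi0b [|xi1b [|etab [|w0b [|w1b [|web [|]]]]]]]]]; try discriminate E.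
  cbv zeta in E; injection E; clear E; intros <- Hv.
  split_valid Hv; subst b1 b2.
  match goal with V : hits_valid _ _ _ _ _ = true |- _ => rename V into VH end.
  destruct (hits_valid_spec xf xb VH) as [Rf [Rb _]].
  assert (Rf' : ta <= 2 * rf <= tb) by (unfold ta in *; lra).
  assert (Rb' : ta <= 2 * rb <= tb) by (unfold tb in *; lra).
  apply (run_variations_ok p nf az0 az1 rhoz er fwd Hp a0 a1 rho rf Ha H0 H1 Hrho rf_eq Rf') in Ef.
  apply (run_variations_ok p nb az0 az1 rhoz er bwd Hp a0 a1 rho rb Ha H0 H1 Hrho rb_eq Rb') in Eb.
  invert_all.
  assert (Tf := hp_enclosed xf xb VH ltac:(assumption)); assert (Tb := hm_enclosed xf xb VH ltac:(assumption)).
  destruct (tinv_ok _ _ (okc_sub _ _ _ _ one_ok A0_ok) ltac:(eassumption)) as [HA Z0].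
  assert (AF : forall K v ve, (0 <= K)%Z -> lip (IZR K) v -> encloses p (v (2 * rf)) ve ->
    okc (v tp) (at_hit K (shift_error 4 xf) ve)) by (intros; now apply at_hit_ok with (2 * rf)).
  assert (AB : forall K v ve, (0 <= K)%Z -> lip (IZR K) v -> encloses p (v (2 * rb)) ve ->
    okc (v tm_) (at_hit K (shift_error 10 xb) ve)) by (intros; now apply at_hit_ok with (2 * rb)).
  assert (SF : okc (/ (1 - a0) - 2 / 3 * exp tp)
    (tinv p (tone p -t tA0 az0 er) -t ttwothird p *t at_hit 5 (shift_error 4 xf) yf)).
  { apply okc_sub; [exact Z0|]; apply okc_mul; [apply (twothird_ok p Hp)|]. apply AF; [lia|apply exp_lip|assumption]. }
  assert (SB : okc (/ (1 - a0) - 2 / 3 * exp tm_)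
    (tinv p (tone p -t tA0 az0 er) -t ttwothird p *t at_hit 5 (shift_error 10 xb) yb)).
  { apply okc_sub; [exact Z0|]; apply okc_mul; [apply (twothird_ok p Hp)|]. apply AB; [lia|apply exp_lip|assumption]. }
  destruct (tinv_ok _ _ SF ltac:(eassumption)) as [NF IF]; destruct (tinv_ok _ _ SB ltac:(eassumption)) as [NB IB].
  assert (GX : okc (gx a0 a1 rho 0) (tscale (-1) (tthird p *t tinv p (tone p -t tA0 az0 er)) -t
     tinv p (tone p -t tA0 az0 er) *t (tinv p (tone p -t tA0 az0 er) *t (tA0 az0 er -t tA1 az1 er)))).
  { replace (gx a0 a1 rho 0) with (- (1 / 3 * / (1 - a0)) - / (1 - a0) * (/ (1 - a0) * (a0 - a1))).
    - apply okc_sub; [apply okc_opp, okc_mul; [apply (third_ok p Hp)|exact Z0]|].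
      apply okc_mul; [exact Z0|]; apply okc_mul; [exact Z0|]; now apply okc_sub.
    - unfold gx, B, Bx; replace (1 + (0 - 1) * (a0 + a1 * 0 + rho * 0 ^ 2)) with (1 - a0) by ring. field; exact HA. }
  assert (DL : forall v wv vf vb wf wb, lip 150 v -> lip 150 wv ->
    encloses p (v (2 * rf)) vf -> encloses p (v (2 * rb)) vb ->
    encloses p (wv (2 * rf)) wf -> encloses p (wv (2 * rb)) wb ->
    okc (dlambda a0 a1 rho v wv) (at_hit 150 (shift_error 4 xf) wf -t at_hit 150 (shift_error 10 xb) wb +t
      (tscale (-1) (tthird p *t tinv p (tone p -t tA0 az0 er)) -t
       tinv p (tone p -t tA0 az0 er) *t (tinv p (tone p -t tA0 az0 er) *t (tA0 az0 er -t tA1 az1 er))) *t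
      (tscale (-1) (at_hit 150 (shift_error 4 xf) vf) *t
         tinv p (tinv p (tone p -t tA0 az0 er) -t ttwothird p *t at_hit 5 (shift_error 4 xf) yf)
       -t tscale (-1) (at_hit 150 (shift_error 10 xb) vb) *t
         tinv p (tinv p (tone p -t tA0 az0 er) -t ttwothird p *t at_hit 5 (shift_error 10 xb) yb)))).
  { intros v wv vf vb wf wb Lv Lw Evf Evb Ewf Ewb; unfold dlambda, hit_shift; rewrite g_zero.
    apply okc_add; [apply okc_sub; [apply AF|apply AB]; try assumption; lia|].
    apply okc_mul; [exact GX|]. unfold Rdiv.
    apply okc_sub; apply okc_mul; try assumption; apply okc_opp; [apply AF|apply AB]; try assumption; lia. }
  assert (C0 : okc (dchi a0 a1 rho (xi0 a0 a1 rho) (ga0 a0 a1 rho 0))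
    (at_hit 150 (shift_error 4 xf) xi0f -t at_hit 150 (shift_error 10 xb) xi0b -t
     tinv p (tone p -t tA0 az0 er) *t tinv p (tone p -t tA0 az0 er) *t
       (tconst (2 * cr fwd) (shift_error 4 xf) -t tconst (2 * cr bwd) (shift_error 10 xb)))).
  { unfold dchi; apply okc_sub.
    - apply okc_sub; [apply AF|apply AB]; try assumption; try lia; now apply xi0_lip.
    - apply okc_mul; [|apply okc_sub; now apply hit_time_ok].
      replace (ga0 a0 a1 rho 0) with (/ (1 - a0) * / (1 - a0)); [now apply okc_mul|].
      unfold ga0, B; replace (1 + (0 - 1) * (a0 + a1 * 0 + rho * 0 ^ 2)) with (1 - a0) by ring. field; exact HA. }
  assert (C1 : okc (dchi a0 a1 rho (xi1 a0 a1 rho) 0)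
    (at_hit 150 (shift_error 4 xf) xi1f -t at_hit 150 (shift_error 10 xb) xi1b)).
  { unfold dchi; rewrite Rmult_0_l, Rminus_0_r.
    apply okc_sub; [apply AF|apply AB]; try assumption; try lia; now apply xi1_lip. }
  assert (L0 := DL (xi0 a0 a1 rho) (w0 a0 a1 rho) xi0f xi0b w0f w0b (xi0_lip a0 a1 rho Ha) (w0_lip a0 a1 rho Ha)
    ltac:(assumption) ltac:(assumption) ltac:(assumption) ltac:(assumption)).
  assert (L1 := DL (xi1 a0 a1 rho) (w1 a0 a1 rho) xi1f xi1b w1f w1b (xi1_lip a0 a1 rho Ha) (w1_lip a0 a1 rho Ha)
    ltac:(assumption) ltac:(assumption) ltac:(assumption) ltac:(assumption)).
  assert (LE := DL (eta a0 a1 rho) (we a0 a1 rho) etaf etab wef web (eta_lip a0 a1 rho Ha) (we_lip a0 a1 rho Ha)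
    ltac:(assumption) ltac:(assumption) ltac:(assumption) ltac:(assumption)).
  repeat apply Forall2_cons; try apply Forall2_nil; apply value_of_ok; try assumption.
  apply okc_sub; now apply okc_mul.
Qed.

End AssemblyCorrect.

(** * Newton iteration in two variables *)

(** Restriction to segments lets the one-variable mean value theorem serve for the Newton map. *)
Lemma differentiable_segment (F : R -> R -> R) (a b a' b' s Fa Fb : R) :
  differentiable_pt_lim F (a + s * (a' - a)) (b + s * (b' - b)) Fa Fb ->
  is_derive (fun s => F (a + s * (a' - a)) (b + s * (b' - b))) s (Fa * (a' - a) + Fb * (b' - b)).
Proof.
  intros H.
  assert (Hu : forall a a', derivable_pt_lim (fun s => a + s * (a' - a)) s (a' - a)).
  { intros; apply is_derive_Reals; auto_derive; [trivial|ring]. }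
  apply is_derive_Reals.
  apply (derivable_pt_lim_comp_2d F _ _ s Fa Fb _ _ H (Hu a a') (Hu b b')).
Qed.

Section Root.

Variables (F G : R -> R -> R) (c0 c1 d : R) (p00 p01 p10 p11 e : R).

Let K (a b : R) : Prop := Rabs (a - c0) <= d /\ Rabs (b - c1) <= d.
Let N0 (a b : R) : R := a - (p00 * F a b + p01 * G a b).
Let N1 (a b : R) : R := b - (p10 * F a b + p11 * G a b).

Hypothesis Hdet : p00 * p11 - p01 * p10 <> 0.
Hypothesis HD : forall a b, K a b -> exists Fa Fb Ga Gb,
  differentiable_pt_lim F a b Fa Fb /\ differentiable_pt_lim G a b Ga Gb /\
  Rabs (1 - (p00 * Fa + p01 * Ga)) + Rabs (p00 * Fb + p01 * Gb) <= 1 / 10 /\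
  Rabs (p10 * Fa + p11 * Ga) + Rabs (1 - (p10 * Fb + p11 * Gb)) <= 1 / 10.
Hypothesis He0 : Rabs (p00 * F c0 c1 + p01 * G c0 c1) <= e.
Hypothesis He1 : Rabs (p10 * F c0 c1 + p11 * G c0 c1) <= e.
Hypothesis Hd : 2 * e <= d.

Let convex (c x y s : R) : 0 <= s <= 1 -> Rabs (x - c) <= d -> Rabs (y - c) <= d ->
  Rabs (x + s * (y - x) - c) <= d.
Proof.
  intros Hs Hx Hy; replace (x + s * (y - x) - c) with ((1 - s) * (x - c) + s * (y - c)) by ring.
  replace d with ((1 - s) * d + s * d) by ring.
  apply abs_plus_le; (apply abs_mult_le; [rewrite Rabs_right; lra|assumption]).
Qed.

(** The rows of the derivative of id - P (F, G), with P the matrix of the p's, have absolute sum at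
    most 1/10, and the square K is convex; this gives a contraction in the maximum norm. *)
Lemma newton_contracts (a b a' b' m : R) : K a b -> K a' b' -> Rabs (a' - a) <= m -> Rabs (b' - b) <= m ->
  Rabs (N0 a' b' - N0 a b) <= m / 10 /\ Rabs (N1 a' b' - N1 a b) <= m / 10.
Proof.
  intros [Ka Kb] [Ka' Kb'] Ha Hb.
  assert (Hm : 0 <= m) by (apply Rle_trans with (2 := Ha), Rabs_pos).
  assert (C : forall (N : R -> R -> R) , (forall s, 0 <= s <= 1 -> exists n0 n1,
     is_derive (fun s => N (a + s * (a' - a)) (b + s * (b' - b))) s (n0 * (a' - a) + n1 * (b' - b)) /\
     Rabs n0 + Rabs n1 <= 1 / 10) -> Rabs (N a' b' - N a b) <= m / 10).
  { intros N HN.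
    assert (M := mvt_bound (fun s => N (a + s * (a' - a)) (b + s * (b' - b)))
      (fun s => Derive (fun s => N (a + s * (a' - a)) (b + s * (b' - b))) s) 0 1 (m / 10)).
    cbv beta in M.
    replace (a + 1 * (a' - a)) with a' in M by ring; replace (b + 1 * (b' - b)) with b' in M by ring.
    replace (a + 0 * (a' - a)) with a in M by ring; replace (b + 0 * (b' - b)) with b in M by ring.
    rewrite Rmin_left, Rmax_right in M by lra; rewrite Rminus_0_r, Rabs_R1, Rmult_1_r in M.
    apply M; intros s Hs; destruct (HN s Hs) as [n0 [n1 [D L]]].
    - apply Derive_correct; eexists; exact D.
    - replace (Derive _ s) with (n0 * (a' - a) + n1 * (b' - b)) by (symmetry; now apply is_derive_unique).
      apply Rle_trans with (Rabs n0 * m + Rabs n1 * m).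
      + apply abs_plus_le; apply abs_mult_le; try assumption; apply Rle_refl.
      + assert (P0 := Rabs_pos n0); assert (P1 := Rabs_pos n1); nra. }
  split; apply C; intros s Hs;
    destruct (HD (a + s * (a' - a)) (b + s * (b' - b))) as [Fa [Fb [Ga [Gb [DF [DG [L0 L1]]]]]]];
    try (split; now apply convex); apply differentiable_segment in DF; apply differentiable_segment in DG.
  - exists (1 - (p00 * Fa + p01 * Ga)), (- (p00 * Fb + p01 * Gb)); split; [|now rewrite Rabs_Ropp].
    unfold N0; eapply is_derive_eq; [apply derive_minus; [|apply derive_plus; apply derive_scal; [exact DF|exact DG]]|].
    + assert (Du : is_derive (fun s => a + s * (a' - a)) s (a' - a)) by (auto_derive; [trivial|ring]). exact Du.
    + ring.
  - exists (- (p10 * Fa + p11 * Ga)), (1 - (p10 * Fb + p11 * Gb)); split; [|now rewrite Rabs_Ropp].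
    unfold N1; eapply is_derive_eq; [apply derive_minus; [|apply derive_plus; apply derive_scal; [exact DF|exact DG]]|].
    + assert (Du : is_derive (fun s => b + s * (b' - b)) s (b' - b)) by (auto_derive; [trivial|ring]). exact Du.
    + ring.
Qed.

Let e_pos : 0 <= e.
Proof. apply Rle_trans with (2 := He0), Rabs_pos. Qed.

Let K_center : K c0 c1.
Proof. split; rewrite Rminus_diag, Rabs_R0; lra. Qed.

(** A zero is a fixed point of the Newton map, which moves the centre by at most e. With m the
    distance to the centre, m <= m/10 + e. *)
Lemma root_location (a b : R) : K a b -> F a b = 0 -> G a b = 0 ->
  Rabs (a - c0) <= 10 / 9 * e /\ Rabs (b - c1) <= 10 / 9 * e.
Proof.
  intros Hk HF HG.
  set (m := Rmax (Rabs (a - c0)) (Rabs (b - c1))).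
  destruct (newton_contracts c0 c1 a b m K_center Hk (Rmax_l _ _) (Rmax_r _ _)) as [C0 C1].
  unfold N0 in C0; unfold N1 in C1; rewrite HF, HG in C0, C1.
  assert (A0 : Rabs (a - c0) <= m / 10 + e).
  { replace (a - c0) with ((a - (p00 * 0 + p01 * 0) - (c0 - (p00 * F c0 c1 + p01 * G c0 c1)))
      + - (p00 * F c0 c1 + p01 * G c0 c1)) by ring.
    apply abs_plus_le; [exact C0|now rewrite Rabs_Ropp]. }
  assert (A1 : Rabs (b - c1) <= m / 10 + e).
  { replace (b - c1) with ((b - (p10 * 0 + p11 * 0) - (c1 - (p10 * F c0 c1 + p11 * G c0 c1)))
      + - (p10 * F c0 c1 + p11 * G c0 c1)) by ring.
    apply abs_plus_le; [exact C1|now rewrite Rabs_Ropp]. }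
  assert (A : m <= m / 10 + e) by (now apply Rmax_lub).
  assert (R0 := Rmax_l (Rabs (a - c0)) (Rabs (b - c1))); assert (R1 := Rmax_r (Rabs (a - c0)) (Rabs (b - c1))).
  fold m in R0, R1; lra.
Qed.

Lemma root_unique (a b a' b' : R) : K a b -> K a' b' -> F a b = 0 -> G a b = 0 -> F a' b' = 0 -> G a' b' = 0 ->
  a = a' /\ b = b'.
Proof.
  intros Hk Hk' HF HG HF' HG'.
  set (m := Rmax (Rabs (a' - a)) (Rabs (b' - b))).
  destruct (newton_contracts a b a' b' m Hk Hk' (Rmax_l _ _) (Rmax_r _ _)) as [C0 C1].
  unfold N0 in C0; unfold N1 in C1; rewrite HF, HG, HF', HG' in C0, C1.
  replace (_ - _) with (a' - a) in C0 by ring; replace (_ - _) with (b' - b) in C1 by ring.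
  assert (A : m <= m / 10) by (now apply Rmax_lub).
  assert (R0 := Rmax_l (Rabs (a' - a)) (Rabs (b' - b))); assert (R1 := Rmax_r (Rabs (a' - a)) (Rabs (b' - b))).
  fold m in R0, R1.
  assert (B0 : Rabs (a' - a) <= 0) by lra; assert (B1 : Rabs (b' - b) <= 0) by lra.
  apply abs_bounds in B0; apply abs_bounds in B1; lra.
Qed.

(** The factor 1/10 is used only as 1/2: the iterates stay within 2 e of the centre and
    [geometric_cauchy] gives their limit, a fixed point. Invertibility of P then turns P (F, G) = 0
    into F = G = 0. *)
Lemma root_exists : exists a b, K a b /\ F a b = 0 /\ G a b = 0.
Proof.
  pose (u := fix u n := match n with O => (c0, c1) | S n => (N0 (fst (u n)) (snd (u n)), N1 (fst (u n)) (snd (u n))) end).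
  assert (St : forall n, (K (fst (u n)) (snd (u n)) /\
     (Rabs (fst (u n) - c0) <= 2 * e * (1 - (1 / 2) ^ n) /\ Rabs (snd (u n) - c1) <= 2 * e * (1 - (1 / 2) ^ n))) /\
     (Rabs (fst (u (S n)) - fst (u n)) <= e * (1 / 2) ^ n /\ Rabs (snd (u (S n)) - snd (u n)) <= e * (1 / 2) ^ n)).
  { induction n as [|n [[Hk [I0 I1]] [J0 J1]]].
    - simpl; rewrite !Rminus_diag, Rabs_R0; split; [split; [exact K_center|lra]|].
      rewrite !Rmult_1_r; split.
      + replace (N0 c0 c1 - c0) with (- (p00 * F c0 c1 + p01 * G c0 c1)) by (unfold N0; ring). now rewrite Rabs_Ropp.
      + replace (N1 c0 c1 - c1) with (- (p10 * F c0 c1 + p11 * G c0 c1)) by (unfold N1; ring). now rewrite Rabs_Ropp.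
    - assert (Pn : 0 < (1 / 2) ^ n) by (apply pow_lt; lra).
      assert (I0' : Rabs (fst (u (S n)) - c0) <= 2 * e * (1 - (1 / 2) ^ S n)).
      { replace (fst (u (S n)) - c0) with ((fst (u (S n)) - fst (u n)) + (fst (u n) - c0)) by ring.
        apply Rle_trans with (1 := Rabs_triang _ _). simpl pow; lra. }
      assert (I1' : Rabs (snd (u (S n)) - c1) <= 2 * e * (1 - (1 / 2) ^ S n)).
      { replace (snd (u (S n)) - c1) with ((snd (u (S n)) - snd (u n)) + (snd (u n) - c1)) by ring.
        apply Rle_trans with (1 := Rabs_triang _ _). simpl pow; lra. }
      assert (Ps : 0 < (1 / 2) ^ S n) by (apply pow_lt; lra).
      assert (Hb : 2 * e * (1 - (1 / 2) ^ S n) <= d) by nra.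
      assert (Hk' : K (fst (u (S n))) (snd (u (S n)))) by (split; lra).
      split; [split; [exact Hk'|split; assumption]|].
      destruct (newton_contracts _ _ _ _ (e * (1 / 2) ^ n) Hk Hk' J0 J1) as [C0 C1].
      assert (0 <= e * (1 / 2) ^ n) by nra.
      split; [apply Rle_trans with (1 := C0)|apply Rle_trans with (1 := C1)]; simpl pow; lra. }
  destruct (geometric_cauchy (fun n => fst (u n)) e) as [a [La Ba]]; [intros n; apply St|].
  destruct (geometric_cauchy (fun n => snd (u n)) e) as [b [Lb Bb]]; [intros n; apply St|].
  assert (Hk : K a b).
  { assert (B0 := Ba 0%nat); assert (B1 := Bb 0%nat); simpl in B0, B1.
    rewrite Rabs_minus_sym in B0; rewrite Rabs_minus_sym in B1; split; lra. }
  assert (Hlim : forall n, Rabs (fst (u (S n)) - N0 a b) <= 2 * e * (1 / 2) ^ n / 10 /\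
     Rabs (snd (u (S n)) - N1 a b) <= 2 * e * (1 / 2) ^ n / 10).
  { intros n; apply (newton_contracts a b (fst (u n)) (snd (u n))); [exact Hk|apply St|apply Ba|apply Bb]. }
  assert (Sq : forall (v : nat -> R) (l l' : R), is_lim_seq v l ->
     (forall n, Rabs (v (S n) - l') <= 2 * e * (1 / 2) ^ n / 10) -> l = l').
  { intros v l l' Hv Hb.
    assert (Z : is_lim_seq (fun n => v (S n) - l') 0).
    { apply is_lim_seq_abs_0, is_lim_seq_le_le with (fun _ => 0) (fun n => 2 * e * (1 / 2) ^ n).
      - intros n; split; [apply Rabs_pos|].
        assert (Pn : 0 < (1 / 2) ^ n) by (apply pow_lt; lra).
        apply Rle_trans with (1 := Hb n); assert (0 <= 2 * e * (1 / 2) ^ n) by (apply Rmult_le_pos; lra); lra.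
      - apply is_lim_seq_const.
      - apply half_pow_lim. }
    assert (Z' : is_lim_seq (fun n => v (S n) - l') (l - l')).
    { apply is_lim_seq_minus'; [now apply is_lim_seq_incr_1 in Hv|apply is_lim_seq_const]. }
    apply is_lim_seq_unique in Z; apply is_lim_seq_unique in Z'; rewrite Z in Z'; injection Z'; lra. }
  assert (E0 := Sq _ _ _ La (fun n => proj1 (Hlim n))); assert (E1 := Sq _ _ _ Lb (fun n => proj2 (Hlim n))).
  exists a, b; split; [exact Hk|].
  unfold N0 in E0; unfold N1 in E1.
  assert (Z0 : p00 * F a b + p01 * G a b = 0) by lra; assert (Z1 : p10 * F a b + p11 * G a b = 0) by lra.
  split.
  - apply Rmult_eq_reg_l with (p00 * p11 - p01 * p10); [|exact Hdet].
    transitivity (p11 * (p00 * F a b + p01 * G a b) - p01 * (p10 * F a b + p11 * G a b)); [ring|rewrite Z0, Z1; ring].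
  - apply Rmult_eq_reg_l with (p00 * p11 - p01 * p10); [|exact Hdet].
    transitivity (p00 * (p10 * F a b + p11 * G a b) - p10 * (p00 * F a b + p01 * G a b)); [ring|rewrite Z0, Z1; ring].
Qed.

End Root.

(** * The zero in the parameter box *)

(** Candidates carry no accuracy guarantee, so they may be rounded and truncated freely to speed up
    a run at lower precision. *)
Definition coarsen (k : Z) (n : nat) (c : candidates) : candidates :=
  let f := fun l => map (fun a => Z.shiftr a k) (firstn n l) in
  Candidates (Z.shiftr (cr c) k) (f (cy c)) (f (cx c)) (f (cz c)) (f (cxi0 c)) (f (cxi1 c)) (f (ceta c)).

(* Bounds are given in units of 10^-18. *)
Definition within (p : Z) (b ve : Z * Z) : bool :=
  ((fst b * scale p <=? (fst ve - snd ve) * 10 ^ 18) && ((fst ve + snd ve) * 10 ^ 18 <=? snd b * scale p))%Z%bool.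

Fixpoint all_within (p : Z) (bs l : list (Z * Z)) : bool :=
  match bs, l with
  | [], [] => true
  | b :: bs, ve :: l => (within p b ve && all_within p bs l)%bool
  | _, _ => false
  end.

Definition certified (p : Z) (run : bool * list (Z * Z)) (bs : list (Z * Z)) : bool :=
  (fst run && all_within p bs (snd run))%bool.

Definition in_bounds (x : R) (b : Z * Z) : Prop := IZR (fst b) / 10 ^ 18 <= x <= IZR (snd b) / 10 ^ 18.

Lemma within_ok (p : Z) (b ve : Z * Z) (x : R) :
  (0 <= p)%Z -> encloses p x ve -> within p b ve = true -> in_bounds x b.
Proof.
  intros Hp He Hw; assert (HS := scale_pos p Hp); apply andb_prop in Hw; destruct Hw as [W1 W2].
  apply Z.leb_le, IZR_le in W1; apply Z.leb_le, IZR_le in W2.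
  rewrite !mult_IZR, minus_IZR in W1; rewrite !mult_IZR, plus_IZR in W2.
  change (IZR (10 ^ 18)) with 1000000000000000000 in W1, W2.
  unfold encloses in He; apply abs_bounds in He; unfold in_bounds.
  replace (10 ^ 18) with 1000000000000000000 by (simpl; ring).
  set (S2 := IZR (scale p)) in *.
  split; apply Rmult_le_reg_r with S2; try exact HS; unfold Rdiv; lra.
Qed.

Lemma certified_ok (p : Z) (b : bool) (l bs : list (Z * Z)) (xs : list R) :
  (0 <= p)%Z -> (b = true -> Forall2 (encloses p) xs l) -> certified p (b, l) bs = true ->
  Forall2 in_bounds xs bs.
Proof.
  intros Hp He Hc; apply andb_prop in Hc; destruct Hc as [Hb Hw]; simpl in Hb, Hw.
  specialize (He Hb); clear Hb; revert bs Hw; induction He as [|x ve xs l Hx _ IH]; intros [|b' bs] Hw; try discriminate Hw.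
  - apply Forall2_nil.
  - simpl in Hw; apply andb_prop in Hw; destruct Hw as [W1 W2].
    apply Forall2_cons; [exact (within_ok p b' ve x Hp Hx W1)|now apply IH].
Qed.

(** er has to cover the radius d measured in coarse units, plus one unit for the floor in the
    shift. *)
Lemma shifted_center (q k z er : Z) (x d : R) :
  (0 <= q)%Z -> (0 <= k)%Z -> Rabs (x - IZR z / IZR (scale (q + k))) <= d ->
  d * IZR (scale q) + 1 <= IZR er -> Rabs (x * IZR (scale q) - IZR (Z.shiftr z k)) <= IZR er.
Proof.
  intros Hq Hk Hx Hd; apply Rle_trans with (2 := Hd).
  assert (Sq := scale_pos q Hq); assert (Sk := scale_pos k Hk); assert (B := shiftr_bounds k Hk z).
  assert (E : IZR (scale (q + k)) = IZR (scale q) * IZR (scale k)).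
  { unfold scale; now rewrite Z.pow_add_r, mult_IZR. }
  rewrite E in Hx.
  replace (x * IZR (scale q) - IZR (Z.shiftr z k)) with
    ((x - IZR z / (IZR (scale q) * IZR (scale k))) * IZR (scale q) + (IZR z / IZR (scale k) - IZR (Z.shiftr z k)))
    by (field; lra).
  apply abs_plus_le; [|apply abs_le; lra].
  rewrite Rabs_mult, (Rabs_right (IZR (scale q))) by lra. apply Rmult_le_compat_r; lra.
Qed.

Section Case.

Variables (rho : R) (az0 az1 rhoz : Z) (fwd bwd : candidates).

Definition center_check (bs : list (Z * Z)) : bool :=
  certified 70 (energy_values 70 46 56 az0 az1 rhoz 0 fwd bwd) bs.

(** Used with q = 32 on the square of radius 101 / 10^12, which is less than one unit 2^(-32), and
    with q = 58 on that of radius 4 / 10^15, about 1153 units 2^(-58). Hence er = 2 and er =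
    1300. *)
Definition derivative_check (q k : Z) (nf nb : nat) (er : Z) (bs : list (Z * Z)) : bool :=
  certified q (derivative_values q nf nb (Z.shiftr az0 k) (Z.shiftr az1 k) (Z.shiftr rhoz k) er
    (coarsen k nf fwd) (coarsen k nb bwd)) bs.

Let c0 : R := IZR az0 / IZR (scale 70).
Let c1 : R := IZR az1 / IZR (scale 70).
(** Slightly more than the half-width 10^(-10) of the boxes, to allow for the dyadic centre. *)
Let d : R := 101 / 10 ^ 12.
(** Length of the Newton step at the centre, where chi and lambda are at most 11 and 18 units of
    10^(-16); 10/9 of it is below 4 / 10^15. *)
Let e : R := 34 / 10 ^ 16.
Let K (a b : R) : Prop := Rabs (a - c0) <= d /\ Rabs (b - c1) <= d.

Notation dchi0 a b := (dchi a b rho (xi0 a b rho) (ga0 a b rho 0)).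
Notation dchi1 a b := (dchi a b rho (xi1 a b rho) 0).
Notation dlambda0 a b := (dlambda a b rho (xi0 a b rho) (w0 a b rho)).
Notation dlambda1 a b := (dlambda a b rho (xi1 a b rho) (w1 a b rho)).
Notation dlambdax a b := (dlambda a b rho (eta a b rho) (we a b rho)).

Hypothesis Hnear : forall a b, K a b -> near a b rho /\ Rabs (a + 1 / 2) < 3 / 1000 /\ Rabs b < 4 / 100.
Hypothesis Hrho : Rabs (rho - IZR rhoz / IZR (scale 70)) <= / IZR (scale 70).

Lemma certified_derivatives (q k : Z) (nf nb : nat) (er : Z) (bs : list (Z * Z)) (a b r : R) :
  (0 <= q)%Z -> (0 <= k)%Z -> (q + k = 70)%Z -> derivative_check q k nf nb er bs = true ->
  r <= d -> Rabs (a - c0) <= r -> Rabs (b - c1) <= r -> r * IZR (scale q) + 1 <= IZR er ->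
  Forall2 in_bounds [dchi0 a b; dchi1 a b; dlambda0 a b; dlambda1 a b; dlambdax a b;
    dchi0 a b * dlambda1 a b - dchi1 a b * dlambda0 a b] bs.
Proof.
  intros Hq Hk Hqk Hc Hrd Ha Hb Hr; unfold derivative_check in Hc.
  destruct (derivative_values _ _ _ _ _ _ _ _ _) as [bo l] eqn:E.
  apply (certified_ok q bo l bs _ Hq); [|exact Hc]; intros ->.
  apply (derivative_values_ok q nf nb _ _ _ _ _ _ Hq a b rho) with (5 := E).
  - apply Hnear; split; lra.
  - apply (shifted_center q k) with r; try assumption; rewrite Hqk; exact Ha.
  - apply (shifted_center q k) with r; try assumption; rewrite Hqk; exact Hb.
  - assert (S70 : 0 < IZR (scale 70)) by (apply scale_pos; lia).
    assert (Sq := scale_pos q Hq).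
    apply (shifted_center q k rhoz 2 rho (/ IZR (scale 70))); try assumption; [rewrite Hqk; exact Hrho|].
    assert (Hle : IZR (scale q) <= IZR (scale 70)) by (apply IZR_le; unfold scale; apply Z.pow_le_mono_r; lia).
    assert (/ IZR (scale 70) * IZR (scale q) <= / IZR (scale 70) * IZR (scale 70)).
    { apply Rmult_le_compat_l; [left; apply Rinv_0_lt_compat; exact S70|exact Hle]. }
    rewrite Rinv_l in H by lra; lra.
Qed.

Hypothesis Hcenter : center_check [(-1100, 1100)%Z; (-1800, 1800)%Z] = true.

Lemma center_bounds : Rabs (chi1 c0 c1 rho) <= 11 / 10 ^ 16 /\ Rabs (lambda_minus c0 c1 rho 1) <= 18 / 10 ^ 16.
Proof.
  assert (S70 : 0 < IZR (scale 70)) by (apply scale_pos; lia).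
  assert (HK : K c0 c1) by (split; rewrite Rminus_diag, Rabs_R0; unfold d; lra).
  assert (Hc := Hcenter); unfold center_check in Hc.
  destruct (energy_values _ _ _ _ _ _ _ _ _) as [bo l] eqn:E.
  assert (H : Forall2 in_bounds [chi1 c0 c1 rho; lambda_minus c0 c1 rho 1] [(-1100, 1100)%Z; (-1800, 1800)%Z]).
  { apply (certified_ok 70 bo l _ _ ltac:(lia)); [|exact Hc]; intros ->.
    apply (energy_values_ok 70 46 56 az0 az1 rhoz 0 fwd bwd ltac:(lia) c0 c1 rho) with (5 := E).
    - apply Hnear, HK.
    - unfold c0; replace (_ - _) with 0 by (field; lra). rewrite Rabs_R0; lra.
    - unfold c1; replace (_ - _) with 0 by (field; lra). rewrite Rabs_R0; lra.
    - replace (rho * IZR (scale 70) - IZR rhoz) with ((rho - IZR rhoz / IZR (scale 70)) * IZR (scale 70)) by (field; lra).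
      rewrite Rabs_mult, (Rabs_right (IZR (scale 70))) by lra.
      apply Rle_trans with (/ IZR (scale 70) * IZR (scale 70)); [apply Rmult_le_compat_r; lra|rewrite Rinv_l; lra]. }
  inversion H as [|? ? ? ? B1 H']; inversion H' as [|? ? ? ? B2 H'']; subst.
  unfold in_bounds in B1, B2; simpl in B1, B2; split; apply abs_le; simpl; lra.
Qed.

Variables (b00 b01 b10 b11 bx bd : Z * Z) (p00 p01 p10 p11 : R).
Hypothesis Hcoarse : derivative_check 32 38 16 20 2 [b00; b01; b10; b11; bx; bd] = true.
Hypothesis Hdet : p00 * p11 - p01 * p10 <> 0.
Hypothesis Hrows : forall Fa Fb Ga Gb,
  in_bounds Fa b00 -> in_bounds Fb b01 -> in_bounds Ga b10 -> in_bounds Gb b11 ->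
  Rabs (1 - (p00 * Fa + p01 * Ga)) + Rabs (p00 * Fb + p01 * Gb) <= 1 / 10 /\
  Rabs (p10 * Fa + p11 * Ga) + Rabs (1 - (p10 * Fb + p11 * Gb)) <= 1 / 10.
Hypothesis He : Rabs p00 * 11 + Rabs p01 * 18 <= 34 /\ Rabs p10 * 11 + Rabs p11 * 18 <= 34.

Notation F := (fun a b => chi1 a b rho).
Notation G := (fun a b => lambda_minus a b rho 1).

Lemma case_derivatives (a b : R) : K a b -> exists Fa Fb Ga Gb,
  differentiable_pt_lim F a b Fa Fb /\ differentiable_pt_lim G a b Ga Gb /\
  Rabs (1 - (p00 * Fa + p01 * Ga)) + Rabs (p00 * Fb + p01 * Gb) <= 1 / 10 /\
  Rabs (p10 * Fa + p11 * Ga) + Rabs (1 - (p10 * Fb + p11 * Gb)) <= 1 / 10.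
Proof.
  intros Hk; destruct (Hnear a b Hk) as [Ha [Hs0 Hs1]].
  exists (dchi0 a b), (dchi1 a b), (dlambda0 a b), (dlambda1 a b).
  split; [now apply chi1_differentiable|split; [now apply lambda_minus_differentiable|]].
  assert (H : Forall2 in_bounds [dchi0 a b; dchi1 a b; dlambda0 a b; dlambda1 a b; dlambdax a b;
    dchi0 a b * dlambda1 a b - dchi1 a b * dlambda0 a b] [b00; b01; b10; b11; bx; bd]).
  { apply (certified_derivatives 32 38 16 20 2 _ a b d); try lia; try assumption; try apply Hk; try apply Rle_refl.
    unfold d; change (IZR (scale 32)) with 4294967296; simpl; lra. }
  repeat match goal with H : Forall2 _ (_ :: _) _ |- _ => inversion H; clear H; subst end.
  now apply Hrows.
Qed.

Let d_val : d = 101 / 1000000000000.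
Proof. unfold d; simpl; field. Qed.

Let e_val : e = 34 / 10000000000000000.
Proof. unfold e; simpl; field. Qed.

Lemma case_center (p q : R) : Rabs p * 11 + Rabs q * 18 <= 34 -> Rabs (p * F c0 c1 + q * G c0 c1) <= e.
Proof.
  intros H; destruct center_bounds as [B1 B2].
  assert (A : Rabs (p * F c0 c1 + q * G c0 c1) <= Rabs p * (11 / 10 ^ 16) + Rabs q * (18 / 10 ^ 16)).
  { apply abs_plus_le; apply abs_mult_le; try assumption; apply Rle_refl. }
  apply Rle_trans with (1 := A); rewrite e_val; simpl; lra.
Qed.

Lemma case_root : exists a b, (Rabs (a - c0) <= 4 / 10 ^ 15 /\ Rabs (b - c1) <= 4 / 10 ^ 15) /\ F a b = 0 /\ G a b = 0.
Proof.
  destruct He as [E0 E1].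
  destruct (root_exists F G c0 c1 d p00 p01 p10 p11 e Hdet case_derivatives (case_center _ _ E0) (case_center _ _ E1)) as [a [b [Hk [HF HG]]]].
  { rewrite d_val, e_val; lra. }
  exists a, b; split; [|split; assumption].
  destruct (root_location F G c0 c1 d p00 p01 p10 p11 e case_derivatives (case_center _ _ E0) (case_center _ _ E1)
    ltac:(rewrite d_val, e_val; lra) a b Hk HF HG) as [L0 L1].
  rewrite e_val in L0, L1; simpl; lra.
Qed.

Lemma case_location (a b : R) : K a b -> F a b = 0 -> G a b = 0 ->
  Rabs (a - c0) <= 4 / 10 ^ 15 /\ Rabs (b - c1) <= 4 / 10 ^ 15.
Proof.
  intros Hk HF HG; destruct He as [E0 E1].
  destruct (root_location F G c0 c1 d p00 p01 p10 p11 e case_derivatives (case_center _ _ E0) (case_center _ _ E1)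
    ltac:(rewrite d_val, e_val; lra) a b Hk HF HG) as [L0 L1].
  rewrite e_val in L0, L1; simpl; lra.
Qed.

Lemma case_unique (a b a' b' : R) : K a b -> K a' b' ->
  F a b = 0 -> G a b = 0 -> F a' b' = 0 -> G a' b' = 0 -> a = a' /\ b = b'.
Proof. exact (root_unique F G c0 c1 d p00 p01 p10 p11 case_derivatives a b a' b'). Qed.

Variables (s00 s01 s10 s11 sx sd : Z * Z).
Hypothesis Hsharp : derivative_check 58 12 40 48 1300 [s00; s01; s10; s11; sx; sd] = true.

Lemma case_sharp (a b : R) : K a b -> F a b = 0 -> G a b = 0 ->
  (exists D, is_jacobian_det F G a b D /\ in_bounds D sd) /\
  (exists l, is_derive (lambda_minus a b rho) 1 l /\ in_bounds l sx).
Proof.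
  intros Hk HF HG; destruct (Hnear a b Hk) as [Ha [Hs0 Hs1]].
  destruct (case_location a b Hk HF HG) as [L0 L1].
  assert (H : Forall2 in_bounds [dchi0 a b; dchi1 a b; dlambda0 a b; dlambda1 a b; dlambdax a b;
    dchi0 a b * dlambda1 a b - dchi1 a b * dlambda0 a b] [s00; s01; s10; s11; sx; sd]).
  { apply (certified_derivatives 58 12 40 48 1300 _ a b (4 / 10 ^ 15)); try lia; try assumption.
    - rewrite d_val; simpl; lra.
    - change (IZR (scale 58)) with 288230376151711744; simpl; lra. }
  repeat match goal with H : Forall2 _ (_ :: _) _ |- _ => inversion H; clear H; subst end.
  split.
  - eexists; split; [|eassumption].
    exists (dchi0 a b), (dchi1 a b), (dlambda0 a b), (dlambda1 a b).
    split; [now apply chi1_differentiable|split; [now apply lambda_minus_differentiable|reflexivity]].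
  - eexists; split; [|eassumption]. now apply lambda_minus_derive.
Qed.

End Case.

(** * Numerical data *)

(* The polynomials come from Picard iteration in high precision and the
   centres from Newton's method; only their residuals matter below. *)

Open Scope Z_scope.

Definition plus_fwd : candidates := Candidates (795086101815433897053)
  [2315162340262442145281; 1559178777730600707006; 525025484962301247087; 117861942794062109802;
   19843947518359359341; 2672837346992989459; 300010010477625165; 28863711277149140; 2429834254342874;
   181822910878936; 12245120742397; 749695410526; 42074413585; 2179662161; 104851733; 4707592; 198150; 7850;
   294; 10]
  [954440397465883568975; -509242690274574219330; -350758081594682178860; -79876493515206055430;
   -13649151666191992156; -1298743161632639982; 253229535011412545; 125350779281367552; 7589797383013130;
   -5628502188846062; 808213324899086; 2203715602691514; 1025002653127384; 191082760268324; -17940222400167;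
   -8320124810315; 9170601853191; 7640763407401; 2442801399144; 164142289933; -120881954857; 7642994089;
   48238494346; 25281585091; 5003656387; -708752484; -435224655; 184062271; 214007683; 75447553; 4042431;
   -5910367; -883522; 1312352; 845148; 176393; -38190; -27434; 2054; 7153; 2893; 125; -318; -89; 36; 33]
  [1077709437104978175191; -215128937458856340358; -111698792872379600235; 14464405341725198847;
   18162233024816796887; 4034190705457543823; -842738819131609857; -781063725215600199; -78580094929276900;
   126593840761369460; 64509096668404652; 4523340114117361; -7344437838424424; -2539309936636156;
   591885173112484; 716852514778676; 188195332842955; -37271165401162; -37314523005647; -4036002430361;
   5850432598725; 3110825803184; 268264173468; -360643061736; -144180182649; 20616339053; 35519907501;
   10566870492; -1646465261; -2106798885; -361192659; 268608650; 170858476; 20561390; -19399132; -9403506;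
   342113; 1859775; 652125; -65604; -126198; -30249; 12065; 9901; 1620; -1051]
  [30215098702341055469; 92802730585376168865; 95309535773301018850; 30805178507459314215;
   -4560644985935147292; -2828087738694767938; 163638535854751378; 541064182877230748; 224682192057172836;
   16440280676157347; -22750637825937586; -6956153251014238; 2682795968562357; 2509665979095891;
   605419103771412; -125007118761985; -112416987002790; -6927309830589; 20551251209521; 9984104869562;
   726437448237; -1144561182428; -416974170725; 85450856620; 115013280701; 31888767929; -5816150054;
   -6496613982; -949273924; 897759260; 528086574; 54102732; -62586461; -28229591; 1811203; 5870085; 1930968;
   -252925; -393821; -86913; 39878; 30239; 4383; -3431; -1896; -60]
  [26847292425666599950; 75032711996809948470; 57069949636671386336; -11622320410262168022;
   -29305877789183269662; -8989162805563381189; 551647589551712571; 877316915343548972; 21426146125680493;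
   -197984877826857498; -103184263129888332; -15515203438871408; 6853144014042976; 2921251191750716;
   -905265273395951; -1090379729892257; -345553451196035; 12635310873476; 42512339438288; 5119280523416;
   -8273486621943; -4909236755446; -793247375729; 361198112811; 186769581632; -23820473842; -50966261692;
   -18261604071; 460592650; 2570106551; 561385257; -340867426; -255482836; -47896805; 20395922; 12971632;
   193720; -2494247; -1051223; 928; 159454; 48516; -13027; -14036; -3174; 1114]
  [1186951841453277930491; 16010754931055635126; 10975016055140536871; -1782112842447184255;
   -4248624419165839947; -1032621453865800870; 235548599097615342; 126667548763719154; -23627029222986628;
   -35054186679614457; -11999698815434734; -172656230664882; 1237823415085400; 191391397202958;
   -238903510762687; -152069310646541; -28596247480630; 8783527714230; 5212690879611; -638314819175;
   -1473933974817; -559210373590; -9765178063; 65861450040; 15108205330; -9485721429; -7313911503;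
   -1539201834; 466993110; 335160458; 4353132; -68581240; -30095962; -1010887; 3956395; 1258652; -347442;
   -382628; -93661; 25280; 22282; 2562; -3280; -1744; -112; 238].
Definition plus_bwd : candidates := Candidates (-1425071087781085392733)
  [353077931529676734752; -426194073485576296226; 257225632153338893121; -103497490858350375653;
   31232493796308696232; -7540037236817773668; 1516907410152591539; -261575982645976831; 39467962882477348;
   -5293452669589624; 638963230095245; -70116465290868; 7053027885199; -654891089162; 56464810913;
   -4543844408; 342799596; -24340428; 1632272; -103699; 6259; -360; 20; -1]
  [782069200793256437340; -664864240810080347237; -168396951759131494134; 70160864467844316634;
   -22676252076927066206; 4226928376166816172; -596226658531667856; 141669413567370619; -99477591021576346;
   42635410468983247; -6691002424064584; -3234936327220556; 2303900092242320; -501747635572219;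
   -93907771682385; 81192437066726; -5196214883626; -12814523968734; 5171087241523; 699082438660;
   -1374207766312; 480351976106; 34463286205; -94181195776; 31349037950; 3126671436; -5945595740;
   1418001003; 594939607; -488217755; 73655091; 64903991; -40706515; 4784708; 5311175; -2886181; 159884;
   449446; -193706; -11323; 41032; -13897; -2278; 3521; -975; -264; 280; -59; -29; 22; -3; -3; 2]
  [1008984856774073709818; -249647026450515103061; -5131638541999617694; 50008795922240040402;
   -22120902717562583932; 3096394931696951725; 1560507839143231924; -818002936574649550; 16648057899564781;
   106382441323170287; -15913009198408624; -26841258293704364; 18232759504993107; -3314319709562644;
   -2049823536645701; 1574938094868802; -346303952033648; -106491004616840; 88313751188430; -10350759008580;
   -12520349924746; 6119854457745; 474737866083; -1573781751619; 601696425187; 48541714307; -135210721847;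
   47049746952; 5414996113; -10286446497; 2716185297; 974771271; -905674542; 156914512; 121339432;
   -82084744; 10250417; 11567029; -6575549; 410916; 1079630; -491961; -20323; 105029; -37712; -5692; 9749;
   -2828; -754; 845; -188; -89; 72; -11; -10; 6]
  [-105732453389917055210; -272797960797372146426; -192043701722198090285; 692703931638036102;
   14039712986062902691; -11071092516267466871; 1718953161437452541; 690903545743991133;
   -509603424879788728; 42449806333620834; 68182018504801265; -29368134121008940; -4088277274460384;
   7989269356900740; -2624987584780167; -443450807787450; 687873951924391; -206832378462064;
   -37663614695490; 49514167314336; -11077873101861; -5191783169350; 4051024434925; -516357666608;
   -614296732576; 357093845397; -27507804117; -57127146047; 28164826308; -461447950; -5062017703;
   2017497659; 199805337; -471292440; 146352790; 34673696; -42800779; 10519218; 4047369; -3631380; 657914;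
   439219; -298932; 31835; 45942; -24495; 754; 4498; -1946; -99; 417; -146; -23; 38; -10; -3]
  [-84033128313006621222; -180581917330752775134; -50086070722933493520; 85772432787271275225;
   18392514819914479666; -17824593711040196830; 5771617860550198594; 1080623272121235158;
   -1352403513287004242; 384033255725113848; 68004880892168895; -77042467685839897; 10407999446451982;
   12219134322999707; -6841257590907596; 205369289677326; 1347749457567019; -633317992916430;
   17617322046075; 107004009386381; -44995057427363; -1916057616279; 8729323997122; -2772982474265;
   -684891431384; 827140306572; -195668290159; -85061597384; 73634003603; -13847320892; -8304705607;
   5844865559; -698635365; -841184886; 457869597; -13299481; -85316150; 36843305; 1925698; -7968586;
   2825544; 408340; -703742; 197517; 58914; -61677; 12829; 7024; -5328; 755; 739; -442; 32; 73; -35]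
  [1174394263044434684102; -14336992001465366442; -1260419130186406709; 12298555722055774089;
   2025078380558218613; -2678279348747742502; 1083603111263339590; 71802628558145735; -221253309406613113;
   88901381064121765; -1083664113126022; -12779082518988935; 4416470707861231; 740185121204073;
   -1048672576545284; 221039725923141; 135016893078258; -103331037664906; 17315554546923; 12586255269825;
   -8475090412346; 1141794490005; 1063751532657; -599141050049; 23084319034; 106277396559; -45315793660;
   -3321009117; 10411017526; -3617305003; -537566986; 906261868; -258295027; -69697022; 75878988; -15922755;
   -8561056; 6495506; -898821; -917424; 545059; -40533; -89136; 43148; 173; -8418; 3279; 350; -782; 243; 56;
   -70; 17; 7; -6; 1].
Definition plus_a0 := -592624824075612414103.
Definition plus_a1 := -42439622869864167727.
Definition plus_rho := 59029581035870565171.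
Definition minus_fwd : candidates := Candidates (795641481027780282438)
  [2316251705540085497295; 1561002047692965280262; 526006605213368547428; 118164674687436644201;
   19908814174952960960; 2683447538961992880; 301411334324996699; 29018787364443958; 2444595420540740;
   183055256814642; 12336726187623; 755831454078; 42448410821; 2200573122; 105931590; 4759397; 200470; 7947;
   298; 11]
  [953740246569364823700; -510392250010013821016; -349925788130774546717; -77470282783426595026;
   -12850065404149417029; -2265134283130327190; -647043524091846583; -168265657574914576;
   -22813975069258638; -1407660278227499; 314089673456997; 1221500364484836; 913780147109859;
   308278921996874; 51059987157133; 4696020786373; -1499189702954; -3595206941865; -2458769127664;
   -835307659450; -159882386738; -22701970177; 3526425835; 10975433700; 7382088796; 2580353013; 578030379;
   114556625; -1459281; -33750229; -23473652; -8625522; -2260824; -565000; -47138; 101844; 76928; 30282;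
   9192; 2701; 403; -290; -255; -109; -38; -13]
  [1076799741541932933754; -209331349508890230281; -96353321046097887020; 18504212973335938755;
   5463563102737083733; -6033505569406074523; -1827154708789264818; 643215406945769981; 262193656779348841;
   -49363792953009850; -4796123311818329; 21970031702738287; 5127227886562931; -2351606834654946;
   -793373297516528; 152691350177251; -21337934606955; -83708061686196; -15612488811395; 8534842655012;
   2393837129793; -499057333790; 203628432811; 327059286018; 51222868010; -29976827693; -6794285357;
   1684192288; -1199408065; -1299583393; -182448682; 99763361; 16413426; -5858926; 6102829; 5220577; 707640;
   -303356; -21863; 21372; -28793; -21092; -2958; 768; -97; -84]
  [30261296125867771358; 92846507140563548645; 95336930007145729724; 31497718287433983300;
   -2839375420928438270; -1403900446700803477; 156503965153010300; -190581175347342218; -221607878263040566;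
   -52931865819258228; 6105146950761737; 2509193004842243; -246287847205397; 845038671933810;
   732383948404843; 164564383767325; -13382879754155; -3903628003065; 689466475463; -3560050311803;
   -2677817610463; -597973383906; 7924035567; -6042344901; -3560171518; 14589644460; 10180804509;
   2363409202; 170876111; 113054372; 23443637; -58184403; -39340770; -9807562; -1582169; -834731; -153961;
   224179; 152404; 41717; 10250; 5011; 959; -822; -585; -179]
  [26877976546346008817; 74998895448751062684; 56915334278447575111; -11277160572786440026;
   -28234116119734755218; -8467832240899938078; -143040822525840384; 80887040748451105; -45277668325608717;
   102714735007660994; 89471530081472162; 24156089470037702; 1141697415051721; 22378974464124;
   -21761358524944; -462133417605747; -326441182040386; -86429436704884; -7846376448480; -1663200583570;
   224198945283; 1905952898192; 1240745515694; 337355147724; 49767196485; 14836908008; -48769913;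
   -7531490685; -4797453226; -1385658319; -291664683; -99640173; -7374644; 28636934; 18637934; 5855040;
   1601138; 588727; 75145; -103626; -71970; -25015; -8343; -3228; -546; 347]
  [1174209042554728362315; -16020230832519843595; -10883222084936626089; 1842445453609277478;
   4120271858543267356; 912941411881163848; -176862149766072830; -38361443157162992; 15148573398520694;
   -14768917865681320; -13537072794633120; -2390085583420999; 550775928609104; 78035698530775;
   -30755653661263; 66492654928175; 48286458920383; 7890448067186; -1509050192024; -39566443270;
   70379167309; -283713031230; -180577976396; -29623129316; 2811537776; -1034364307; -221259668; 1176188675;
   692306799; 121603583; 3534448; 9479966; 1100452; -4756918; -2687986; -527699; -80466; -61903; -6991;
   18698; 10466; 2352; 613; 355; 46; -71].
Definition minus_bwd : candidates := Candidates (-1420398952120749308297)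
  [354477989296014853658; -426481228318364002984; 256555052217998666080; -102889240992096180972;
   30947147075477574526; -7446655474383849059; 1493209202206544205; -256645269915288493; 38597033264654955;
   -5159671608899795; 620772841172204; -67897013176419; 6807381194559; -630009886944; 54141461640;
   -4342595358; 326542736; -23110096; 1544685; -97813; 5884; -337; 18; -1]
  [784557978309263652823; -663637800865317755825; -174112620989711927215; 67357823856666385903;
   -18828573715815924806; 5843138901014729497; -1344957058009986982; 164196249792897062; 16041026342838541;
   -23307732062474212; 9598985078993665; -889084327712093; -1298500311915565; 990981210166666;
   -401585298499181; 72346952282221; 29970404708631; -32908151265296; 15324947454181; -3453075249689;
   -804859451985; 1224261326400; -644309122326; 177151135088; 14229314012; -45888223749; 27678080787;
   -8996520793; 271025694; 1695236104; -1196168072; 449224721; -50861775; -60609356; 51790161; -22208236;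
   4032764; 2002963; -2225105; 1085313; -261552; -55204; 94098; -52385; 15472; 760; -3879; 2494; -867; 52;
   154; -117; 47; -7; -6; 5]
  [1012112422035644051841; -237038369582337578883; -2904038598103193572; 32693541383342618649;
   -25078816189549880406; 9903170681961460972; -925872996344706288; -1425491042538238733;
   1134252713965222928; -459341142232939761; 62083093206707631; 58862656176295469; -53616221327413032;
   23747175379493384; -4504351853860784; -2129282613301474; 2448613545743381; -1210359230478975;
   291054251854304; 67496862858357; -111040232732494; 61627983998548; -17875478202878; -1365890127761;
   4933734373378; -3114347882176; 1056985035257; -36557038183; -211473979632; 155212858183; -60485520857;
   7216730094; 8580533741; -7604495939; 3368783352; -635218352; -316891213; 364716222; -183159576; 45526969;
   9613296; -17029578; 9736054; -2953968; -139749; 767987; -506211; 180283; -11352; -33014; 25729; -10535;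
   1536; 1320; -1276; 595]
  [-105019834388473999294; -273589194866884162930; -198972527556893619729; -5263831324244998210;
   19004080152872436638; -3775428397922140669; 2108436668532689536; -665987421176574671;
   -155904213524148207; 172833812291044041; -77571762871083048; 21607338566046340; 2513543024378865;
   -6439780642233571; 3695320289980999; -1150065936981336; -1854246345579; 253324695453949;
   -173723991720051; 64147117282478; -6314566584973; -9685360911973; 8076586846568; -3445123406873;
   598544205968; 348299983164; -374358246970; 182366605417; -43277969041; -10602201937; 17044046831;
   -9492245596; 2793662092; 181739312; -753857939; 485046547; -168956882; 8768274; 31947115; -24302815;
   9779707; -1350490; -1265520; 1191049; -547388; 113612; 44437; -56887; 29789; -7973; -1172; 2633; -1581;
   510; 1; -117]
  [-83611725288947433841; -181940850505422669142; -55648848561163991750; 84257906093589541511;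
   25854425061449079100; -13656596787391869171; 2348660671152668363; -645766611373005807;
   -312497054347919463; 421450573473521426; -182841145205633678; 40982590748240430; 7051133342556293;
   -13918710530951040; 7859816423211555; -2277380491106048; -123216683087110; 574640950898078;
   -369070399596845; 127911855576867; -7145195576822; -23118767872667; 17542758182261; -7031402036222;
   986770862111; 873797393250; -824378034410; 377538746599; -78471011965; -29720325550; 38203993562;
   -19935636780; 5322691613; 763040233; -1727149509; 1033183237; -332415456; -578840; 75322328; -52500166;
   19695924; -1913504; -3113634; 2611587; -1123330; 195110; 117883; -126820; 62132; -14770; -3751; 5985;
   -3346; 987; 69; -273]
  [1186754007482197091752; 14441056711622056722; 1736818456970834849; -12221738445633405103;
   -2843783618296737863; 2318061065951136225; -570411095309151678; 125431298179633350; 59098844226064212;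
   -79922856004349369; 37179263342247909; -8408051797998963; -1798736092385271; 3088647156463274;
   -1711838641688866; 484632713895784; 40870722529771; -133679815059906; 83025206992487; -27628311505342;
   677311148739; 5645826253189; -4052531974403; 1549999891403; -171587059166; -226455287333; 195346169386;
   -85001871479; 15341030292; 8380057523; -9272242694; 4573910104; -1102215397; -260815931; 430121721;
   -241347611; 71467500; 4565485; -19333732; 12481896; -4354797; 221146; 831446; -632085; 254072; -34575;
   -33435; 31280; -14331; 2939; 1197; -1508; 786; -208; -33; 70].
Definition minus_a0 := -587967087503715499931.
Definition minus_a1 := 42416885972041220811.
Definition minus_rho := -59029581035870565172.

Definition anything : Z * Z := (- 10 ^ 20, 10 ^ 20).
Definition milli (a b : Z) : Z * Z := (a * 10 ^ 15, b * 10 ^ 15).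
Definition tenth_nano (a b : Z) : Z * Z := (a * 10 ^ 8, b * 10 ^ 8).

Lemma plus_center : center_check plus_a0 plus_a1 plus_rho plus_fwd plus_bwd [(-1100, 1100); (-1800, 1800)] = true.
Proof. vm_compute. reflexivity. Qed.

Lemma minus_center : center_check minus_a0 minus_a1 minus_rho minus_fwd minus_bwd [(-1100, 1100); (-1800, 1800)] = true.
Proof. vm_compute. reflexivity. Qed.

(** Intervals of width about 0.03 are narrow enough for the contraction test in [plus_rows]. *)
Lemma plus_coarse : derivative_check plus_a0 plus_a1 plus_rho plus_fwd plus_bwd 32 38 16 20 2
  [milli (-999) (-967); milli 266 297; milli (-1907) (-1876); milli (-689) (-656); anything; anything] = true.
Proof. vm_compute. reflexivity. Qed.

Lemma minus_coarse : derivative_check minus_a0 minus_a1 minus_rho minus_fwd minus_bwd 32 38 16 20 2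
  [milli (-1002) (-969); milli 267 299; milli (-1914) (-1880); milli (-691) (-655); anything; anything] = true.
Proof. vm_compute. reflexivity. Qed.

Lemma plus_sharp : derivative_check plus_a0 plus_a1 plus_rho plus_fwd plus_bwd 58 12 40 48 1300
  [anything; anything; anything; anything;
   tenth_nano (-1048330993) (-1048330959); tenth_nano 11941593312 11941593352] = true.
Proof. vm_compute. reflexivity. Qed.

Lemma minus_sharp : derivative_check minus_a0 minus_a1 minus_rho minus_fwd minus_bwd 58 12 40 48 1300
  [anything; anything; anything; anything;
   tenth_nano 1050308568 1050308603; tenth_nano 12001493803 12001493843] = true.
Proof. vm_compute. reflexivity. Qed.

Close Scope Z_scope.

(** * The response and the theorem *)

Definition box_center (z : Z) : R := IZR z / IZR (scale 70).

Lemma scale70 : IZR (scale 70) = 1180591620717411303424.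
Proof. reflexivity. Qed.

Lemma plus_box_in (a b : R) : B_plus a b ->
  Rabs (a - box_center plus_a0) <= 101 / 10 ^ 12 /\ Rabs (b - box_center plus_a1) <= 101 / 10 ^ 12.
Proof.
  unfold B_plus, box_center, plus_a0, plus_a1; rewrite scale70; intros [Ha Hb]; split; apply abs_le; simpl; lra.
Qed.

Lemma minus_box_in (a b : R) : B_minus a b ->
  Rabs (a - box_center minus_a0) <= 101 / 10 ^ 12 /\ Rabs (b - box_center minus_a1) <= 101 / 10 ^ 12.
Proof.
  unfold B_minus, box_center, minus_a0, minus_a1; rewrite scale70; intros [Ha Hb]; split; apply abs_le; simpl; lra.
Qed.

Lemma plus_near (a b : R) :
  Rabs (a - box_center plus_a0) <= 101 / 10 ^ 12 /\ Rabs (b - box_center plus_a1) <= 101 / 10 ^ 12 ->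
  near a b (1 / 20) /\ Rabs (a + 1 / 2) < 3 / 1000 /\ Rabs b < 4 / 100.
Proof.
  unfold box_center, plus_a0, plus_a1, near; rewrite scale70; simpl; intros [Ha Hb].
  apply abs_bounds in Ha; apply abs_bounds in Hb.
  repeat split; try (apply abs_le; lra); apply Rabs_def1; lra.
Qed.

Lemma minus_near (a b : R) :
  Rabs (a - box_center minus_a0) <= 101 / 10 ^ 12 /\ Rabs (b - box_center minus_a1) <= 101 / 10 ^ 12 ->
  near a b (-1 / 20) /\ Rabs (a + 1 / 2) < 3 / 1000 /\ Rabs b < 4 / 100.
Proof.
  unfold box_center, minus_a0, minus_a1, near; rewrite scale70; simpl; intros [Ha Hb].
  apply abs_bounds in Ha; apply abs_bounds in Hb.
  repeat split; try (apply abs_le; lra); apply Rabs_def1; lra.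
Qed.

Lemma plus_rho_close : Rabs (1 / 20 - IZR plus_rho / IZR (scale 70)) <= / IZR (scale 70).
Proof. unfold plus_rho; rewrite scale70; apply abs_le; lra. Qed.

Lemma minus_rho_close : Rabs (-1 / 20 - IZR minus_rho / IZR (scale 70)) <= / IZR (scale 70).
Proof. unfold minus_rho; rewrite scale70; apply abs_le; lra. Qed.

Ltac unfold_bounds H := unfold in_bounds, milli, tenth_nano in H; cbn [fst snd] in H;
  rewrite ?mult_IZR in H; simpl in H.

(* The rows are those of an approximate inverse of the Jacobian matrix. *)
Lemma plus_rows (Fa Fb Ga Gb : R) :
  in_bounds Fa (milli (-999) (-967)) -> in_bounds Fb (milli 266 297) ->
  in_bounds Ga (milli (-1907) (-1876)) -> in_bounds Gb (milli (-689) (-656)) ->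
  Rabs (1 - (- (5632 / 10000) * Fa + - (23595 / 100000) * Ga))
    + Rabs (- (5632 / 10000) * Fb + - (23595 / 100000) * Gb) <= 1 / 10 /\
  Rabs (158393 / 100000 * Fa + - (8233 / 10000) * Ga)
    + Rabs (1 - (158393 / 100000 * Fb + - (8233 / 10000) * Gb)) <= 1 / 10.
Proof.
  intros H1 H2 H3 H4; unfold_bounds H1; unfold_bounds H2; unfold_bounds H3; unfold_bounds H4.
  split; [replace (1 / 10) with (3 / 100 + 7 / 100) by field|replace (1 / 10) with (5 / 100 + 5 / 100) by field];
    apply Rplus_le_compat; apply abs_le; lra.
Qed.

Lemma minus_rows (Fa Fb Ga Gb : R) :
  in_bounds Fa (milli (-1002) (-969)) -> in_bounds Fb (milli 267 299) ->
  in_bounds Ga (milli (-1914) (-1880)) -> in_bounds Gb (milli (-691) (-655)) ->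
  Rabs (1 - (- (56095 / 100000) * Fa + - (23573 / 100000) * Ga))
    + Rabs (- (56095 / 100000) * Fb + - (23573 / 100000) * Gb) <= 1 / 10 /\
  Rabs (158083 / 100000 * Fa + - (82109 / 100000) * Ga)
    + Rabs (1 - (158083 / 100000 * Fb + - (82109 / 100000) * Gb)) <= 1 / 10.
Proof.
  intros H1 H2 H3 H4; unfold_bounds H1; unfold_bounds H2; unfold_bounds H3; unfold_bounds H4.
  split; [replace (1 / 10) with (3 / 100 + 7 / 100) by field|replace (1 / 10) with (5 / 100 + 5 / 100) by field];
    apply Rplus_le_compat; apply abs_le; lra.
Qed.

Lemma plus_error : Rabs (- (5632 / 10000)) * 11 + Rabs (- (23595 / 100000)) * 18 <= 34 /\
  Rabs (158393 / 100000) * 11 + Rabs (- (8233 / 10000)) * 18 <= 34.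
Proof. unfold Rabs; repeat destruct Rcase_abs; lra. Qed.

Lemma minus_error : Rabs (- (56095 / 100000)) * 11 + Rabs (- (23573 / 100000)) * 18 <= 34 /\
  Rabs (158083 / 100000) * 11 + Rabs (- (82109 / 100000)) * 18 <= 34.
Proof. unfold Rabs; repeat destruct Rcase_abs; lra. Qed.

Lemma plus_det : - (5632 / 10000) * - (8233 / 10000) - - (23595 / 100000) * (158393 / 100000) <> 0.
Proof. lra. Qed.

Lemma minus_det : - (56095 / 100000) * - (82109 / 100000) - - (23573 / 100000) * (158083 / 100000) <> 0.
Proof. lra. Qed.

(** The zero found lies within 4 / 10^15 of the centre, well inside the box; uniqueness holds on the
    square of half-width 101 / 10^12, which contains the box. *)
Lemma plus_root : exists! a : R * R, parameter_point (1 / 20) (fst a) (snd a).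
Proof.
  destruct (case_root (1 / 20) _ _ _ _ _ plus_near plus_rho_close plus_center _ _ _ _ _ _ _ _ _ _
    plus_coarse plus_det plus_rows plus_error) as [a [b [[Ha Hb] [HF HG]]]].
  unfold plus_a0, plus_a1 in Ha, Hb; rewrite scale70 in Ha, Hb; simpl in Ha, Hb.
  apply abs_bounds in Ha; apply abs_bounds in Hb.
  assert (HB : B_plus a b) by (unfold B_plus; lra).
  exists (a, b); split.
  - split; [left; split; [reflexivity|exact HB]|split; assumption].
  - intros [a' b'] [[[_ HB']|[E _]] [HF' HG']]; [|lra]; cbn [fst snd] in *.
    destruct (case_unique (1 / 20) _ _ _ _ _ plus_near plus_rho_close _ _ _ _ _ _ _ _ _ _
      plus_coarse plus_rows a b a' b' (plus_box_in _ _ HB) (plus_box_in _ _ HB') HF HG HF' HG') as [-> ->].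
    reflexivity.
Qed.

Lemma minus_root : exists! a : R * R, parameter_point (-1 / 20) (fst a) (snd a).
Proof.
  destruct (case_root (-1 / 20) _ _ _ _ _ minus_near minus_rho_close minus_center _ _ _ _ _ _ _ _ _ _
    minus_coarse minus_det minus_rows minus_error) as [a [b [[Ha Hb] [HF HG]]]].
  unfold minus_a0, minus_a1 in Ha, Hb; rewrite scale70 in Ha, Hb; simpl in Ha, Hb.
  apply abs_bounds in Ha; apply abs_bounds in Hb.
  assert (HB : B_minus a b) by (unfold B_minus; lra).
  exists (a, b); split.
  - split; [right; split; [reflexivity|exact HB]|split; assumption].
  - intros [a' b'] [[[E _]|[_ HB']] [HF' HG']]; [lra|]; cbn [fst snd] in *.
    destruct (case_unique (-1 / 20) _ _ _ _ _ minus_near minus_rho_close _ _ _ _ _ _ _ _ _ _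
      minus_coarse minus_rows a b a' b' (minus_box_in _ _ HB) (minus_box_in _ _ HB') HF HG HF' HG') as [-> ->].
    reflexivity.
Qed.

Lemma plus_derivatives (a b : R) : parameter_point (1 / 20) a b ->
  (exists d, is_jacobian_det (fun b0 b1 => chi1 b0 b1 (1 / 20)) (fun b0 b1 => lambda_minus b0 b1 (1 / 20) 1) a b d /\
     1.1941593312 <= d <= 1.1941593352) /\
  (exists l, is_derive (lambda_minus a b (1 / 20)) 1 l /\ -0.1048330993 <= l <= -0.1048330959).
Proof.
  intros [[[_ HB]|[E _]] [HF HG]]; [|lra].
  destruct (case_sharp (1 / 20) _ _ _ _ _ plus_near plus_rho_close plus_center _ _ _ _ _ _ _ _ _ _
    plus_coarse plus_rows plus_error _ _ _ _ _ _ plus_sharp a b (plus_box_in _ _ HB) HF HG)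
    as [[D [HD BD]] [l [Hl Bl]]].
  unfold_bounds BD; unfold_bounds Bl.
  split; [exists D|exists l]; (split; [assumption|lra]).
Qed.

Lemma minus_derivatives (a b : R) : parameter_point (-1 / 20) a b ->
  (exists d, is_jacobian_det (fun b0 b1 => chi1 b0 b1 (-1 / 20)) (fun b0 b1 => lambda_minus b0 b1 (-1 / 20) 1) a b d /\
     1.2001493803 <= d <= 1.2001493843) /\
  (exists l, is_derive (lambda_minus a b (-1 / 20)) 1 l /\ 0.1050308568 <= l <= 0.1050308603).
Proof.
  intros [[[E _]|[_ HB]] [HF HG]]; [lra|].
  destruct (case_sharp (-1 / 20) _ _ _ _ _ minus_near minus_rho_close minus_center _ _ _ _ _ _ _ _ _ _
    minus_coarse minus_rows minus_error _ _ _ _ _ _ minus_sharp a b (minus_box_in _ _ HB) HF HG)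
    as [[D [HD BD]] [l [Hl Bl]]].
  unfold_bounds BD; unfold_bounds Bl.
  split; [exists D|exists l]; (split; [assumption|lra]).
Qed.

Lemma box_near (rho a b : R) : parameter_box rho a b ->
  near a b rho /\ Rabs (a + 1 / 2) < 3 / 1000 /\ Rabs b < 4 / 100.
Proof.
  intros [[-> HB]|[-> HB]]; [apply plus_near, plus_box_in, HB|apply minus_near, minus_box_in, HB].
Qed.

Lemma orbits_exist (rho a0 a1 : R) : parameter_box rho a0 a1 ->
  locally_2d (fun b0 b1 => is_orbit b0 b1 rho 1 (orbit b0 b1 rho 1)) a0 a1 /\
  locally 1 (fun x0 => is_orbit a0 a1 rho x0 (orbit a0 a1 rho x0)).
Proof.
  intros Hb; destruct (box_near rho a0 a1 Hb) as [Ha [Hs0 Hs1]]; split.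
  - destruct (near_open a0 a1 rho Ha Hs0 Hs1) as [d Hd]; exists d; intros b0 b1 B0 B1.
    apply orbit_spec; [now apply Hd|exact near0_1].
  - exists (mkposreal (1 / 100) ltac:(lra)); intros y Hy.
    apply orbit_spec; [exact Ha|]. unfold near0; left; exact Hy.
Qed.

(** * Shape of the response function *)

Definition p_slope (rho a b x : R) : R :=
  1 - a + 2 * (a - b) * x + 3 * (b - rho) * x ^ 2 + 4 * rho * x ^ 3.

Section Response.

Variables rho a b : R.
Hypothesis Hbox : parameter_box rho a b.

Notation dp := (p_slope rho a b).

Lemma p_poly_derive (x : R) : is_derive (p_poly a b rho) x (dp x).
Proof. unfold p_poly, B, p_slope; auto_derive; [trivial|ring]. Qed.

Lemma p_poly_derive2 (x : R) : is_derive dp x (2 * (a - b) + 6 * (b - rho) * x + 12 * rho * x ^ 2).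
Proof. unfold p_slope; auto_derive; [trivial|ring]. Qed.

Lemma Derive_p_poly (x : R) : Derive (p_poly a b rho) x = dp x.
Proof. apply is_derive_unique, p_poly_derive. Qed.

Lemma Derive2_p_poly (x : R) :
  Derive_n (p_poly a b rho) 2 x = 2 * (a - b) + 6 * (b - rho) * x + 12 * rho * x ^ 2.
Proof.
  simpl; rewrite (Derive_ext _ dp); [apply is_derive_unique, p_poly_derive2|exact Derive_p_poly].
Qed.

(** The divided difference of p' is a polynomial dominated by 2 (a - b), close to -1. The shape
    follows from it: p' has its minimum at 1, is positive, and chord slopes decrease strictly. *)
Lemma dp_decreasing (x y : R) : 0 <= x -> x < y -> y <= 1 -> dp y < dp x.
Proof.
  intros Hx Hxy Hy.
  assert (E : dp y - dp x = (y - x) * (2 * (a - b) + 3 * (b - rho) * (x + y) + 4 * rho * (x * x + x * y + y * y)))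
    by (unfold p_slope; ring).
  assert (Q : 0 <= x * x + x * y + y * y <= 3) by nra.
  assert (L : 2 * (a - b) + 3 * (b - rho) * (x + y) + 4 * rho * (x * x + x * y + y * y) < 0).
  { destruct Hbox as [[-> [Ha Hb]]|[-> [Ha Hb]]]; nra. }
  nra.
Qed.

Lemma dp_one : dp 1 = 1 + a + b + rho.
Proof. unfold p_slope; ring. Qed.

Lemma dp_one_pos : 0 < dp 1.
Proof. rewrite dp_one; destruct Hbox as [[-> [Ha Hb]]|[-> [Ha Hb]]]; lra. Qed.

Lemma dp_min : is_min_on (Derive (p_poly a b rho)) 0 1 (dp 1).
Proof.
  split; [exists 1; split; [lra|apply Derive_p_poly]|].
  intros x Hx; rewrite Derive_p_poly; destruct (Req_dec x 1) as [->|]; [lra|left; apply dp_decreasing; lra].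
Qed.

Lemma p_on_unit (x : R) : x <= 1 -> p a b rho x = p_poly a b rho x.
Proof. intros Hx; unfold p; destruct (Rle_dec x 1); [reflexivity|lra]. Qed.

Lemma mvt_p_poly (x y : R) : x < y -> exists c, p_poly a b rho y - p_poly a b rho x = dp c * (y - x) /\ x < c < y.
Proof.
  intros Hxy; apply MVT_cor2; [exact Hxy|]; intros c _; apply is_derive_Reals, p_poly_derive.
Qed.

Lemma p_increasing : strictly_increasing_on (p a b rho) 0 1.
Proof.
  intros x y Hx Hxy Hy; rewrite !p_on_unit by lra.
  destruct (mvt_p_poly x y Hxy) as [c [E Hc]].
  assert (dp 1 < dp c) by (apply dp_decreasing; lra).
  assert (P := dp_one_pos); nra.
Qed.

Lemma p_concave : strictly_concave_on (p a b rho) 0 1.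
Proof.
  intros x y s Hx Hxy Hy Hs; set (z := s * x + (1 - s) * y).
  assert (Hz : x < z < y) by (unfold z; nra).
  rewrite !p_on_unit by lra.
  destruct (mvt_p_poly x z) as [c1 [E1 H1]]; [lra|]; destruct (mvt_p_poly z y) as [c2 [E2 H2]]; [lra|].
  assert (D : dp c2 < dp c1) by (apply dp_decreasing; lra).
  assert (E : s * p_poly a b rho x + (1 - s) * p_poly a b rho y - p_poly a b rho z
     = s * (1 - s) * (y - x) * (dp c2 - dp c1)).
  { replace (p_poly a b rho y) with (p_poly a b rho z + dp c2 * (y - z)) by lra.
    replace (p_poly a b rho x) with (p_poly a b rho z - dp c1 * (z - x)) by lra.
    unfold z; ring. }
  assert (0 < s * (1 - s)) by nra. assert (0 < s * (1 - s) * (y - x)) by nra. nra.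
Qed.

(** Both factors of (x - 1) (a + b x + rho x^2) are nonpositive, since a is close to -1/2. *)
Lemma B_ge_1 (x : R) : 0 <= x <= 1 -> 1 <= B a b rho x.
Proof.
  intros Hx; unfold B.
  assert (Q : 0 <= x ^ 2 <= 1) by nra.
  assert (L : a + b * x + rho * x ^ 2 <= 0).
  { destruct Hbox as [[-> [Ha Hb]]|[-> [Ha Hb]]]; nra. }
  nra.
Qed.

Lemma p_positive (x : R) : 0 < x -> 0 < p a b rho x.
Proof.
  intros Hx; unfold p; destruct (Rle_dec x 1); [|lra].
  unfold p_poly; assert (H := B_ge_1 x ltac:(lra)); nra.
Qed.

(** B - 1 carries the factor x - 1, so the difference quotient at 1 is exactly the polynomial q. *)
Lemma left_derive_p : is_left_derive (p a b rho) 1 (1 + a + b + rho).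
Proof.
  unfold is_left_derive.
  pose (q := fun h => 1 + (1 + h) * (a + b * (1 + h) + rho * (1 + h) ^ 2)).
  apply (filterlim_ext_loc q).
  - exists (mkposreal 1 Rlt_0_1); intros h _ Hh; rewrite !p_on_unit by lra.
    unfold q, p_poly, B; field; lra.
  - replace (1 + a + b + rho) with (q 0) by (unfold q; ring).
    assert (C : continuous q 0).
    { apply (derive_continuous q 0 (Derive q 0)), Derive_correct; unfold q; auto_derive; trivial. }
    intros P HP; destruct (C P HP) as [eps He]; exists eps; intros y Hy _; exact (He y Hy).
Qed.

Lemma right_derive_p : is_right_derive (p a b rho) 1 0.
Proof.
  unfold is_right_derive; apply (filterlim_ext_loc (fun _ => 0)); [|apply filterlim_const].
  exists (mkposreal 1 Rlt_0_1); intros h _ Hh.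
  assert (E1 : p a b rho 1 = 1) by (rewrite p_on_unit by lra; unfold p_poly, B; ring).
  assert (E2 : p a b rho (1 + h) = 1) by (unfold p; destruct (Rle_dec (1 + h) 1); [lra|reflexivity]).
  rewrite E1, E2; field; lra.
Qed.

Lemma transverse_hits :
  transverse_hit a b rho (orbit a b rho 1) (Tm (orbit a b rho 1)) /\
  transverse_hit a b rho (orbit a b rho 1) (Tp (orbit a b rho 1)).
Proof.
  destruct (box_near rho a b Hbox) as [Ha _].
  assert (Ho := orbit_spec a b rho 1 Ha near0_1).
  destruct (orbit_unique a b rho 1 Ha near0_1 _ Ho) as [Em [Ep _]].
  assert (Ho' := Ho); destruct Ho' as [HT [_ [_ [_ [Zm [Zp _]]]]]].
  destruct (hm_spec a b rho 1 Ha near0_1) as [_ Sm]; destruct (hp_spec a b rho 1 Ha near0_1) as [_ Sp].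
  split; (split; [assumption|]).
  - rewrite Zm, (orbit_Y a b rho 1 _ Ho) by lra; rewrite Em, g_one.
    rewrite <- (slope_hit a b rho _ Sm). assert (H := slope_tm a b rho Ha); lra.
  - rewrite Zp, (orbit_Y a b rho 1 _ Ho) by lra; rewrite Ep, g_one.
    rewrite <- (slope_hit a b rho _ Sp). assert (H := slope_tp a b rho Ha); lra.
Qed.

End Response.

Theorem proposition9p3 :
  (* The orbits entering chi(1), lambda^-(x0) and their derivatives exist. *)
  (forall rho a0 a1 : R, parameter_box rho a0 a1 ->
     locally_2d (fun b0 b1 => is_orbit b0 b1 rho 1 (orbit b0 b1 rho 1)) a0 a1 /\
     locally 1 (fun x0 => is_orbit a0 a1 rho x0 (orbit a0 a1 rho x0))) /\
  (exists! a : R * R, parameter_point (1 / 20) (fst a) (snd a)) /\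
  (exists! a : R * R, parameter_point (-1 / 20) (fst a) (snd a)) /\
  (forall a0 a1 : R, parameter_point (1 / 20) a0 a1 ->
     (exists d : R,
        is_jacobian_det (fun b0 b1 => chi1 b0 b1 (1 / 20))
          (fun b0 b1 => lambda_minus b0 b1 (1 / 20) 1) a0 a1 d /\
        1.1941593312 <= d <= 1.1941593352) /\
     (exists l : R,
        is_derive (lambda_minus a0 a1 (1 / 20)) 1 l /\
        -0.1048330993 <= l <= -0.1048330959) /\
     (exists m : R,
        is_min_on (Derive (p_poly a0 a1 (1 / 20))) 0 1 m /\
        0.5120062563 <= m) /\
     (exists M : R,
        is_max_on (Derive_n (p_poly a0 a1 (1 / 20)) 2) 0 1 M /\
        M <= -0.8476526041) /\
     (exists l : R,
        is_left_derive (p a0 a1 (1 / 20)) 1 l /\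
        0.5120794896 <= l <= 0.5120794901) /\
     0.3413863264 <= beta_bio a0 a1 (1 / 20) <= 0.3413863267) /\
  (forall a0 a1 : R, parameter_point (-1 / 20) a0 a1 ->
     (exists d : R,
        is_jacobian_det (fun b0 b1 => chi1 b0 b1 (-1 / 20))
          (fun b0 b1 => lambda_minus b0 b1 (-1 / 20) 1) a0 a1 d /\
        1.2001493803 <= d <= 1.2001493843) /\
     (exists l : R,
        is_derive (lambda_minus a0 a1 (-1 / 20)) 1 l /\
        0.1050308568 <= l <= 0.1050308603) /\
     (exists m : R,
        is_min_on (Derive (p_poly a0 a1 (-1 / 20))) 0 1 m /\
        0.4878590474 <= m) /\
     (exists M : R,
        is_max_on (Derive_n (p_poly a0 a1 (-1 / 20)) 2) 0 1 M /\
        M <= -0.9570619837) /\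
     (exists l : R,
        is_left_derive (p a0 a1 (-1 / 20)) 1 l /\
        0.4879010047 <= l <= 0.4879010052) /\
     0.3252673364 <= beta_bio a0 a1 (-1 / 20) <= 0.3252673368) /\
  (forall rho a0 a1 : R, parameter_point rho a0 a1 ->
     transverse_hit a0 a1 rho (orbit a0 a1 rho 1) (Tm (orbit a0 a1 rho 1)) /\
     transverse_hit a0 a1 rho (orbit a0 a1 rho 1) (Tp (orbit a0 a1 rho 1)) /\
     (forall x, 0 <= x <= 1 -> 1 <= B a0 a1 rho x) /\
     (forall x, 0 < x -> 0 < p a0 a1 rho x) /\
     strictly_increasing_on (p a0 a1 rho) 0 1 /\
     strictly_concave_on (p a0 a1 rho) 0 1 /\
     (exists l : R, is_left_derive (p a0 a1 rho) 1 l /\ 0 < l) /\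
     is_right_derive (p a0 a1 rho) 1 0 /\
     beta_bio a0 a1 rho <> 0 /\
     (exists l : R,
        is_derive (lambda_minus a0 a1 rho) 1 l /\
        l <> 0 /\ sign l = - sign rho) /\
     (exists d : R,
        is_jacobian_det (fun b0 b1 => chi1 b0 b1 rho)
          (fun b0 b1 => lambda_minus b0 b1 rho 1) a0 a1 d /\
        d <> 0)).
Proof.
  split; [exact orbits_exist|]; split; [exact plus_root|]; split; [exact minus_root|].
  split; [|split].
  - intros a b Hp; destruct (plus_derivatives a b Hp) as [HD HL].
    assert (Hbox := proj1 Hp); destruct (Hbox) as [[_ [Ha Hb]]|[E _]]; [|lra].
    split; [exact HD|]; split; [exact HL|]; split; [|split; [|split]].
    + eexists; split; [apply dp_min, Hbox|rewrite dp_one; lra].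
    (* For rho > 0 the parabola p'' is convex, and its value at 1 exceeds that at 0, so the maximum
       is at x = 1. *)
    + exists (2 * (a - b) + 6 * (b - 1 / 20) * 1 + 12 * (1 / 20) * 1 ^ 2); split; [split|simpl; lra].
      * exists 1; split; [lra|apply Derive2_p_poly].
      * intros x Hx; rewrite Derive2_p_poly; nra.
    + exists (1 + a + b + 1 / 20); split; [apply left_derive_p|lra].
    + unfold beta_bio; lra.
  - intros a b Hp; destruct (minus_derivatives a b Hp) as [HD HL].
    assert (Hbox := proj1 Hp); destruct (Hbox) as [[E _]|[_ [Ha Hb]]]; [lra|].
    split; [exact HD|]; split; [exact HL|]; split; [|split; [|split]].
    + eexists; split; [apply dp_min, Hbox|rewrite dp_one; lra].
    (* For rho < 0 the parabola p'' is concave, with its vertex at 5 (b + 1/20), about 0.43, inside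
       [0, 1]. *)
    + exists (2 * (a - b) + 15 * (b + 1 / 20) ^ 2); split; [split|simpl; nra].
      * exists (5 * (b + 1 / 20)); split; [lra|]. rewrite Derive2_p_poly; field.
      * intros x Hx; rewrite Derive2_p_poly. assert (0 <= (x - 5 * (b + 1 / 20)) ^ 2) by apply pow2_ge_0. nra.
    + exists (1 + a + b + -1 / 20); split; [apply left_derive_p|lra].
    + unfold beta_bio; lra.
  - intros rho a b Hp; assert (Hbox := proj1 Hp).
    destruct (transverse_hits rho a b Hbox) as [T1 T2].
    split; [exact T1|]; split; [exact T2|].
    split; [now apply B_ge_1|]; split; [now apply p_positive|]; split; [now apply p_increasing|].
    split; [now apply p_concave|]; split.
    { exists (1 + a + b + rho); split; [apply left_derive_p|].
      rewrite <- dp_one; now apply dp_one_pos. }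
    split; [apply right_derive_p|]; split.
    { unfold beta_bio; assert (H := dp_one_pos rho a b Hbox); rewrite dp_one in H; lra. }
    destruct Hbox as [[-> _]|[-> _]].
    + destruct (plus_derivatives a b Hp) as [[D [HD BD]] [l [Hl Bl]]]; split.
      * exists l; split; [exact Hl|]; split; [lra|]. rewrite sign_eq_m1, (sign_eq_1 (1 / 20)); lra.
      * exists D; split; [exact HD|lra].
    + destruct (minus_derivatives a b Hp) as [[D [HD BD]] [l [Hl Bl]]]; split.
      * exists l; split; [exact Hl|]; split; [lra|]. rewrite sign_eq_1, (sign_eq_m1 (-1 / 20)); lra.
      * exists D; split; [exact HD|lra].
Qed.
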